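(* The following $\{o;c\}$-sequence $D$ with the following operations is a cofibrant replacement of $\mathcal{A}ct$ in the model category of $\mathcal{A}ct_{>0}$-infinitesimal bimodules. Put $D(n;c)=\Delta^{n}$ for $n\geq 0$, $D(n;o)=\Delta^{n-1}\times [0,1]$ for $n>0$, and $D$ empty otherwise, where $\Delta^n=\{0\le t_1\le\cdots\le t_n\le 1\}$. The structure is: \begin{itemize} \item $-\circ^{i}\ast_{2;c}: D(n;c)\to D(n+1;c)$, $(t_{1}\leq\cdots\leq t_{n})\mapsto(t_{1}\leq\cdots\leq t_{i}\leq t_{i}\leq\cdots\leq t_{n})$, $1\le i\le n$; \item $-\circ^{i}\ast_{2;c}: D(n;o)\to D(n+1;o)$, $(t_{1}\leq\cdots\leq t_{n-1})\times t\mapsto(t_{1}\leq\cdots\leq t_{i}\leq t_{i}\leq\cdots\leq t_{n-1})\times t$, $1\le i\le n-1$; \item $-\circ^{n}\ast_{2;o}: D(n;o)\to D(n+1;o)$, $(t_{1}\leq\cdots\leq t_{n-1})\times t\mapsto(t_{1}\leq\cdots\leq t_{n-1}\leq 1)\times t$; \item $\ast_{2;c}\circ_{2}-: D(n;c)\to D(n+1;c)$, $(t_{1}\leq\cdots\leq t_{n})\mapsto(0\leq t_{1}\leq\cdots\leq t_{n})$; \item $\ast_{2;c}\circ_{1}-: D(n;c)\to D(n+1;c)$, $(t_{1}\leq\cdots\leq t_{n})\mapsto(t_{1}\leq\cdots\leq t_{n}\leq 1)$; \item $\ast_{2;o}\circ_{2}-: D(n;o)\to D(n+1;o)$, $(t_{1}\leq\cdots\leq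 t_{n-1})\times t\mapsto(0\leq t_{1}\leq\cdots\leq t_{n-1})\times t$; \item $\ast_{2;o}\circ_{1}-: D(n;c)\to D(n+1;o)$, $(t_{1}\leq\cdots\leq t_{n})\mapsto(t_{1}\leq\cdots\leq t_{n})\times 1$. \end{itemize}
   Context: ''Space'' means compactly generated Hausdorff space. For a set $S$, an $S$-sequence is a family of spaces $O(s_1,\dots,s_n;s_{n+1})$, $n\ge 0$, $s_i\in S$. A (non-symmetric) $S$-operad is an $S$-sequence with partial compositions $\circ_i$ and units satisfying the usual axioms. For an $\{o;c\}$-sequence $M$ write $M(n;c)=M(c,\dots,c;c)$ ($n$ inputs $c$) and $M(n;o)=M(c,\dots,c,o;o)$ ($n-1$ inputs $c$ followed by one input $o$). $\mathcal{A}ct$ is the $\{o;c\}$-operad with $\mathcal{A}ct(n;c)=\{\ast_{n;c}\}$ for $n\ge0$, $\mathcal{A}ct(n;o)=\{\ast_{n;o}\}$ for $n>0$, and empty otherwise; $\mathcal{A}ct_{>0}$ is its suboperad consisting of $\ast_{n;c}$, $\ast_{n;o}$ for $n>0$; compositions are the unique ones. $\mathcal{A}ct_{>0}$ is generated as a coloured operad by $\ast_{2;c}$ and $\ast_{2;o}$, so the action of these elements determines an infinitesimal bimodule structure. An infinitesimal bimodule over an $S$-operad $O$ is an $S$-sequence $M$ with operations $\circ_i:O(s_1,\dots,s_n;s_{n+1})\times M(s'_1,\dots,s'_m;s_i)\to M(s_1,\dots,s_{i-1},s'_1,\dots,s'_m,s_{i+1},\dots,s_n;s_{n+1})$ and $\circ^i:M(s_1,\dots,s_n;s_{n+1})\times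 O(s'_1,\dots,s'_m;s_i)\to M(s_1,\dots,s_{i-1},s'_1,\dots,s'_m,s_{i+1},\dots,s_n;s_{n+1})$ satisfying the associativity and unit relations of operadic partial compositions in which exactly one factor lies in $M$. $\mathcal{A}ct$ is an $\mathcal{A}ct_{>0}$-infinitesimal bimodule via the inclusion of operads. The model structure on $O$-infinitesimal bimodules has componentwise weak homotopy equivalences and Serre fibrations as weak equivalences and fibrations. A cofibrant replacement of an object is a cofibrant object with a weak equivalence to it. *)

(* Defs.v *)
From HB Require Import structures.
From mathcomp Require Import all_boot all_order all_algebra.
From mathcomp Require Import all_classical all_reals all_analysis.

Set Implicit Arguments.
Unset Strict Implicit.
Unset Printing Implicit Defensive.

Import Order.TTheory GRing.Theory Num.Theory.
Import numFieldNormedType.Exports.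

Local Open Scope classical_set_scope.
Local Open Scope ring_scope.

Definition k_open (T : topologicalType) (A : set T) : Prop :=
  forall K : set T, compact K -> exists2 U, open U & U `&` K = A `&` K.

Record space := Space {
  space_sort :> topologicalType;
  space_hausdorff : hausdorff_space space_sort;
  space_cg : forall A : set space_sort, k_open A -> open A }.

(** [kify T] is [T] with the compactly generated topology; the product of
    [X] and [Y] in the category of compactly generated Hausdorff spaces is
    [kify (X * Y)]. *)
Definition kify (T : topologicalType) : Type := T.

Section KifyTopology.
Variable T : topologicalType.

HB.instance Definition _ := Choice.on (kify T).

Lemma k_openT : k_open [set: T].
Proof. by move=> K _; exists setT => //; exact: openT. Qed.

Lemma k_openI : setI_closed (@k_open T).
Proof.
move=> A B hA hB K cK; have [U oU UK] := hA K cK; have [V oV VK] := hB K cK.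
exists (U `&` V); first exact: openI.
by rewrite setIIl UK VK -setIIl.
Qed.

Lemma k_open_bigU (I : Type) (f : I -> set T) :
  (forall i, k_open (f i)) -> k_open (\bigcup_i f i).
Proof.
move=> hf K cK.
exists (\bigcup_(U in [set U | open U /\ exists i, U `&` K = f i `&` K]) U).
  by apply: bigcup_open => U [].
apply/seteqP; split => x.
  case=> -[U [_ [i e]] Ux] Kx; split=> //; exists i => //.
  by have [] : (f i `&` K) x by rewrite -e.
case=> -[i _ fx] Kx; split => //; have [U oU e] := hf i K cK.
exists U; first by split=> //; exists i.
by have [] : (U `&` K) x by rewrite e.
Qed.

HB.instance Definition _ :=
  isOpenTopological.Build (kify T) k_openT k_openI k_open_bigU.

End KifyTopology.

Lemma kify_openE (T : topologicalType) (A : set T) :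
  open (A : set (kify T)) = k_open A.
Proof. by []. Qed.

Lemma kify_continuous (X Y : topologicalType) (f : X -> Y) :
  continuous f -> continuous (f : kify X -> kify Y).
Proof.
move=> cf; apply/continuousP => A; rewrite !kify_openE => hA K cK.
have [|U oU e] := hA (f @` K).
  by apply: continuous_compact => //; exact: continuous_subspaceT.
exists (f @^-1` U); first by move/continuousP: cf; apply.
apply/seteqP; split => x [fx Kx]; split => //.
  by have [] : (A `&` f @` K) (f x) by rewrite -e; split => //; exists x.
by have [] : (U `&` f @` K) (f x) by rewrite e; split => //; exists x.
Qed.

Lemma continuous_comp_kify (X Y Z : topologicalType) (f : X -> Y)
    (h : kify Y -> Z) :
  continuous f -> continuous h -> continuous (fun x : kify X => h (f x)).
Proof.
move=> /kify_continuous/continuousP cf /continuousP ch.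
by apply/continuousP => A /ch /cf.
Qed.

Section CompactSubspace.
Variables (T : topologicalType) (A : set T).
Hypotheses (hT : hausdorff_space T) (cA : compact A).

Lemma set_type_hausdorff : hausdorff_space (set_type A).
Proof.
have cval : continuous (set_val : A -> T) by exact: initial_continuous.
move=> p q clpq; apply: val_inj; apply: hT => U V pU qV.
have [r [Ur Vr]] := clpq _ _ (cval p U pU) (cval q V qV).
by exists (set_val r).
Qed.

Lemma set_type_compact : compact [set: set_type A].
Proof.
have cval : continuous (set_val : A -> T) by exact: initial_continuous.
move=> F PF _; have FA : F (set_val @^-1` A).
  by apply: filterS filterT => -[y Ay] _; exact: set_mem Ay.
have PF' : ProperFilter (set_val @ F) by exact: fmap_proper_filter.
have [x [Ax clx]] : A `&` cluster (set_val @ F) !=set0 by exact: cA.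
exists (exist _ x (mem_set Ax)); split => // U V FU [W [[W' oW' eW'] Wx WV]].
have FU' : F (set_val @^-1` (set_val @` U)).
  by apply: filterS FU => u Uu; exists u.
have W'x : nbhs x W' by apply: open_nbhs_nbhs; split => //; move: Wx; rewrite -eW'.
have [y [[u Uu uy] W'y]] := clx _ _ FU' W'x.
by exists u; split => //; apply: WV; rewrite -eW' /= uy.
Qed.

Lemma set_type_cg (B : set (set_type A)) : k_open B -> open B.
Proof. by move=> /(_ _ set_type_compact)[U oU]; rewrite !setIT => <-. Qed.

Definition compact_space : space := Space set_type_hausdorff set_type_cg.

End CompactSubspace.

(** A composition [- \circ_i -] is indexed by a decomposition
    [l = a ++ s :: b] of the list of inputs, so that [i = size a + 1].  The
    lists of inputs of the arguments and of the result are constrained by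
    equations instead of being given by terms, so that the axioms below need
    no transport along equalities of lists. *)

Section Sequences.
Variable S : Type.

Definition sequence := seq S -> S -> space.

Identity Coercion sequence_Funclass : sequence >-> Funclass.

Definition pcomp (A B C : sequence) : Type :=
  forall (l a b m l' : seq S) (s t : S),
    l = a ++ s :: b -> l' = a ++ m ++ b -> A l t -> B m s -> C l' t.

Definition pcomp_continuous (A B C : sequence) (c : pcomp A B C) : Prop :=
  forall l a b m l' s t (e : l = a ++ s :: b) (e' : l' = a ++ m ++ b),
    continuous (fun p : kify (A l t * B m s)%type => c _ _ _ _ _ _ _ e e' p.1 p.2).

(** [(x \circ_i y) \circ_(i+j-1) z = x \circ_i (y \circ_j z)] *)
Definition seq_assoc (A B C AB BC ABC : sequence)
    (cAB : pcomp A B AB) (cAB_C : pcomp AB C ABC)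
    (cBC : pcomp B C BC) (cA_BC : pcomp A BC ABC) : Prop :=
  forall (l m n lm mn lmn a b c d : seq S) (s u t : S)
    (e1 : l = a ++ s :: b) (e1' : lm = a ++ m ++ b)
    (e2 : lm = (a ++ c) ++ u :: (d ++ b)) (e2' : lmn = (a ++ c) ++ n ++ (d ++ b))
    (e3 : m = c ++ u :: d) (e3' : mn = c ++ n ++ d)
    (e4' : lmn = a ++ mn ++ b)
    (x : A l t) (y : B m s) (z : C n u),
    cAB_C _ _ _ _ _ _ _ e2 e2' (cAB _ _ _ _ _ _ _ e1 e1' x y) z =
    cA_BC _ _ _ _ _ _ _ e1 e4' x (cBC _ _ _ _ _ _ _ e3 e3' y z).

(** [(x \circ_i y) \circ_(k+m-1) z = (x \circ_k z) \circ_i y] for [i < k],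
    where [m] is the number of inputs of [y] *)
Definition par_assoc (A B C AB AC ABC : sequence)
    (cAB : pcomp A B AB) (cAB_C : pcomp AB C ABC)
    (cAC : pcomp A C AC) (cAC_B : pcomp AC B ABC) : Prop :=
  forall (l m n lm ln lmn a b c : seq S) (s u t : S)
    (e1 : l = a ++ s :: (b ++ u :: c)) (e1' : lm = a ++ m ++ (b ++ u :: c))
    (e2 : lm = (a ++ m ++ b) ++ u :: c) (e2' : lmn = (a ++ m ++ b) ++ n ++ c)
    (e3 : l = (a ++ s :: b) ++ u :: c) (e3' : ln = (a ++ s :: b) ++ n ++ c)
    (e4 : ln = a ++ s :: (b ++ n ++ c)) (e4' : lmn = a ++ m ++ (b ++ n ++ c))
    (x : A l t) (y : B m s) (z : C n u),
    cAB_C _ _ _ _ _ _ _ e2 e2' (cAB _ _ _ _ _ _ _ e1 e1' x y) z =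
    cAC_B _ _ _ _ _ _ _ e4 e4' (cAC _ _ _ _ _ _ _ e3 e3' x z) y.

Definition left_unit (A B : sequence) (id : forall s, A [:: s] s)
    (c : pcomp A B B) : Prop :=
  forall l t (e : [:: t] = [::] ++ t :: [::]) (e' : l = [::] ++ l ++ [::])
    (x : B l t), c _ _ _ _ _ _ _ e e' (id t) x = x.

Definition right_unit (A B : sequence) (id : forall s, A [:: s] s)
    (c : pcomp B A B) : Prop :=
  forall l a b s t (e : l = a ++ s :: b) (e' : l = a ++ [:: s] ++ b)
    (x : B l t), c _ _ _ _ _ _ _ e e' x (id s) = x.

Record operad := Operad {
  op_seq :> sequence;
  op_id : forall s, op_seq [:: s] s;
  op_comp : pcomp op_seq op_seq op_seq;
  op_comp_continuous : pcomp_continuous op_comp;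
  op_seq_assoc : seq_assoc op_comp op_comp op_comp op_comp;
  op_par_assoc : par_assoc op_comp op_comp op_comp op_comp;
  op_left_unit : left_unit op_id op_comp;
  op_right_unit : right_unit op_id op_comp }.

Record operad_hom (O P : operad) := OperadHom {
  oh_fun :> forall l t, O l t -> P l t;
  oh_continuous : forall l t, continuous (@oh_fun l t);
  oh_id : forall s, oh_fun (op_id O s) = op_id P s;
  oh_comp : forall l a b m l' s t (e : l = a ++ s :: b) (e' : l' = a ++ m ++ b)
      (x : O l t) (y : O m s),
    oh_fun (op_comp e e' x y) = op_comp e e' (oh_fun x) (oh_fun y) }.

(** [ib_left] is [O \circ_i M] and [ib_right] is [M \circ^i O]. *)
Record infbimod_structure (O : operad) (M : sequence) := InfBimodStructure {
  ib_left : pcomp O M M;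
  ib_right : pcomp M O M;
  ib_left_continuous : pcomp_continuous ib_left;
  ib_right_continuous : pcomp_continuous ib_right;
  ib_seq_assoc1 : seq_assoc ib_right ib_right (@op_comp O) ib_right;
  ib_seq_assoc2 : seq_assoc ib_left ib_right ib_right ib_left;
  ib_seq_assoc3 : seq_assoc (@op_comp O) ib_left ib_left ib_left;
  ib_par_assoc1 : par_assoc ib_right ib_right ib_right ib_right;
  ib_par_assoc2 : par_assoc ib_left ib_right (@op_comp O) ib_left;
  ib_par_assoc3 : par_assoc (@op_comp O) ib_left ib_left ib_right;
  ib_left_unit : left_unit (op_id O) ib_left;
  ib_right_unit : right_unit (op_id O) ib_right }.

Record infbimod (O : operad) := InfBimod {
  ib_seq :> sequence;
  ib_str :> infbimod_structure O ib_seq }.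

Record infbimod_hom (O : operad) (M N : infbimod O) := InfBimodHom {
  ih_fun :> forall l t, M l t -> N l t;
  ih_continuous : forall l t, continuous (@ih_fun l t);
  ih_left : forall l a b m l' s t (e : l = a ++ s :: b)
      (e' : l' = a ++ m ++ b) (x : O l t) (y : M m s),
    ih_fun (ib_left M e e' x y) = ib_left N e e' x (ih_fun y);
  ih_right : forall l a b m l' s t (e : l = a ++ s :: b)
      (e' : l' = a ++ m ++ b) (x : M l t) (y : O m s),
    ih_fun (ib_right M e e' x y) = ib_right N e e' (ih_fun x) y }.

Section Restriction.
Variables (O P : operad) (f : operad_hom O P).

Definition restr_left : pcomp O P P :=
  fun l a b m l' s t e e' x y => op_comp e e' (f _ _ x) y.
Definition restr_right : pcomp P O P :=
  fun l a b m l' s t e e' x y => op_comp e e' x (f _ _ y).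

Lemma restr_left_continuous : pcomp_continuous restr_left.
Proof.
move=> l a b m l' s t e e'.
pose g (p : O l t * P m s) : P l t * P m s := (f _ _ p.1, p.2).
have cg : continuous g.
  move=> p; apply: cvg_pair; last exact: cvg_snd.
  by apply: continuous_comp; [exact: cvg_fst|exact: oh_continuous].
exact: continuous_comp_kify cg (op_comp_continuous (o := P) (e := e) (e' := e')).
Qed.

Lemma restr_right_continuous : pcomp_continuous restr_right.
Proof.
move=> l a b m l' s t e e'.
pose g (p : P l t * O m s) : P l t * P m s := (p.1, f _ _ p.2).
have cg : continuous g.
  move=> p; apply: cvg_pair; first exact: cvg_fst.
  by apply: continuous_comp; [exact: cvg_snd|exact: oh_continuous].
exact: continuous_comp_kify cg (op_comp_continuous (o := P) (e := e) (e' := e')).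
Qed.

Lemma restr_structure : infbimod_structure O P.
Proof.
apply: (@InfBimodStructure O P restr_left restr_right).
- exact: restr_left_continuous.
- exact: restr_right_continuous.
- by move=> *; rewrite /restr_right oh_comp; exact: op_seq_assoc.
- by move=> *; exact: op_seq_assoc.
- by move=> *; rewrite /restr_left oh_comp; exact: op_seq_assoc.
- by move=> *; exact: op_par_assoc.
- by move=> *; rewrite /restr_left oh_comp; exact: op_par_assoc.
- by move=> *; rewrite /restr_left oh_comp; exact: op_par_assoc.
- by move=> l t e e' x; rewrite /restr_left oh_id; exact: op_left_unit.
- by move=> l a b s t e e' x; rewrite /restr_right oh_id; exact: op_right_unit.
Defined.

Definition restr_infbimod : infbimod O := InfBimod restr_structure.

End Restriction.

Section PointOperad.

(** A point if [p] holds, empty otherwise. *)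
Definition point_set (p : Prop) : set bool := [set b | b = true /\ p].

Lemma point_set_compact p : compact (point_set p).
Proof.
have [hp|np] := pselect p.
  suff -> : point_set p = [set true] by exact: compact_set1.
  by apply/seteqP; split => b [].
suff -> : point_set p = set0 by exact: compact0.
by apply/seteqP; split => b [].
Qed.

Definition point_space (p : Prop) : space :=
  compact_space discrete_hausdorff (@point_set_compact p).

Definition pt (p : Prop) (h : p) : point_space p :=
  exist _ true (mem_set (conj erefl h)).

Lemma pt_prop (p : Prop) (x : point_space p) : p.
Proof. by case: x => b /= /set_mem[]. Qed.

Lemma pt_eq (p : Prop) (x y : point_space p) : x = y.
Proof.
apply: val_inj; case: x y => [b1 h1] [b2 h2] /=.
by have [-> _] := set_mem h1; have [-> _] := set_mem h2.
Qed.

Lemma pt_continuous (T : topologicalType) p (f : T -> point_space p) :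
  continuous f.
Proof.
move=> x; suff -> : f = fun=> f x by exact: cvg_cst.
by apply/funext => y; exact: pt_eq.
Qed.

Variable P : seq S -> S -> Prop.
Hypothesis P_id : forall s, P [:: s] s.
Hypothesis P_comp : forall (l a b m l' : seq S) (s t : S),
  l = a ++ s :: b -> l' = a ++ m ++ b -> P l t -> P m s -> P l' t.

Definition point_sequence : sequence := fun l t => point_space (P l t).

Definition point_comp : pcomp point_sequence point_sequence point_sequence :=
  fun l a b m l' s t e e' x y => pt (P_comp e e' (pt_prop x) (pt_prop y)).

Definition point_operad : operad.
Proof.
apply: (@Operad point_sequence (fun s => pt (P_id s)) point_comp).
- by move=> *; exact: pt_continuous.
- by move=> *; exact: pt_eq.
- by move=> *; exact: pt_eq.
- by move=> *; exact: pt_eq.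
- by move=> *; exact: pt_eq.
Defined.

End PointOperad.

Definition point_operad_hom (P Q : seq S -> S -> Prop) hP1 hP2 hQ1 hQ2
    (PQ : forall l t, P l t -> Q l t) :
  operad_hom (@point_operad P hP1 hP2) (@point_operad Q hQ1 hQ2).
Proof.
apply: (@OperadHom (@point_operad P hP1 hP2) (@point_operad Q hQ1 hQ2)
  (fun l t (x : point_space (P l t)) => pt (PQ l t (pt_prop x)))).
- by move=> *; exact: pt_continuous.
- by move=> *; exact: pt_eq.
- by move=> *; exact: pt_eq.
Defined.

Section Empty.
Variable O : operad.

Lemma point_False (T : Type) : point_space False -> T.
Proof. by move/pt_prop. Qed.

Definition empty_sequence : sequence := fun _ _ => point_space False.

Definition empty_left : pcomp O empty_sequence empty_sequence :=
  fun l a b m l' s t e e' _ y => y.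
Definition empty_right : pcomp empty_sequence O empty_sequence :=
  fun l a b m l' s t e e' x _ => x.

Definition empty_infbimod : infbimod O.
Proof.
apply: (@InfBimod O empty_sequence).
apply: (@InfBimodStructure O empty_sequence empty_left empty_right);
  by move=> *; try exact: pt_continuous; exact: pt_eq.
Defined.

Definition from_empty (M : infbimod O) : infbimod_hom empty_infbimod M.
Proof.
apply: (@InfBimodHom O empty_infbimod M (fun l t => @point_False _)).
- by move=> l t x; case: (pt_prop x).
- by move=> l a b m l' s t e e' x y; case: (pt_prop y).
- by move=> l a b m l' s t e e' x y; case: (pt_prop x).
Defined.

Lemma empty_initial (M : infbimod O) (f g : infbimod_hom empty_infbimod M) l t :
  f l t = g l t.
Proof. by apply/funext => x; case: (pt_prop x). Qed.

End Empty.

End Sequences.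

Arguments op_id {S}.
Arguments op_comp {S} _ {l a b m l' s t}.
Arguments ib_left {S O M} _ {l a b m l' s t}.
Arguments ib_right {S O M} _ {l a b m l' s t}.

Section Homotopy.
Variable R : realType.

Definition itv : topologicalType := set_type `[0 : R, 1 : R].

Lemma itv_in0 : `[0 : R, 1 : R]%classic 0.
Proof. by rewrite /= in_itv /= lexx ler01. Qed.

Lemma itv_in1 : `[0 : R, 1 : R]%classic 1.
Proof. by rewrite /= in_itv /= lexx ler01. Qed.

Definition itv0 : itv := exist _ 0 (mem_set itv_in0).
Definition itv1 : itv := exist _ 1 (mem_set itv_in1).

Definition cube_set (n : nat) : set 'rV[R]_n :=
  [set u | forall i, `[0 : R, 1 : R]%classic (u ord0 i)].

Definition cube (n : nat) : topologicalType := set_type (@cube_set n).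

Definition cube_val (n : nat) (u : cube n) : 'rV[R]_n :=
  set_val (u : set_type (@cube_set n)).

Definition cube_boundary (n : nat) : set (cube n) :=
  [set u | exists i, cube_val u ord0 i = 0 \/ cube_val u ord0 i = 1].

Section Spaces.
Variables X Y : topologicalType.

Definition path_connected (x y : X) : Prop :=
  exists g : itv -> X, [/\ continuous g, g itv0 = x & g itv1 = y].

(** Representatives of elements of [\pi_n(X, x)]. *)
Definition sphere_map (n : nat) (x : X) (al : cube n -> X) : Prop :=
  continuous al /\ forall u, cube_boundary u -> al u = x.

Definition homotopic_rel_boundary (n : nat) (al be : cube n -> X) : Prop :=
  exists H : (cube n * itv)%type -> X,
    [/\ continuous H,
        forall u, H (u, itv0) = al u,
        forall u, H (u, itv1) = be u
      & forall u s, cube_boundary u -> H (u, s) = al u].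

End Spaces.

(** [f] induces a bijection on path components and, for every [n >= 1] and
    every base point, a bijection of homotopy groups [\pi_n]. *)
Definition weak_homotopy_equivalence (X Y : topologicalType) (f : X -> Y) : Prop :=
  [/\ continuous f,
      (forall x x', path_connected (f x) (f x') -> path_connected x x') /\
      (forall y, exists x, path_connected (f x) y)
    & forall (n : nat) (x : X), (0 < n)%N ->
      (forall al al' : cube n -> X, sphere_map x al -> sphere_map x al' ->
         homotopic_rel_boundary (f \o al) (f \o al') ->
         homotopic_rel_boundary al al') /\
      (forall be : cube n -> Y, sphere_map (f x) be ->
         exists2 al : cube n -> X, sphere_map x al &
           homotopic_rel_boundary (f \o al) be)].

Definition serre_fibration (X Y : topologicalType) (p : X -> Y) : Prop :=
  continuous p /\
  forall (n : nat) (g : cube n -> X) (H : (cube n * itv)%type -> Y),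
    continuous g -> continuous H -> (forall u, H (u, itv0) = p (g u)) ->
    exists G : (cube n * itv)%type -> X,
      [/\ continuous G, forall u, G (u, itv0) = g u & forall q, p (G q) = H q].

Section Model.
Variables (S : Type) (O : operad S).

Definition weak_equivalence (M N : infbimod O) (f : infbimod_hom M N) : Prop :=
  forall l t, weak_homotopy_equivalence (f l t).

Definition fibration (M N : infbimod O) (f : infbimod_hom M N) : Prop :=
  forall l t, serre_fibration (f l t).

Definition left_lifting (A B X Y : infbimod O)
    (i : infbimod_hom A B) (p : infbimod_hom X Y) : Prop :=
  forall (f : infbimod_hom A X) (g : infbimod_hom B Y),
    (forall l t a, p l t (f l t a) = g l t (i l t a)) ->
    exists h : infbimod_hom B X,
      (forall l t a, h l t (i l t a) = f l t a) /\
      (forall l t b, p l t (h l t b) = g l t b).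

(** As in any model category, the cofibrations are determined by the weak
    equivalences and the fibrations. *)
Definition cofibration (A B : infbimod O) (i : infbimod_hom A B) : Prop :=
  forall (X Y : infbimod O) (p : infbimod_hom X Y),
    fibration p -> weak_equivalence p -> left_lifting i p.

(** [empty_infbimod] is the initial object, see [empty_initial]. *)
Definition cofibrant (M : infbimod O) : Prop := cofibration (from_empty M).

Definition cofibrant_replacement (M N : infbimod O) : Prop :=
  cofibrant M /\ exists f : infbimod_hom M N, weak_equivalence f.

End Model.

End Homotopy.

Inductive color := col_o | col_c.

(** The inputs of [M(n; t)]: [n] inputs [c] if [t = c]; [n - 1] inputs [c]
    followed by one input [o] if [t = o].  As [inputs 0 col_o] has length one,
    [has_inputs l col_o] forces [l] to be nonempty. *)
Definition inputs (n : nat) (t : color) : seq color :=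
  match t with
  | col_c => nseq n col_c
  | col_o => rcons (nseq n.-1 col_c) col_o
  end.

Definition has_inputs (l : seq color) (t : color) : Prop :=
  l = inputs (size l) t.

Lemma has_inputs_id s : has_inputs [:: s] s.
Proof. by case: s. Qed.

Lemma has_inputs_cP l : has_inputs l col_c <-> exists n, l = nseq n col_c.
Proof.
split; first by move=> h; exists (size l).
by case=> n ->; rewrite /has_inputs /= size_nseq.
Qed.

Lemma has_inputs_oP l :
  has_inputs l col_o <-> exists n, l = rcons (nseq n col_c) col_o.
Proof.
split; first by move=> h; exists (size l).-1.
by case=> n ->; rewrite /has_inputs /= size_rcons size_nseq.
Qed.

Lemma nseq_cat_inv (n : nat) (a b : seq color) (s : color) :
  nseq n col_c = a ++ s :: b ->
  [/\ s = col_c, a = nseq (size a) col_c & b = nseq (size b) col_c].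
Proof.
elim: a n => [|x a ih] [|n] //= [].
  by move=> <- <-; rewrite size_nseq.
by move=> <- /ih[-> ea eb]; split => //; rewrite -ea.
Qed.

Lemma rcons_cat_inv (n : nat) (a b : seq color) (s : color) :
  rcons (nseq n col_c) col_o = a ++ s :: b ->
  a = nseq (size a) col_c /\
  match s with
  | col_o => b = [::]
  | col_c => exists k, b = rcons (nseq k col_c) col_o
  end.
Proof.
elim: a n => [|x a ih] [|n] //=.
- by case=> <- <-.
- by case=> <- <-; split => //; exists n.
- by case=> _; case: a {ih}.
- by case=> <- /ih[ea eb]; split => //; rewrite -ea.
Qed.

Lemma has_inputs_comp (l a b m l' : seq color) (s t : color) :
  l = a ++ s :: b -> l' = a ++ m ++ b ->
  has_inputs l t -> has_inputs m s -> has_inputs l' t.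
Proof.
move=> el -> ; case: t; last first.
  move=> /has_inputs_cP[n en]; move: el; rewrite en => /nseq_cat_inv[-> ea eb].
  move=> /has_inputs_cP[k ->]; apply/has_inputs_cP; rewrite ea eb.
  by exists (size a + (k + size b))%N; rewrite !nseqD.
move=> /has_inputs_oP[n en]; move: el; rewrite en => /rcons_cat_inv[ea].
rewrite ea; case: s => [->|[k ->]].
  move=> /has_inputs_oP[j ->]; apply/has_inputs_oP; exists (size a + j)%N.
  by rewrite cats0 nseqD -rcons_cat.
move=> /has_inputs_cP[j ->]; apply/has_inputs_oP.
by exists (size a + (j + k))%N; rewrite !nseqD -!rcons_cat.
Qed.

Definition has_inputs_pos (l : seq color) (t : color) : Prop :=
  l <> [::] /\ has_inputs l t.

Lemma has_inputs_pos_id s : has_inputs_pos [:: s] s.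
Proof. by split => //; exact: has_inputs_id. Qed.

Lemma has_inputs_pos_comp (l a b m l' : seq color) (s t : color) :
  l = a ++ s :: b -> l' = a ++ m ++ b ->
  has_inputs_pos l t -> has_inputs_pos m s -> has_inputs_pos l' t.
Proof.
move=> el el' [_ hl] [m0 hm]; split; last exact: has_inputs_comp el el' hl hm.
by rewrite el'; case: (a) => // ; case: (m) m0.
Qed.

Definition Act : operad color := point_operad has_inputs_id has_inputs_comp.

Definition Act_pos : operad color :=
  point_operad has_inputs_pos_id has_inputs_pos_comp.

Definition Act_pos_incl : operad_hom Act_pos Act :=
  point_operad_hom _ _ _ _ (fun l t (h : has_inputs_pos l t) => proj2 h).

Definition Act_bimod : infbimod Act_pos := restr_infbimod Act_pos_incl.

Lemma has_inputs_pos2 (s : color) : has_inputs_pos [:: col_c; s] s.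
Proof. by case: s. Qed.

Definition ast2c : Act_pos [:: col_c; col_c] col_c := pt (has_inputs_pos2 col_c).
Definition ast2o : Act_pos [:: col_c; col_o] col_o := pt (has_inputs_pos2 col_o).

Section D.
Variable R : realType.

Definition coords (n : nat) (x : 'rV[R]_n) : seq R := [seq x ord0 i | i : 'I_n].

(** [0 <= t_1 <= ... <= t_n <= 1] *)
Definition simplex (n : nat) : set 'rV[R]_n :=
  [set x | path <=%R 0 (rcons (coords x) 1)].

(** [size l] is the number [n] of inputs. *)
Definition D_c_set (l : seq color) : set 'rV[R]_(size l) :=
  [set x | has_inputs l col_c /\ simplex x].

Definition D_o_set (l : seq color) : set ('rV[R]_(size l).-1 * R) :=
  [set p | has_inputs l col_o /\ (@simplex _ `*` `[0 : R, 1 : R]%classic) p].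

Lemma nth_coords n (x : 'rV[R]_n) (i : 'I_n) : nth 0 (coords x) i = x ord0 i.
Proof.
by rewrite (nth_map i) ?size_enum_ord ?ltn_ord // nth_ord_enum.
Qed.

Lemma size_coords n (x : 'rV[R]_n) : size (coords x) = n.
Proof. by rewrite size_map size_enum_ord. Qed.

Lemma nth_coords_continuous n i :
  continuous (fun x : 'rV[R]_n => nth 0 (0 :: rcons (coords x) 1) i).
Proof.
case: i => [|i]; first exact: (@cst_continuous _ _ (0 : R)).
have [ltin|leni] := ltnP i n.
  rewrite (_ : (fun _ => _) = fun x : 'rV[R]_n => x ord0 (Ordinal ltin)).
    exact: coord_continuous.
  apply/funext => x /=; rewrite nth_rcons size_coords ltin.
  exact: (nth_coords x (Ordinal ltin)).
rewrite (_ : (fun _ => _) = fun=> (if i == n then 1 else 0)).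
  exact: (@cst_continuous _ _ (if i == n then 1 else 0 : R)).
by apply/funext => x /=; rewrite nth_rcons size_coords ltnNge leni.
Qed.

Lemma simplex_closed n : closed (@simplex n).
Proof.
have -> : @simplex n = \bigcap_(i in [set i | (i < n.+1)%N])
    [set x | nth 0 (0 :: rcons (coords x) 1) i <=
             nth 0 (0 :: rcons (coords x) 1) i.+1].
  apply/seteqP; split => x.
    by move=> /(pathP 0) h i ltin; apply: h; rewrite size_rcons size_coords.
  by move=> h; apply/(pathP 0) => i; rewrite size_rcons size_coords; exact: h.
apply: closed_bigI => i _.
rewrite (_ : [set x | _] = (fun x : 'rV[R]_n =>
    nth 0 (0 :: rcons (coords x) 1) i.+1 - nth 0 (0 :: rcons (coords x) 1) i)
    @^-1` [set r | 0 <= r]); last first.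
  by apply/seteqP; split => x /=; rewrite subr_ge0.
apply: closed_comp; last exact: closed_ge.
move=> x _.
exact: (@continuousB R R^o _ _ _ _ (@nth_coords_continuous n i.+1 x) (@nth_coords_continuous n i x)).
Qed.

Lemma simplex_sub n (x : 'rV[R]_n) : simplex x -> forall i, `[0 : R, 1 : R]%classic (x ord0 i).
Proof.
move=> hx i; have hs : sorted <=%R (0 :: rcons (coords x) 1) by exact: hx.
have hle := sorted_leq_nth le_trans lexx 0 hs.
have isz : (i < size (coords x))%N by rewrite size_coords.
rewrite /= in_itv /= -nth_coords; apply/andP; split.
  have := hle 0%N i.+1; rewrite !inE /= nth_rcons isz; apply => //.
  by rewrite ltnS size_rcons; exact: ltnW.
have := hle i.+1 (size (coords x)).+1; rewrite !inE /= !nth_rcons isz ltnn eqxx.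
by apply; rewrite ?ltnS ?size_rcons // ?ltnS; exact: ltnW.
Qed.

Lemma simplex_compact n : compact (@simplex n).
Proof.
apply: (subclosed_compact (@simplex_closed n)
  (rV_compact (A := fun=> `[0 : R, 1]%classic) (fun=> @segment_compact R 0 1))).
by move=> x /simplex_sub.
Qed.

Lemma compact_and (T : topologicalType) (P : Prop) (A : set T) :
  compact A -> compact [set x | P /\ A x].
Proof.
move=> cA; have [p|np] := pselect P.
  by rewrite (_ : mkset _ = A) //; apply/seteqP; split => x //= [].
by rewrite (_ : mkset _ = set0); [exact: compact0|apply/seteqP; split => x []].
Qed.

Lemma D_c_compact l : compact (@D_c_set l).
Proof. by apply: compact_and; exact: simplex_compact. Qed.

Lemma D_o_compact l : compact (@D_o_set l).
Proof.
apply: compact_and; apply: compact_setX; first exact: simplex_compact.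
exact: segment_compact.
Qed.

Lemma prod_norm_hausdorff n : hausdorff_space ('rV[R]_n * R)%type.
Proof. exact: norm_hausdorff. Qed.

Definition D_seq : sequence color := fun l t =>
  match t with
  | col_c => compact_space (@norm_hausdorff _ _) (@D_c_compact l)
  | col_o => compact_space (@prod_norm_hausdorff _) (@D_o_compact l)
  end.

Definition D_c_pts (l : seq color) (x : D_seq l col_c) : seq R :=
  coords (set_val (x : set_type (@D_c_set l))).

Definition D_o_pts (l : seq color) (x : D_seq l col_o) : seq R * R :=
  let p := set_val (x : set_type (@D_o_set l)) in (coords p.1, p.2).

(** [t_1 <= ... <= t_i <= t_i <= ... <= t_n] *)
Definition repeat_at (i : nat) (s : seq R) : seq R := take i s ++ drop i.-1 s.

(** In the first two clauses the position of the input is [i = size a + 1];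
    since [l] must have the form [c, ..., c] or [c, ..., c, o] for [x] to
    exist, this covers [1 <= i <= n] and [1 <= i <= n - 1] respectively. *)
Record D_operations (B : infbimod_structure Act_pos D_seq) : Prop := {
  D_c_right_ast2c : forall l a b l' (e : l = a ++ col_c :: b)
      (e' : l' = a ++ [:: col_c; col_c] ++ b) (x : D_seq l col_c),
    D_c_pts (ib_right B e e' x ast2c) = repeat_at (size a).+1 (D_c_pts x);
  D_o_right_ast2c : forall l a b l' (e : l = a ++ col_c :: b)
      (e' : l' = a ++ [:: col_c; col_c] ++ b) (x : D_seq l col_o),
    D_o_pts (ib_right B e e' x ast2c) =
      (repeat_at (size a).+1 (D_o_pts x).1, (D_o_pts x).2);
  D_o_right_ast2o : forall l a l' (e : l = a ++ col_o :: [::])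
      (e' : l' = a ++ [:: col_c; col_o] ++ [::]) (x : D_seq l col_o),
    D_o_pts (ib_right B e e' x ast2o) =
      (rcons (D_o_pts x).1 1, (D_o_pts x).2);
  D_ast2c_left2 : forall l l'
      (e : [:: col_c; col_c] = [:: col_c] ++ col_c :: [::])
      (e' : l' = [:: col_c] ++ l ++ [::]) (x : D_seq l col_c),
    D_c_pts (ib_left B e e' ast2c x) = 0 :: D_c_pts x;
  D_ast2c_left1 : forall l l'
      (e : [:: col_c; col_c] = [::] ++ col_c :: [:: col_c])
      (e' : l' = [::] ++ l ++ [:: col_c]) (x : D_seq l col_c),
    D_c_pts (ib_left B e e' ast2c x) = rcons (D_c_pts x) 1;
  D_ast2o_left2 : forall l l'
      (e : [:: col_c; col_o] = [:: col_c] ++ col_o :: [::])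
      (e' : l' = [:: col_c] ++ l ++ [::]) (x : D_seq l col_o),
    D_o_pts (ib_left B e e' ast2o x) = (0 :: (D_o_pts x).1, (D_o_pts x).2);
  D_ast2o_left1 : forall l l'
      (e : [:: col_c; col_o] = [::] ++ col_c :: [:: col_o])
      (e' : l' = [::] ++ l ++ [:: col_o]) (x : D_seq l col_c),
    D_o_pts (ib_left B e e' ast2o x) = (D_c_pts x, 1) }.

End D.

(* Main.v *)
Require Import Defs.
From mathcomp Require Import all_boot all_order all_algebra.
From mathcomp Require Import all_classical all_reals all_analysis.
From mathcomp Require Import ring lra zify.

(** An infinitesimal bimodule over [Act_pos] amounts to two semi-cosimplicial
    spaces (one for each color) and a map between them, given by
    [ast2o \circ_1 -].  In [D] the coface maps are the inclusions of the faces
    of the simplices, so a map out of [D] can be built by induction on the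
    dimension: at output color [c] one extends a map from the boundary of a
    simplex to the simplex, at output color [o] one extends a map from an open
    box to a prism.  A trivial Serre fibration has the lifting property for the
    former, and any Serre fibration for the latter.  Both are deduced from the
    case of cubes, of which simplices and prisms are quotients that identify
    points of the boundary only.  Finally [D] is componentwise convex, or empty
    when [Act] is. *)

Set Implicit Arguments.
Unset Strict Implicit.
Unset Printing Implicit Defensive.

Import Order.TTheory GRing.Theory Num.Theory.
Import numFieldNormedType.Exports.

Local Open Scope classical_set_scope.
Local Open Scope ring_scope.

(** * Continuity on subsets and lifting properties *)

Section ContinuityOn.

(** Only based problems are solved, in which the partial lift is constant on the face where the last
    coordinate vanishes. They suffice for simplices, because the parametrization by products
    [t_j = u_j * ... * u_n] collapses exactly that face to a vertex.

    Cubes and simplices of every dimension live in one space of real sequences: cubes are padded by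
    0, simplices by [t_0 = 0] and by 1 beyond the last coordinate. A cube is then literally a face
    of the next one, and cofaces and bimodule operations become reindexings of sequences, whose
    identities are arithmetic on natural numbers; inserting a last coordinate 1 even becomes the
    identity. The price is that maps are total and continuous on a subset only, which [contOn]
    expresses.

    The operations on [D] are specified on generators alone, and cofibrancy is proved from these
    values: arbitrary compositions are factored into actions of [ast2c] and [ast2o]. *)

Definition contOn (T U : topologicalType) (A : set T) (f : T -> U) : Prop :=
  forall x, A x -> f @ within A (nbhs x) --> f x.

Variables T U V : topologicalType.

Lemma contOnT (A : set T) (f : T -> U) : continuous f -> contOn A f.
Proof. by move=> cf x _; apply: cvg_within_filter; exact: cf. Qed.

Lemma contOn_setT (f : T -> U) : contOn setT f -> continuous f.
Proof. by move=> cf x; have := cf x I; rewrite withinET. Qed.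

Lemma contOn_comp (A : set T) (B : set U) (f : T -> U) (g : U -> V) :
  contOn A f -> contOn B g -> (forall x, A x -> B (f x)) ->
  contOn A (g \o f).
Proof.
move=> cf cg AB x Ax; apply: cvg_comp (cg _ (AB _ Ax)) => D BD.
have := cf _ Ax _ BD; rewrite /nbhs /= /within /=.
by apply: filterS => y AD Ay; apply: AD => //; exact: AB.
Qed.

Lemma contOnS (A B : set T) (f : T -> U) :
  B `<=` A -> contOn A f -> contOn B f.
Proof.
move=> BA cf x Bx D /(cf _ (BA _ Bx)); rewrite /nbhs /= /within /=.
by apply: filterS => y AD /BA; exact: AD.
Qed.

Lemma contOn_eq (A : set T) (f g : T -> U) :
  (forall x, A x -> f x = g x) -> contOn A f -> contOn A g.
Proof.
move=> fg cf x Ax; rewrite -fg //; apply: cvg_trans (cf _ Ax).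
by apply: fmap_within_eq => y /set_mem Ay; rewrite fg.
Qed.

Lemma contOn_closed (A : set T) (f : T -> U) (C : set U) :
  closed A -> contOn A f -> closed C -> closed (A `&` f @^-1` C).
Proof.
move=> cA cf cC x clx; have Ax : A x by apply: cA => N /clx[y [[]]]; exists y.
split => //; apply: cC => N /(cf _ Ax); rewrite /nbhs /= /within /= => fN.
by have [y [[Ay Cy] Ny]] := clx _ fN; exists (f y); split => //; exact: Ny.
Qed.

(** Closedness is asked in the whole space. With [C] everything this makes [A] closed, which is why
    the gluing lemmas below take closed pieces. *)
Lemma contOn_of_closed (A : set T) (f : T -> U) :
  (forall C, closed C -> closed (A `&` f @^-1` C)) -> contOn A f.
Proof.
move=> h x Ax N; rewrite nbhsE => -[Q [oQ Qfx] QN].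
have cl : closed (A `&` f @^-1` (~` Q)) by apply: h; exact: open_closedC.
rewrite /nbhs /= /within /=.
suff : nbhs x (~` (A `&` f @^-1` (~` Q))).
  by apply: filterS => y nAy Ay; apply: QN; apply: contrapT => nQ; exact: nAy.
by apply: open_nbhs_nbhs; split; [exact: closed_openC|case].
Qed.

End ContinuityOn.

Lemma contOn_comp_continuous (T U V : topologicalType) (A : set U)
    (f : T -> U) (g : U -> V) :
  continuous f -> contOn A g -> (forall x, A (f x)) -> continuous (g \o f).
Proof.
by move=> cf cg Af; apply: contOn_setT; exact: contOn_comp (contOnT cf) cg _.
Qed.

Lemma contOn_glue_finite (T U : topologicalType) (n : nat) (F : nat -> set T)
    (f : T -> U) :
  (forall i, (i < n)%N -> closed (F i)) ->
  (forall i, (i < n)%N -> contOn (F i) f) ->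
  contOn (\bigcup_(i in [set i | (i < n)%N]) F i) f.
Proof.
move=> cF cf; apply: contOn_of_closed => C cC.
rewrite setI_bigcupl; apply: closed_bigcup; first exact: finite_II.
by move=> i /= ltin; apply: contOn_closed => //; [exact: cF|exact: cf].
Qed.

Lemma contOnU (T U : topologicalType) (A B : set T) (f : T -> U) :
  closed A -> closed B -> contOn A f -> contOn B f -> contOn (A `|` B) f.
Proof.
move=> cA cB fA fB; apply: contOn_of_closed => C cC; rewrite setIUl.
by apply: closedU; exact: contOn_closed.
Qed.

Lemma contOn_compact (T U : topologicalType) (A : set T) (f : T -> U) :
  contOn A f -> compact A -> compact (f @` A).
Proof. by move=> cf; apply: continuous_compact; apply/subspace_continuousP. Qed.

(* A continuous surjection of a compact set onto a subset of a Hausdorff space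
   is a closed map, hence a quotient map. *)
Lemma contOn_descend (T T' U : topologicalType) (K : set T) (r : T -> T')
    (h : T' -> U) :
  hausdorff_space T -> hausdorff_space T' -> compact K -> contOn K r ->
  contOn K (h \o r) -> contOn (r @` K) h.
Proof.
move=> hT hT' cK cr chr; apply: contOn_of_closed => C cC.
have clK : closed K by exact: compact_closed.
have -> : (r @` K) `&` h @^-1` C = r @` (K `&` (h \o r) @^-1` C).
  apply/seteqP; split => [_ [[x Kx <-] Cx]|_ [x [Kx Cx] <-]]; first by exists x.
  by split => //; exists x.
apply: compact_closed => //; apply: contOn_compact.
  by apply: contOnS cr => x [].
apply: subclosed_compact cK _; last by move=> x [].
exact: contOn_closed.
Qed.

(** * Lifting problems between subsets and their descent along quotient maps *)

Section Lifting.
Variables (X Y : topologicalType) (p : X -> Y).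

Definition liftable (T : topologicalType) (A B : set T) (g : T -> X)
    (f : T -> Y) : Prop :=
  exists h : T -> X, [/\ contOn B h, forall w, A w -> h w = g w
    & forall w, B w -> p (h w) = f w].

(* The lifting property of [p] against the inclusion of [A] into [B]; the maps
   are total, only their restrictions to [A] and [B] matter. *)
Definition lifts (T : topologicalType) (A B : set T) : Prop :=
  forall (g : T -> X) (f : T -> Y), contOn A g -> contOn B f ->
    (forall w, A w -> p (g w) = f w) -> liftable A B g f.

Section Descent.
Variables (T T' : topologicalType) (A B : set T) (A' B' : set T') (r : T -> T').
Hypotheses (hT : hausdorff_space T) (hT' : hausdorff_space T').
Hypotheses (cB : compact B) (A'B' : A' `<=` B') (AB : A `<=` B).
Hypotheses (cr : contOn B r) (rB : r @` B = B').
Hypothesis AA' : forall w, B w -> A w <-> A' (r w).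
Hypothesis rinj :
  forall w w', B w -> B w' -> ~ A w -> r w = r w' -> w = w'.

(** The map [r] identifies points of [A] only, and there the lift is prescribed by [g \o r], so a
    lift upstairs is constant on the fibres of [r]. The statement concerns a single problem because
    [simplex_lifts] can solve upstairs only the problems that are based. *)
Lemma liftable_descend (g : T' -> X) (f : T' -> Y) :
  liftable A B (g \o r) (f \o r) -> liftable A' B' g f.
Proof.
move=> [h [ch hA hB]].
(* A preimage outside [A] is unique by [rinj]; a point without one comes from [A], where the value
   has to be [g]. *)
pose h' w' := if pselect (exists w, [/\ B w, ~ A w & r w = w']) is left e
  then h (projT1 (cid e)) else g w'.
have h'r w : B w -> h' (r w) = h w.
  move=> Bw; rewrite /h'; case: pselect => [e|ne].
    case: (cid e) => w1 /= [Bw1 nA1 e1]; congr h; exact: rinj.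
  by have [Aw|nAw] := pselect (A w); [rewrite hA|case: ne; exists w].
exists h'; split.
- rewrite -rB; apply: contOn_descend => //.
  by apply: contOn_eq ch => w Bw; rewrite /= h'r.
- move=> w' A'w'; have : B' w' by exact: A'B'.
  rewrite -rB => -[w Bw e]; have Aw : A w by apply/AA' => //; rewrite e.
  by rewrite -e h'r // hA.
- by move=> w'; rewrite -rB => -[w Bw <-]; rewrite h'r // hB.
Qed.

Lemma contOn_descent_source (Z : topologicalType) (g : T' -> Z) :
  contOn A' g -> contOn A (g \o r).
Proof.
move=> cg; apply: contOn_comp (contOnS AB cr) cg _ => w Aw.
exact: (proj1 (AA' (AB Aw)) Aw).
Qed.

Lemma lifts_descend : lifts A B -> lifts A' B'.
Proof.
move=> LAB g f cg cf gf; apply: liftable_descend; apply: LAB.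
- exact: contOn_descent_source.
- by apply: contOn_comp cr cf _ => x Bx; rewrite -rB; exists x.
- by move=> w Aw; apply: gf; exact: (proj1 (AA' (AB Aw)) Aw).
Qed.

End Descent.

End Lifting.

(** * Cubes *)

Section RealFunctions.
Variables (R : realType) (T : topologicalType).
Implicit Types f g : T -> R.

Lemma continuous_add f g :
  continuous f -> continuous g -> continuous (fun x => f x + g x).
Proof. by move=> cf cg x; apply: cvgD; [exact: cf|exact: cg]. Qed.

Lemma continuous_opp f : continuous f -> continuous (fun x => - f x).
Proof. by move=> cf x; apply: cvgN; exact: cf. Qed.

Lemma continuous_mul f g :
  continuous f -> continuous g -> continuous (fun x => f x * g x).
Proof. by move=> cf cg x; apply: cvgM; [exact: cf|exact: cg]. Qed.

Lemma continuous_maxr f g :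
  continuous f -> continuous g -> continuous (fun x => Num.max (f x) (g x)).
Proof. by move=> cf cg x; exact: continuous_max (cf x) (cg x). Qed.

Lemma continuous_minr f g :
  continuous f -> continuous g -> continuous (fun x => Num.min (f x) (g x)).
Proof. by move=> cf cg x; exact: continuous_min (cf x) (cg x). Qed.

Lemma continuous_normr f : continuous f -> continuous (fun x => `|f x|).
Proof. by move=> cf x; apply: cvg_norm; exact: cf. Qed.

End RealFunctions.

Lemma continuous_cst (T U : topologicalType) (c : U) :
  continuous (fun _ : T => c).
Proof. by move=> x; exact: cvg_cst. Qed.

Lemma continuous_pair (T U V : topologicalType) (f : T -> U) (g : T -> V) :
  continuous f -> continuous g -> continuous (fun x => (f x, g x)).
Proof. by move=> cf cg x; apply: cvg_pair; [exact: cf|exact: cg]. Qed.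

Lemma continuous_fst (T U : topologicalType) : continuous (@fst T U).
Proof. by move=> x; exact: cvg_fst. Qed.

Lemma continuous_snd (T U : topologicalType) : continuous (@snd T U).
Proof. by move=> x; exact: cvg_snd. Qed.

Lemma continuous_compose (T U V : topologicalType) (f : T -> U) (g : U -> V) :
  continuous f -> continuous g -> continuous (fun x => g (f x)).
Proof. by move=> cf cg x; apply: continuous_comp; [exact: cf|exact: cg]. Qed.

Section PointSequences.
Variable R : realType.

Definition rseq : topologicalType := {ptws nat -> R}.

Lemma rseq_hausdorff : hausdorff_space rseq.
Proof. exact: (@hausdorff_product nat (fun=> R) (fun=> @Rhausdorff R)). Qed.

Lemma continuous_coord (i : nat) : continuous (fun w : rseq => w i).
Proof. exact: (@proj_continuous nat (fun=> R)). Qed.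

Lemma continuous_coord_of (T : topologicalType) (f : T -> rseq) (i : nat) :
  continuous f -> continuous (fun x => f x i).
Proof. move=> cf; exact: continuous_compose cf (@continuous_coord i). Qed.

Lemma continuous_rseq (T : topologicalType) (f : T -> rseq) :
  (forall i, continuous (fun x => f x i : R)) -> continuous f.
Proof.
move=> cf x; apply/cvg_sup => i.
exact: (@continuous_comp_initial _ _ _ _
  (f : T -> initial_topology (fun g : nat -> R => g i)) (cf i) x).
Qed.

Definition clamp (x : R) : R := Num.max 0 (Num.min x 1).

Lemma clamp_itv x : 0 <= clamp x <= 1.
Proof. by rewrite /clamp le_max lexx ge_max ler01 ge_min lexx orbT. Qed.

Lemma clamp_id x : 0 <= x <= 1 -> clamp x = x.
Proof. by move=> /andP[x0 x1]; rewrite /clamp min_l // max_r. Qed.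

Lemma clamp_ge1 x : 1 <= x -> clamp x = 1.
Proof. by move=> x1; rewrite /clamp min_r // max_r. Qed.

Lemma clamp_le0 x : x <= 0 -> clamp x = 0.
Proof. by move=> x0; rewrite /clamp min_l ?(le_trans x0) // max_l. Qed.

Lemma continuous_clamp (T : topologicalType) (f : T -> R) :
  continuous f -> continuous (fun x => clamp (f x)).
Proof.
move=> cf; apply: continuous_maxr; first exact: continuous_cst.
by apply: continuous_minr => //; exact: continuous_cst.
Qed.

(* The cube [0, 1]^n, embedded in the space of sequences by padding with 0. *)
Definition ncube (n : nat) : set rseq :=
  [set w | (forall i, 0 <= w i <= 1) /\ forall i, (n <= i)%N -> w i = 0].

Definition ncube_proj (n : nat) (w : rseq) : rseq :=
  fun i => if (i < n)%N then clamp (w i) else 0.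

Lemma ncube_projP n w : ncube n (ncube_proj n w).
Proof.
split=> i; rewrite /ncube_proj; first by case: ifP; rewrite ?clamp_itv ?lexx ?ler01.
by rewrite ltnNge => ->.
Qed.

Lemma ncube_proj_id n w : ncube n w -> ncube_proj n w = w.
Proof.
move=> [w01 w0]; apply/funext => i; rewrite /ncube_proj.
by case: ltnP => ni; [rewrite clamp_id|rewrite w0].
Qed.

Lemma continuous_ncube_proj (T : topologicalType) n (f : T -> rseq) :
  (forall i, (i < n)%N -> continuous (fun x => f x i : R)) ->
  continuous (fun x => ncube_proj n (f x)).
Proof.
move=> cf; apply: continuous_rseq => i; rewrite /ncube_proj.
case: (boolP (i < n)%N) => ni; last exact: continuous_cst.
by apply: continuous_clamp; exact: cf.
Qed.

Lemma ncubeS n m : (n <= m)%N -> ncube n `<=` ncube m.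
Proof. by move=> nm w [w01 w0]; split=> // i mi; apply: w0; exact: leq_trans mi. Qed.

Lemma ncube_compact n : compact (ncube n).
Proof.
pose A i := if (i < n)%N then `[0 : R, 1 : R]%classic else [set 0].
rewrite (_ : ncube n = [set w : nat -> R | forall i, A i (w i)]).
  apply: (@tychonoff nat (fun=> R) A) => i; rewrite /A.
  by case: ifP => _; [exact: segment_compact|exact: compact_set1].
apply/seteqP; split => w.
  by move=> [w01 w0] i; rewrite /A; case: ltnP => ni; [rewrite /= in_itv /= w01|exact: w0].
move=> h; split=> i; have := h i; rewrite /A; case: ltnP => // ni; rewrite /= ?in_itv //=.
by move->; rewrite lexx ler01.
Qed.

Definition facet (n : nat) (w : rseq) : Prop :=
  exists2 i, (i < n)%N & w i = 0 \/ w i = 1.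

Definition ncube_bd (n : nat) : set rseq := [set w | ncube n w /\ facet n w].

Lemma closed_coord_eq i (c : R) : closed [set w : rseq | w i = c].
Proof.
rewrite (_ : [set w | _] = (fun w : rseq => w i) @^-1` [set c]) //.
have /continuous_closedP := @continuous_coord i; apply.
exact: (accessible_closed_set1 (hausdorff_accessible (@Rhausdorff R))).
Qed.

Lemma ncube_closed n : closed (ncube n).
Proof. by apply: compact_closed; [exact: rseq_hausdorff|exact: ncube_compact]. Qed.

Lemma facet_closed n : closed (facet n).
Proof.
rewrite (_ : facet n = \bigcup_(i in [set i | (i < n)%N])
    ([set w : rseq | w i = 0] `|` [set w | w i = 1])).
  apply: closed_bigcup; first exact: finite_II.
  by move=> i _; apply: closedU; exact: closed_coord_eq.
by apply/seteqP; split=> w [i ni h]; exists i.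
Qed.

(** Clamping extends the identification of [ncube n] with [cube R n] continuously to all
    sequences. *)
Definition cube_of (n : nat) (w : rseq) : cube R n :=
  let v : 'rV[R]_n := \row_(i < n) clamp (w i) in
  exist _ v (mem_set (fun i => ltac:(by rewrite mxE /= in_itv /=; exact: clamp_itv)
    : `[0 : R, 1 : R]%classic (v ord0 i))).

Definition of_cube (n : nat) (u : cube R n) : rseq :=
  fun i => if insub i is Some j then cube_val u ord0 j else 0.

Lemma cube_valE n w i : cube_val (cube_of n w) ord0 i = clamp (w i).
Proof. by rewrite /cube_val /= mxE. Qed.

Lemma of_cubeE n (u : cube R n) (i : 'I_n) : of_cube u i = cube_val u ord0 i.
Proof. by rewrite /of_cube valK. Qed.

Lemma cube_val_itv n (u : cube R n) i : 0 <= cube_val u ord0 i <= 1.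
Proof.
by case: u => u hu; have := set_mem hu i; rewrite /cube_val /= in_itv /=.
Qed.

Lemma of_cubeP n (u : cube R n) : ncube n (of_cube u).
Proof.
split=> i; rewrite /of_cube; case: insubP => [j _ ji|] //.
- by rewrite cube_val_itv.
- by rewrite lexx ler01.
- by move=> /= ni; have := ltn_ord j; rewrite ji ltnNge ni.
Qed.

Lemma of_cubeK n : cancel (@of_cube n) (@cube_of n).
Proof.
move=> u; apply: val_inj; apply/rowP => i; rewrite /= mxE of_cubeE.
by rewrite clamp_id // cube_val_itv.
Qed.

Lemma cube_ofK n w : ncube n w -> of_cube (cube_of n w) = w.
Proof.
move=> [w01 w0]; apply/funext => i; have [ni|ni] := ltnP i n.
  by rewrite (of_cubeE _ (Ordinal ni)) cube_valE clamp_id.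
by rewrite w0 // /of_cube insubF // ltnNge ni.
Qed.

Lemma continuous_row (T : topologicalType) n (f : T -> 'rV[R]_n) :
  (forall i, continuous (fun x => f x ord0 i)) -> continuous f.
Proof.
move=> cf x A [P hP PA]; apply: filterS PA _ => /=.
apply: filter_forall => i; apply: filter_forall => j.
by have := cf j x _ (hP ord0 j); rewrite (ord1 i).
Qed.

Lemma continuous_cube_of n : continuous (@cube_of n).
Proof.
apply: continuous_comp_initial; apply: continuous_row => i.
rewrite (_ : (fun _ => _) = fun w : rseq => clamp (w i)).
  by apply: continuous_clamp; exact: continuous_coord.
by apply/funext => w; exact: cube_valE.
Qed.

Lemma continuous_of_cube n : continuous (@of_cube n).
Proof.
apply: continuous_rseq => i; rewrite /of_cube.
case: insubP => [j _ _|_]; last exact: continuous_cst.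
by apply: continuous_compose (@coord_continuous _ _ _ _ _); exact: initial_continuous.
Qed.

Definition itv_of (s : R) : itv R :=
  exist _ (clamp s) (mem_set (ltac:(by rewrite /= in_itv /=; exact: clamp_itv)
    : `[0 : R, 1 : R]%classic (clamp s))).

Definition itv_val (s : itv R) : R := set_val (s : set_type `[0 : R, 1 : R]).

Lemma itv_val_itv s : 0 <= itv_val s <= 1.
Proof. by case: s => s hs; have := set_mem hs; rewrite /= in_itv. Qed.

Lemma itv_ofK s : 0 <= s <= 1 -> itv_val (itv_of s) = s.
Proof. exact: clamp_id. Qed.

Lemma continuous_itv_of : continuous itv_of.
Proof.
by apply: continuous_comp_initial; apply: continuous_clamp => x; exact: cvg_id.
Qed.

Lemma continuous_itv_val : continuous itv_val.
Proof. exact: initial_continuous. Qed.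

Lemma itv_of0 : itv_of 0 = itv0 R.
Proof. by apply: val_inj; apply: clamp_id; rewrite lexx ler01. Qed.

Lemma itv_of1 : itv_of 1 = itv1 R.
Proof. by apply: val_inj; apply: clamp_id; rewrite lexx ler01. Qed.

Lemma cube_boundary_of n w : ncube n w ->
  cube_boundary (cube_of n w) <-> facet n w.
Proof.
move=> [w01 w0]; split=> [[i]|[i ni h]].
  by rewrite cube_valE clamp_id //; exists i.
by exists (Ordinal ni); rewrite cube_valE clamp_id.
Qed.

End PointSequences.

(** * Lifting in cubes *)

Section CubeLifting.
Variable R : realType.
Notation rseq := (rseq R).
Implicit Types w v : rseq.

Definition upd (w : rseq) (n : nat) (s : R) : rseq :=
  fun i => if i == n then s else w i.

Lemma updE w n s : upd w n s n = s.
Proof. by rewrite /upd eqxx. Qed.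

Lemma updN w n s i : i != n -> upd w n s i = w i.
Proof. by rewrite /upd => /negbTE->. Qed.

Lemma upd_id w n : upd w n (w n) = w.
Proof. by apply/funext => i; rewrite /upd; case: eqP => // ->. Qed.

Lemma upd_upd w n s t : upd (upd w n s) n t = upd w n t.
Proof. by apply/funext => i; rewrite /upd; case: eqP. Qed.

Lemma continuous_upd (T : topologicalType) (f : T -> rseq) n (s : T -> R) :
  continuous f -> continuous s -> continuous (fun x => upd (f x) n (s x)).
Proof.
move=> cf cs; apply: continuous_rseq => i; rewrite /upd.
by case: (i == n); [exact: cs|exact: continuous_coord_of].
Qed.

Lemma ncube_upd w n s : ncube n.+1 w -> 0 <= s <= 1 -> ncube n.+1 (upd w n s).
Proof.
move=> [w01 w0] s01; split=> i; rewrite /upd.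
  by case: (i == n) => //; exact: w01.
by case: eqP => [->|_ /w0 //]; rewrite ltnn.
Qed.

Lemma ncube_upd0 w n : ncube n.+1 w -> ncube n (upd w n 0).
Proof.
move=> [w01 w0]; split=> i; rewrite /upd; case: eqP => [//|ni].
- by rewrite lexx ler01.
- exact: w01.
- by move=> ni'; apply: w0; rewrite ltn_neqAle ni' andbT eq_sym; apply/eqP.
Qed.

Lemma ncube_last0 w n : ncube n.+1 w -> w n = 0 -> ncube n w.
Proof. by move=> cw w0; rewrite -(upd_id w n) w0; exact: ncube_upd0. Qed.

Lemma facet_upd w n s : facet n (upd w n s) <-> facet n w.
Proof.
by split=> -[i ni h]; exists i => //; move: h; rewrite updN // ltn_eqF.
Qed.

Lemma facetS w n : facet n.+1 w <-> facet n w \/ (w n = 0 \/ w n = 1).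
Proof.
split=> [[i]|[[i ni h]|h]]; last 2 first.
- by exists i => //; exact: ltnW.
- by exists n.
by rewrite ltnS leq_eqVlt => /predU1P[-> h|ni h]; [right|left; exists i].
Qed.

Lemma cube_ofE n w : of_cube (cube_of n w) = ncube_proj n w.
Proof.
apply/funext => i; rewrite /ncube_proj; have [ni|ni] := ltnP i n.
  by rewrite (of_cubeE _ (Ordinal ni)) cube_valE.
by rewrite /of_cube insubF // ltnNge ni.
Qed.

Lemma upd_ncube_proj n w : ncube n.+1 w -> upd (ncube_proj n w) n (w n) = w.
Proof.
move=> cw; apply/funext => i; rewrite /upd /ncube_proj.
case: eqP => [->//|/eqP ni]; case: ltnP => ni'; first by rewrite clamp_id ?cw.1.
by rewrite cw.2 // ltn_neqAle eq_sym ni.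
Qed.

(** * Serre fibrations lift from an open box to a cube *)

Section Fibration.
Variables (X Y : topologicalType) (p : X -> Y).
Hypothesis fp : serre_fibration R p.

(** Coordinate [n] is the homotopy parameter: because of the padding by 0, [ncube n] is the face of
    [ncube n.+1] where this coordinate vanishes. *)
Lemma serre_lifts n : lifts p (@ncube R n) (@ncube R n.+1).
Proof.
move=> g f cg cf gf.
pose F (q : cube R n * itv R) := f (upd (of_cube q.1) n (itv_val q.2)).
have cF : continuous F.
  apply: (contOn_comp_continuous (A := @ncube R n.+1)) cf _.
    apply: continuous_upd; apply: continuous_compose.
    - exact: continuous_fst.
    - exact: continuous_of_cube.
    - exact: continuous_snd.
    - exact: continuous_itv_val.
  move=> q; apply: ncube_upd; last exact: itv_val_itv.
  exact: ncubeS (leqnSn n) _ (of_cubeP _).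
have cgc : continuous (g \o @of_cube R n).
  apply: contOn_comp_continuous cg _; first exact: continuous_of_cube.
  exact: of_cubeP.
have [|G [cG G0 pG]] := fp.2 n _ F cgc cF.
  move=> u; rewrite /F /= gf; last exact: of_cubeP.
  congr f; rewrite -itv_of0 itv_ofK ?lexx ?ler01 //.
  by rewrite -[RHS](upd_id _ n); congr upd; rewrite (of_cubeP u).2.
exists (fun w => G (cube_of n w, itv_of (w n))); split.
- apply: contOnT; apply: (continuous_compose _ cG); apply: continuous_pair.
    exact: continuous_cube_of.
  exact: continuous_compose (@continuous_coord R n) (@continuous_itv_of R).
- by move=> w cw; rewrite cw.2 // itv_of0 G0 /= cube_ofK.
- move=> w cw; rewrite pG /F /= itv_ofK ?cw.1 // cube_ofE.
  by rewrite upd_ncube_proj.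
Qed.

Definition open_box (n : nat) (c : R) : set rseq :=
  [set w | ncube n.+1 w /\ (w n = c \/ facet n w)].

(** Twice the sup-norm distance of the first [n] coordinates from the centre of the cube, so that it
    equals 1 on the facets. *)
Fixpoint eccentricity (n : nat) (w : rseq) : R :=
  if n is n'.+1 then Num.max (eccentricity n' w) `|2 * w n' - 1| else 0.

Lemma continuous_eccentricity n : continuous (eccentricity n).
Proof.
elim: n => [|n ih]; first exact: continuous_cst.
apply: continuous_maxr => //; apply: continuous_normr; apply: continuous_add.
  by apply: continuous_mul; [exact: continuous_cst|exact: continuous_coord].
exact: continuous_cst.
Qed.

Lemma eccentricity_eq n w :
  eccentricity n w = 0 \/ exists2 i, (i < n)%N & eccentricity n w = `|2 * w i - 1|.
Proof.
elim: n => [|n ih] /=; first by left.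
case: (leP (eccentricity n w)) => _; first by right; exists n.
by case: ih => [->|[i ni ->]]; [left|right; exists i => //; exact: ltnW].
Qed.

Lemma le_eccentricity n w i : (i < n)%N -> `|2 * w i - 1| <= eccentricity n w.
Proof.
elim: n => // n ih; rewrite ltnS leq_eqVlt /= le_max => /predU1P[->|/ih ->] //.
by rewrite lexx orbT.
Qed.

Lemma eccentricity_le1 n w : ncube n.+1 w -> eccentricity n w <= 1.
Proof.
move=> [w01 _]; have [->|[i _ ->]] := eccentricity_eq n w; first exact: ler01.
by have := w01 i; rewrite ler_norml => /andP[? ?]; apply/andP; split; lra.
Qed.

Lemma eccentricity_facet n w : facet n w -> 1 <= eccentricity n w.
Proof.
move=> [i ni [] e]; apply: le_trans (le_eccentricity w ni); rewrite e.
  by rewrite mulr0 sub0r normrN normr1.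
by rewrite mulr1 (_ : 2 - 1 = 1) ?normr1 //; ring.
Qed.

(* Time at which the flow that expands the cube away from the centre of the
   first [n] coordinates and decreases the last one has surely left through the
   open box; it vanishes on the box. *)
Definition exit_time (n : nat) (w : rseq) : R :=
  Num.min (w n) (2 * (1 - eccentricity n w)).

Lemma continuous_exit_time n : continuous (exit_time n).
Proof.
apply: continuous_minr; first exact: continuous_coord.
apply: continuous_mul; first exact: continuous_cst.
apply: continuous_add; first exact: continuous_cst.
by apply: continuous_opp; exact: continuous_eccentricity.
Qed.

Lemma exit_time_itv n w : ncube n.+1 w -> 0 <= exit_time n w <= 1.
Proof.
move=> cw; have /andP[w0 w1] := cw.1 n; rewrite /exit_time le_min w0 /=.
by rewrite mulr_ge0 ?subr_ge0 ?eccentricity_le1 //= ge_min w1.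
Qed.

Lemma exit_time0 n w : open_box n 0 w -> exit_time n w = 0.
Proof.
move=> [cw bw]; apply/le_anti/andP; split; last by case/andP: (exit_time_itv cw).
rewrite /exit_time ge_min; case: bw => [->|/eccentricity_facet h].
  by rewrite lexx.
by apply/orP; right; lra.
Qed.

(* Coordinate [n.+1] is the time, counted backwards from [exit_time]. *)
Definition exit_flow (n : nat) (v : rseq) : rseq :=
  let t := Num.max 0 (exit_time n v - v n.+1) in
  ncube_proj n.+1 (fun i =>
    if i == n then v n - t else 2^-1 + (v i - 2^-1) * (1 + t)).

Lemma continuous_exit_flow n : continuous (exit_flow n).
Proof.
apply: continuous_ncube_proj => i ni.
have ct : continuous (fun v => Num.max 0 (exit_time n v - v n.+1)).
  apply: continuous_maxr; first exact: continuous_cst.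
  apply: continuous_add; first exact: continuous_exit_time.
  by apply: continuous_opp; exact: continuous_coord.
case: (i == n).
  by apply: continuous_add; [exact: continuous_coord|exact: continuous_opp].
apply: continuous_add; first exact: continuous_cst.
apply: continuous_mul; apply: continuous_add => //.
- exact: continuous_coord.
- exact: continuous_cst.
- exact: continuous_cst.
Qed.

(** Once the clock in coordinate [n.+1] has passed [exit_time], the elapsed flow time is 0. At such
    a clock value the flowed problem is the original one. *)
Lemma exit_flow_id n w s : ncube n.+1 w -> exit_time n w <= s ->
  exit_flow n (upd w n.+1 s) = w.
Proof.
move=> cw hs; rewrite /exit_flow updE.
have ecc m : (m <= n.+1)%N -> eccentricity m (upd w n.+1 s) = eccentricity m w.
  by elim: m => //= m ih mn; rewrite ih 1?ltnW // updN // ltn_eqF.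
have -> : exit_time n (upd w n.+1 s) = exit_time n w.
  by rewrite /exit_time ecc // updN // ltn_eqF.
rewrite max_l ?subr_le0 //; rewrite -[RHS](ncube_proj_id cw).
apply/funext => i; rewrite /ncube_proj; case: ltnP => // ni.
have -> : upd w n.+1 s i = w i by rewrite updN // ltn_eqF.
have -> : upd w n.+1 s n = w n by rewrite updN // ltn_eqF.
congr clamp; rewrite addr0 mulr1 subr0.
by case: (eqVneq i n) => [->//|_]; ring.
Qed.

(** Either [w n] realizes the minimum in [exit_time] and the last coordinate reaches 0, or the
    coordinate farthest from the centre is pushed onto a facet. *)
Lemma exit_flow_box n w : ncube n.+1 w -> open_box n 0 (exit_flow n w).
Proof.
move=> cw; split; first exact: ncube_projP.
have /andP[T0 T1] := exit_time_itv cw.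
have t_eq : Num.max 0 (exit_time n w - w n.+1) = exit_time n w.
  by rewrite cw.2 // subr0 max_r.
rewrite /exit_flow t_eq; have m1 := eccentricity_le1 cw.
have /andP[wn0 wn1] := cw.1 n.
have [h|h] := leP (w n) (2 * (1 - eccentricity n w)).
  left; rewrite /ncube_proj ltnSn eqxx clamp_le0 // /exit_time min_l //.
  by rewrite subrr.
right; move: T0 T1; rewrite /exit_time (min_r (ltW h)) => T0 T1.
have [m0|[i ni mi]] := eccentricity_eq n w; first by lra.
exists i => //; rewrite /ncube_proj ltnW // ltn_eqF //.
(* With [m] the eccentricity, [m * (3 - 2 * m) - 1 = (2 * m - 1) * (1 - m)], and [h] together with
   [w n <= 1] gives [m > 1/2]. The factor 2 in [exit_time] is chosen for this. *)
have : 1 <= eccentricity n w * (1 + 2 * (1 - eccentricity n w)).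
  set m := eccentricity n w in m1 h *; nra.
set t := 2 * _; rewrite mi; have [wi|wi] := leP 0 (2 * w i - 1).
  rewrite ger0_norm // => ht; right; apply: clamp_ge1; lra.
rewrite ltr0_norm // => ht; left; apply: clamp_le0; lra.
Qed.

(** A retract argument: the flow carries the cube into the box at clock 0, where [g] provides a
    lift; lift along the clock and stop at [exit_time w], when the flow is back at [w]. On the box
    the exit time is 0, so the lift restricts to [g]. *)
Lemma open_box_lifts0 n : lifts p (open_box n 0) (@ncube R n.+1).
Proof.
move=> g f cg cf gf.
have ck (A : set rseq) : contOn A (exit_flow n).
  by apply: contOnT; exact: continuous_exit_flow.
have [||v cv|G [cG G0 pG]] := @serre_lifts n.+1 (g \o exit_flow n) (f \o exit_flow n).
- by apply: contOn_comp (ck _) cg _ => w; exact: exit_flow_box.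
- by apply: contOn_comp (ck _) cf _ => w _; exact: ncube_projP.
- by apply: gf; exact: exit_flow_box.
have e_cube w : ncube n.+1 w -> ncube n.+2 (upd w n.+1 (exit_time n w)).
  move=> cw; apply: ncube_upd; last exact: exit_time_itv.
  exact: ncubeS (leqnSn _) _ cw.
exists (fun w => G (upd w n.+1 (exit_time n w))); split.
- apply: (contOn_comp (f := fun w => upd w n.+1 (exit_time n w)) _ cG).
    apply: contOnT; apply: continuous_upd; last exact: continuous_exit_time.
    by move=> w; exact: cvg_id.
  exact: e_cube.
- move=> w Jw; have cw := Jw.1; rewrite (exit_time0 Jw).
  have e : upd w n.+1 0 = w by rewrite -[RHS](upd_id w n.+1) cw.2.
  rewrite e G0 //= -[in LHS]e exit_flow_id //.
  by rewrite (exit_time0 Jw).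
- by move=> w cw; rewrite pG /= ?exit_flow_id //; exact: e_cube.
Qed.

(** Reflection of the last coordinate exchanges the two ends. The end 1 is the one prescribed for
    prisms, since [ast2o \circ_1 -] lands at parameter 1. *)
Lemma open_box_lifts1 n : lifts p (open_box n 1) (@ncube R n.+1).
Proof.
pose r w := upd w n (1 - w n).
have rK w : r (r w) = w.
  by rewrite /r updE upd_upd opprB addrCA subrr addr0 upd_id.
have rC w : ncube n.+1 w -> ncube n.+1 (r w).
  move=> cw; apply: ncube_upd => //; have := cw.1 n.
  by move=> /andP[? ?]; apply/andP; split; lra.
apply: (lifts_descend (r := r) _ _ _ _ _ _ _ _ _ (@open_box_lifts0 n)).
- exact: rseq_hausdorff.
- exact: rseq_hausdorff.
- exact: ncube_compact.
- by move=> w [].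
- by move=> w [].
- apply: contOnT; apply: continuous_upd; first by move=> w; exact: cvg_id.
  apply: continuous_add; first exact: continuous_cst.
  by apply: continuous_opp; exact: continuous_coord.
- apply/seteqP; split=> [_ [w cw <-]|w cw]; first exact: rC.
  by exists (r w) => //; exact: rC.
- move=> w cw; rewrite /open_box /= {2}/r updE facet_upd.
  split=> -[_ [h|h]]; split; rewrite ?h ?subr0; auto; left.
  by move: h => /(congr1 (fun x => 1 - x)); rewrite opprB addrCA subrr addr0.
- by move=> w w' _ _ _ /(congr1 r); rewrite !rK.
Qed.

End Fibration.
End CubeLifting.

(** * Trivial fibrations lift based problems on the boundary of a cube *)

Section TrivialFibration.
Variable R : realType.
Notation rseq := (rseq R).
Implicit Types w v : rseq.

Lemma closed_le (T : topologicalType) (c d : T -> R) :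
  continuous c -> continuous d -> closed [set x | c x <= d x].
Proof.
move=> cc cd; rewrite (_ : [set x | _] =
    (fun x => d x - c x) @^-1` [set r | 0 <= r]); last first.
  by apply/seteqP; split => x /=; rewrite subr_ge0.
have /continuous_closedP : continuous (fun x => d x - c x).
  by apply: continuous_add => //; exact: continuous_opp.
by apply; exact: closed_ge.
Qed.

Lemma contOn_if (T U : topologicalType) (A : set T) (c d : T -> R)
    (f1 f2 : T -> U) :
  closed A -> continuous c -> continuous d ->
  contOn (A `&` [set x | c x <= d x]) f1 ->
  contOn (A `&` [set x | d x <= c x]) f2 ->
  (forall x, A x -> c x = d x -> f1 x = f2 x) ->
  contOn A (fun x => if c x <= d x then f1 x else f2 x).
Proof.
move=> cA cc cd c1 c2 f12.
have -> : A = (A `&` [set x | c x <= d x]) `|` (A `&` [set x | d x <= c x]).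
  rewrite -setIUr; apply/seteqP; split=> x //; last by case.
  by move=> Ax; split => //; have [h|/ltW h] := leP (c x) (d x); [left|right].
apply: contOnU; [apply: closedI => //; exact: closed_le..| |].
  by apply: contOn_eq c1 => x [_ /= ->].
apply: contOn_eq c2 => x [Ax /= dc]; case: ifP => // cd'.
by rewrite f12 //; apply/le_anti/andP.
Qed.

Lemma upd_last n w s : ncube n w -> upd (upd w n s) n 0 = w.
Proof. by move=> cw; rewrite upd_upd -[RHS](upd_id w n) cw.2. Qed.

Lemma itv01 (b : bool) : 0 <= (b%:R : R) <= 1.
Proof. by case: b; rewrite !lexx ler01. Qed.

Lemma ncube_snoc n w s : ncube n w -> 0 <= s <= 1 -> ncube n.+1 (upd w n s).
Proof. by move=> cw; apply: ncube_upd; exact: ncubeS (leqnSn n) _ cw. Qed.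

Lemma ncube_bdS n w : ncube n.+1 w -> w n = 0 -> ncube_bd n.+1 w.
Proof. by move=> cw w0; split=> //; apply/facetS; right; left. Qed.

Variables (X Y : topologicalType) (p : X -> Y).
Hypothesis fp : serre_fibration R p.
Hypothesis wp : weak_homotopy_equivalence R p.

Let pi0_inj : forall x x', path_connected R (p x) (p x') -> path_connected R x x'.
Proof. by have [_ []] := wp. Qed.

Let pin : forall n x, (0 < n)%N -> _ := let: And3 _ _ h := wp in h.

Lemma contOn_p (T : topologicalType) (A : set T) (g : T -> X) :
  contOn A g -> contOn A (p \o g).
Proof.
by move=> cg; apply: (contOn_comp (B := setT) cg) => //; exact: contOnT fp.1.
Qed.

Lemma cube_map_continuous (Z : topologicalType) n (g : rseq -> Z) :
  contOn (@ncube R n) g -> continuous (g \o @of_cube R n).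
Proof.
move=> cg; apply: contOn_comp_continuous cg _; last exact: of_cubeP.
exact: continuous_of_cube.
Qed.

Lemma facet_of_cube n (u : cube R n) : cube_boundary u -> facet n (of_cube u).
Proof.
by rewrite -{1}(of_cubeK u) => h; apply/cube_boundary_of => //; exact: of_cubeP.
Qed.

Lemma boundary_cube_of n w : ncube n.+1 w -> facet n w ->
  cube_boundary (cube_of n w).
Proof.
move=> cw [i ni h]; exists (Ordinal ni); rewrite cube_valE clamp_id //.
exact: cw.1.
Qed.

Lemma homotopy_contOn (Z : topologicalType) n (H : cube R n * itv R -> Z) A :
  continuous H ->
  contOn A (fun w => H (cube_of n w, itv_of (w n))).
Proof.
move=> cH; apply: contOnT; apply: (continuous_compose _ cH).
apply: continuous_pair; first exact: continuous_cube_of.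
exact: continuous_compose (@continuous_coord R n) (@continuous_itv_of R).
Qed.

(** As [p \o c] is constant, this is injectivity of [p] on [\pi_n], and on path components when
    [n = 0], where the cube is a point without boundary. Coordinate [n] of [d] is the homotopy
    parameter. *)
Lemma sphere_homotopic_cst n x (c : rseq -> X) :
  contOn (@ncube R n) c -> (forall w, ncube_bd n w -> c w = x) ->
  (forall w, ncube n w -> p (c w) = p x) ->
  exists d : rseq -> X, [/\ contOn (@ncube R n.+1) d,
    forall w, ncube n.+1 w -> w n = 0 \/ facet n w -> d w = x
    & forall w, ncube n.+1 w -> w n = 1 -> d w = c (upd w n 0)].
Proof.
have [-> {n}|n0] := posnP n.
  move=> _ _ pc; pose o : rseq := fun=> 0.
  have co : ncube 0 o by split=> // i; exact: (itv01 false).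
  have [|g [cg g0 g1]] := @pi0_inj x (c o).
    exists (fun=> p x); split => //; last by rewrite pc.
    exact: continuous_cst.
  exists (fun w => g (itv_of (w 0%N))); split.
  - apply: contOnT; apply: continuous_compose cg.
    exact: continuous_compose (@continuous_coord R 0) (@continuous_itv_of R).
  - by move=> w _ [->|[]//]; rewrite itv_of0.
  - move=> w cw ->; rewrite itv_of1 g1; congr c; apply/funext => -[|i] //.
    by rewrite updN // cw.2.
move=> cc cx pc; have [inj _] := pin x n0.
have [|||H [cH H0 H1 Hb]] := inj (fun=> x) (c \o @of_cube R n).
- by split=> //; exact: continuous_cst.
- split; first exact: cube_map_continuous.
  by move=> u hu; apply: cx; split; [exact: of_cubeP|exact: facet_of_cube].
- exists (fun=> p x); split => //; first exact: continuous_cst.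
  by move=> u; rewrite /= pc //; exact: of_cubeP.
exists (fun w => H (cube_of n w, itv_of (w n))); split.
- exact: homotopy_contOn.
- move=> w cw [->|fw]; first by rewrite itv_of0 H0.
  by rewrite Hb //; exact: boundary_cube_of.
- move=> w cw w1; rewrite w1 itv_of1 H1 /= cube_ofE; congr c.
  rewrite -{2}(upd_ncube_proj cw) upd_upd -[LHS](upd_id _ n); congr upd.
  by rewrite (ncube_projP n w).2.
Qed.

(** Surjectivity on [\pi_n] gives a sphere whose projection is only homotopic to [b]. Lifting that
    homotopy, with the boundary held at [x], and taking its end turns this into an equality. *)
Lemma sphere_lift n x (b : rseq -> Y) : (0 < n)%N ->
  contOn (@ncube R n) b -> (forall w, ncube_bd n w -> b w = p x) ->
  exists a : rseq -> X, [/\ contOn (@ncube R n) a,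
    forall w, ncube_bd n w -> a w = x
    & forall w, ncube n w -> p (a w) = b w].
Proof.
move=> n0 cb bx; have [_ surj] := pin x n0.
have [|al [cal alx] [H [cH H0 H1 Hb]]] := surj (b \o @of_cube R n).
  split; first exact: cube_map_continuous.
  by move=> u hu; apply: bx; split; [exact: of_cubeP|exact: facet_of_cube].
have proj_upd w : ncube n.+1 w -> ncube_proj n w = upd w n 0.
  move=> cw; rewrite -{2}(upd_ncube_proj cw) upd_upd -[LHS](upd_id _ n).
  by congr upd; rewrite (ncube_projP n w).2.
have [|||G [cG Gg pG]] := @open_box_lifts0 _ _ _ _ fp n
  (fun w => al (cube_of n w)) (fun w => H (cube_of n w, itv_of (w n))).
- apply: contOnT; apply: continuous_compose cal; exact: continuous_cube_of.
- exact: homotopy_contOn.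
- move=> w [cw [->|fw]]; first by rewrite itv_of0 H0.
  by rewrite Hb //=; exact: boundary_cube_of.
exists (fun w => G (upd w n 1)); split.
- apply: (contOn_comp (f := fun w => upd w n 1) _ cG).
    apply: contOnT; apply: continuous_upd; last exact: continuous_cst.
    by move=> w; exact: cvg_id.
  by move=> w cw; apply: ncube_snoc => //; exact: (itv01 true).
- move=> w [cw fw]; have cw1 := ncube_snoc cw (itv01 true).
  have fw1 : facet n (upd w n 1) by apply/facet_upd.
  rewrite Gg; last by split=> //; right.
  by rewrite alx //; exact: boundary_cube_of.
- move=> w cw; have cw1 := ncube_snoc cw (itv01 true).
  rewrite pG // updE itv_of1 H1 /= cube_ofE proj_upd //.
  by rewrite upd_last.
Qed.

(* [c] is null-homotopic in [X] through some [d], but [p \o d] need not be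
   constant; choose a sphere [a] with [p \o a = p \o d].  The concatenation [e]
   of the reverse of [a] with [d] projects to a path run back and forth, which
   contracts; lifting the contraction moves [e] into the fibre. *)
Lemma sphere_null_in_fibre n x (c : rseq -> X) :
  contOn (@ncube R n) c -> (forall w, ncube_bd n w -> c w = x) ->
  (forall w, ncube n w -> p (c w) = p x) ->
  exists d : rseq -> X, [/\ contOn (@ncube R n.+1) d,
    forall w, ncube n.+1 w -> w n = 0 \/ facet n w -> d w = x,
    forall w, ncube n.+1 w -> w n = 1 -> d w = c (upd w n 0)
    & forall w, ncube n.+1 w -> p (d w) = p x].
Proof.
move=> cc cx pc; have [d [cd d0 d1]] := sphere_homotopic_cst cc cx pc.
have [//|||a [ca ax pa]] := @sphere_lift n.+1 x (p \o d).
- exact: contOn_p.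
- move=> w [cw /facetS fw] /=; have [w1|w1] := eqVneq (w n) 1.
    by rewrite d1 // pc //; exact: ncube_upd0.
  by rewrite d0 //; case: fw => [|[|/eqP]]; auto; rewrite (negbTE w1).
have a0 w : ncube n.+1 w -> w n = 0 \/ w n = 1 \/ facet n w -> a w = x.
  by move=> cw h; apply: ax; split=> //; apply/facetS; tauto.
pose e w := if w n <= 2^-1 then a (upd w n (1 - 2 * w n))
  else d (upd w n (2 * w n - 1)).
have ccoord : continuous (fun w : rseq => w n) by exact: continuous_coord.
have c2 : continuous (fun w : rseq => 2 * w n).
  by apply: continuous_mul => //; exact: continuous_cst.
have ce : contOn (@ncube R n.+1) e.
  apply: contOn_if => //; first exact: ncube_closed.
  - exact: continuous_cst.
  - apply: (contOn_comp (f := fun w => upd w n (1 - 2 * w n)) _ ca).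
      apply: contOnT; apply: continuous_upd; first by move=> w; exact: cvg_id.
      apply: continuous_add; first exact: continuous_cst.
      exact: continuous_opp.
    move=> w [cw /= h]; apply: ncube_upd => //; have /andP[? ?] := cw.1 n.
    by apply/andP; split; lra.
  - apply: (contOn_comp (f := fun w => upd w n (2 * w n - 1)) _ cd).
      apply: contOnT; apply: continuous_upd; first by move=> w; exact: cvg_id.
      by apply: continuous_add => //; exact: continuous_cst.
    move=> w [cw /= h]; apply: ncube_upd => //; have /andP[? ?] := cw.1 n.
    by apply/andP; split; lra.
  move=> w cw ->; rewrite mulfV ?pnatr_eq0 // subrr.
  have cw0 : ncube n.+1 (upd w n 0) by apply: ncube_upd => //; exact: (itv01 false).
  by rewrite a0 // ?d0 //; left; rewrite updE.
(* Because [p \o a = p \o d], the projection of [e] follows the same path from parameter 1 down to 0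
   and back to 1. *)
have pe w : ncube n.+1 w -> p (e w) = p (d (upd w n `|2 * w n - 1|)).
  move=> cw; rewrite /e; have /andP[? ?] := cw.1 n.
  case: (leP (w n) 2^-1) => h.
    rewrite pa /=; last by apply: ncube_upd => //; apply/andP; split; lra.
    by rewrite ler0_norm ?opprB //; lra.
  by rewrite ger0_norm //; lra.
(* The contraction keeps the path parameter at least equal to the time [v n.+1]. At time 1 only the
   end of [d] remains, which is [c], and [p \o c] is constant. *)
pose f v := p (d (upd (upd v n.+1 0) n (Num.max `|2 * v n - 1| (v n.+1)))).
have t01 v : ncube n.+2 v -> 0 <= Num.max `|2 * v n - 1| (v n.+1) <= 1.
  move=> cv; rewrite le_max normr_ge0 ge_max /=.
  have /andP[? ?] := cv.1 n; have /andP[_ ->] := cv.1 n.+1.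
  by rewrite andbT ler_norml; apply/andP; split; lra.
have [|||G [cG Ge pG]] := @open_box_lifts0 _ _ _ _ fp n.+1
  (fun v => e (upd v n.+1 0)) f.
- apply: (contOn_comp (f := fun v => upd v n.+1 0) _ ce).
    apply: contOnT; apply: continuous_upd; last exact: continuous_cst.
    by move=> w; exact: cvg_id.
  by move=> v [cv _]; exact: ncube_upd0.
- apply: (contOn_comp (f := fun v => upd (upd v n.+1 0) n
    (Num.max `|2 * v n - 1| (v n.+1))) _ (contOn_p cd)).
    apply: contOnT; apply: continuous_upd.
      apply: continuous_upd; last exact: continuous_cst.
      by move=> w; exact: cvg_id.
    apply: continuous_maxr; last exact: continuous_coord.
    apply: continuous_normr; apply: continuous_add => //.
    exact: continuous_cst.
  by move=> v cv; apply: ncube_upd; [exact: ncube_upd0|exact: t01].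
- move=> v [cv bv]; have cv0 := ncube_upd0 cv.
  have vn : upd v n.+1 0 n = v n by rewrite updN // ltn_eqF.
  have n01 : 0 <= `|2 * v n - 1| <= 1.
    rewrite normr_ge0 ler_norml /=; have /andP[? ?] := cv.1 n.
    by apply/andP; split; lra.
  rewrite pe // /f vn; case: bv => [->|/facetS[fv|fv]].
  + by rewrite max_l ?normr_ge0.
  + have fv' s : facet n (upd (upd v n.+1 0) n s).
      by case: fv => i ni h; exists i; rewrite // !updN ?ltn_eqF // ltnW.
    have dx s : 0 <= s <= 1 -> d (upd (upd v n.+1 0) n s) = x.
      by move=> s01; apply: d0; [exact: ncube_upd|right; exact: fv'].
    by rewrite !dx //; exact: t01.
  + have -> : `|2 * v n - 1| = 1.
      by case: fv => ->; [rewrite mulr0 sub0r normrN|rewrite mulr1 -{2}(addrK 1 1)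
        addrK]; rewrite ?normr1 // (_ : 2 - 1 = 1) ?normr1 //; ring.
    by rewrite max_l //; have /andP[] := cv.1 n.+1.
have cw1 w : ncube n.+1 w -> ncube n.+2 (upd w n.+1 1).
  by move=> cw; apply: ncube_snoc => //; exact: (itv01 true).
(* The box prescribes [e] on the facets at all times, so the end of the lifted contraction keeps the
   boundary values of [e]. *)
have Ge1 w : ncube n.+1 w -> facet n.+1 w -> G (upd w n.+1 1) = e w.
  move=> cw fw; rewrite Ge ?upd_last //; split; first exact: cw1.
  by right; apply/facet_upd.
exists (fun w => G (upd w n.+1 1)); split.
- apply: (contOn_comp (f := fun w => upd w n.+1 1) _ cG) => //.
  apply: contOnT; apply: continuous_upd; last exact: continuous_cst.
  by move=> w; exact: cvg_id.
- move=> w cw h; rewrite Ge1 //; last by apply/facetS; tauto.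
  have /andP[? ?] := cw.1 n.
  rewrite /e; case: (leP (w n) 2^-1) => hw.
    rewrite a0 //; first by apply: ncube_upd => //; apply/andP; split; lra.
    case: h => [->|h]; first by right; left; rewrite mulr0 subr0 updE.
    by right; right; apply/facet_upd.
  rewrite d0 //; first by apply: ncube_upd => //; apply/andP; split; lra.
  by right; apply/facet_upd; case: h => // h; lra.
- move=> w cw wn; rewrite Ge1 //; last by apply/facetS; auto.
  rewrite /e wn; case: (leP (1 : R) 2^-1) => hw; first by exfalso; lra.
  have -> : 2 * 1 - 1 = 1 :> R by ring.
  by rewrite -{1}wn upd_id d1.
- move=> w cw; rewrite pG; last exact: cw1.
  rewrite /f upd_last // updE max_r; last first.
    rewrite updN ?ltn_eqF // ler_norml; have /andP[? ?] := cw.1 n.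
    by apply/andP; split; lra.
  have c1 : ncube n.+1 (upd w n 1) by apply: ncube_upd => //; exact: (itv01 true).
  by rewrite d1 ?updE // upd_upd pc //; exact: ncube_upd0.
Qed.

(* Lift [f] down from the face [w n = 1] to get [l]; on the face [w n = 0] it is a
   sphere in a fibre, contracted there by [k].  The concatenation [e] of [k]
   and [l] solves the problem up to a homotopy [th] of lifting problems. *)
Lemma based_lifts n x (g : rseq -> X) (f : rseq -> Y) :
  contOn (@ncube_bd R n.+1) g -> contOn (@ncube R n.+1) f ->
  (forall w, ncube_bd n.+1 w -> p (g w) = f w) ->
  (forall w, ncube n.+1 w -> w n = 0 -> g w = x) ->
  liftable p (@ncube_bd R n.+1) (@ncube R n.+1) g f.
Proof.
move=> cg cf gf gx.
have box_bd : @open_box R n 1 `<=` @ncube_bd R n.+1.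
  by move=> w [cw h]; split=> //; apply/facetS; tauto.
have [|||l [cl lg pl]] := @open_box_lifts1 _ _ _ _ fp n g f => //.
- exact: contOnS box_bd cg.
- by move=> w /box_bd; exact: gf.
have fx w : ncube n.+1 w -> w n = 0 -> f w = p x.
  by move=> cw w0; rewrite -gf ?gx //; exact: ncube_bdS.
have [|||k [ck k0 k1 pk]] := sphere_null_in_fibre (n := n) (x := x) (c := l).
- by apply: contOnS cl; exact: ncubeS.
- move=> w [cw fw]; have cw' : ncube n.+1 w by exact: ncubeS (leqnSn n) _ cw.
  by rewrite lg ?gx ?cw.2 //; split=> //; right.
- move=> w cw; have cw' : ncube n.+1 w by exact: ncubeS (leqnSn n) _ cw.
  by rewrite pl // fx // cw.2.
pose e w := if w n <= 2^-1 then k (upd w n (2 * w n))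
  else l (upd w n (2 * w n - 1)).
have cid' : continuous (fun w : rseq => w) by move=> w; exact: cvg_id.
have ccoord i : continuous (fun w : rseq => w i) by exact: continuous_coord.
have c2 : continuous (fun w : rseq => 2 * w n).
  by apply: continuous_mul => //; exact: continuous_cst.
have c21 : continuous (fun w : rseq => 2 * w n - 1).
  by apply: continuous_add => //; exact: continuous_cst.
have ce : contOn (@ncube R n.+1) e.
  apply: contOn_if => //; first exact: ncube_closed.
  - exact: continuous_cst.
  - apply: (contOn_comp (f := fun w => upd w n (2 * w n)) _ ck).
      by apply: contOnT; exact: continuous_upd.
    move=> w [cw /= h]; apply: ncube_upd => //; have /andP[? ?] := cw.1 n.
    by apply/andP; split; lra.
  - apply: (contOn_comp (f := fun w => upd w n (2 * w n - 1)) _ cl).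
      by apply: contOnT; exact: continuous_upd.
    move=> w [cw /= h]; apply: ncube_upd => //; have /andP[? ?] := cw.1 n.
    by apply/andP; split; lra.
  move=> w cw ->; rewrite mulfV ?pnatr_eq0 // subrr k1 ?updE ?upd_upd //.
  by apply: ncube_upd => //; exact: (itv01 true).
(* Interpolates between the reparametrization under which [p \o e] becomes [f], at time 0, and the
   identity, at time 1. Both fix 0 and 1, so facets are sent into the boundary throughout. *)
pose q v := (1 - v n.+1) * Num.max 0 (2 * v n - 1) + v n.+1 * v n.
pose th v := upd (upd v n.+1 0) n (q v).
have cth : continuous th.
  apply: continuous_upd.
    by apply: continuous_upd => //; exact: continuous_cst.
  apply: continuous_add; apply: continuous_mul => //.
    apply: continuous_add; first exact: continuous_cst.
    exact: continuous_opp.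
  by apply: continuous_maxr => //; exact: continuous_cst.
have thP v : ncube n.+2 v -> ncube n.+1 (th v).
  move=> cv; apply: ncube_upd; first exact: ncube_upd0.
  have /andP[? ?] := cv.1 n; have /andP[? ?] := cv.1 n.+1; rewrite /q.
  by case: (leP 0 (2 * v n - 1)) => h; apply/andP; split; nra.
have thF v : ncube n.+2 v -> facet n.+1 v -> ncube_bd n.+1 (th v).
  move=> cv fv; split; [exact: thP|apply/facetS]; rewrite /th updE /q.
  case/facetS: fv => [[i ni h]|[->|->]].
  - by left; exists i; rewrite // !updN ?ltn_eqF // ltnW.
  - by right; left; rewrite max_l ?mulr0 ?addr0 // sub0r oppr_le0 ler01.
  - right; right; have -> : 2 * 1 - 1 = 1 :> R by ring.
    by rewrite max_r ?ler01 //; ring.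
have thE v : v n.+1 = 0 -> th v = upd v n (Num.max 0 (2 * v n - 1)).
  move=> v0; rewrite /th /q v0 subr0 mul1r mul0r addr0; congr upd.
  by rewrite -{1}v0 upd_id.
have pe v : ncube n.+2 v -> v n.+1 = 0 -> p (e v) = f (th v).
  move=> cv v0; have cv' := ncube_last0 cv v0; have /andP[? ?] := cv'.1 n.
  rewrite thE // /e.
  case: (leP (v n) 2^-1) => h.
    rewrite pk; last by apply: ncube_upd => //; apply/andP; split; lra.
    rewrite max_l ?fx ?updE //; last by lra.
    by apply: ncube_upd => //; exact: (itv01 false).
  rewrite max_r; last by lra.
  by rewrite pl //; apply: ncube_upd => //; apply/andP; split; lra.
have eg v : ncube n.+2 v -> v n.+1 = 0 -> facet n.+1 v -> e v = g (th v).
  move=> cv v0 fv; have cv' := ncube_last0 cv v0; have /andP[? ?] := cv'.1 n.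
  rewrite thE // /e; case: (leP (v n) 2^-1) => h.
    rewrite max_l ?gx ?updE //; [|by apply: ncube_upd => //;
      exact: (itv01 false)|by lra].
    apply: k0; first by apply: ncube_upd => //; apply/andP; split; lra.
    case/facetS: fv => [fv|[->|v1]]; first by right; apply/facet_upd.
      by left; rewrite updE mulr0.
    by exfalso; rewrite v1 in h; lra.
  rewrite max_r; last by lra.
  apply: lg; split; first by apply: ncube_upd => //; apply/andP; split; lra.
  case/facetS: fv => [fv|[v1|->]]; first by right; apply/facet_upd.
    by exfalso; rewrite v1 in h; lra.
  by left; rewrite updE; ring.
(* The data on the box: [e] on the bottom and [g \o th] on the sides; [eg] is their agreement where
   these meet. *)
pose g' v := if v n.+1 <= 0 then e v else g (th v).
have [|||G [cG Gg pG]] := @open_box_lifts0 _ _ _ _ fp n.+1 g' (f \o th).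
- pose A0 : set rseq := ncube n.+2 `&` [set v | v n.+1 = 0].
  pose A1 : set rseq := ncube n.+2 `&` facet n.+1.
  have -> : open_box n.+1 0 = A0 `|` A1.
    by apply/seteqP; split => v; rewrite /open_box /A0 /A1 /=; tauto.
  apply: contOnU.
  + by apply: closedI; [exact: ncube_closed|exact: closed_coord_eq].
  + by apply: closedI; [exact: ncube_closed|exact: facet_closed].
  + have ce0 : contOn A0 e.
      by apply: contOnS ce => v [cv v0]; exact: ncube_last0.
    by apply: contOn_eq ce0 => v [cv v0]; rewrite /g' v0 lexx.
  + have cg1 : contOn A1 (g \o th).
      by apply: contOn_comp (contOnT cth) cg _ => v [cv fv]; exact: thF.
    apply: contOn_eq cg1 => v [cv fv]; rewrite /g' /=; case: (leP (v n.+1) 0) => // v0.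
    by rewrite eg //; apply/le_anti; rewrite v0; case/andP: (cv.1 n.+1).
- by apply: contOn_comp (contOnT cth) cf _ => v; exact: thP.
- move=> v [cv bv]; rewrite /g' /=; case: (leP (v n.+1) 0) => v0.
    by apply: pe => //; apply/le_anti; rewrite v0; case/andP: (cv.1 n.+1).
  case: bv => [e0|fv]; first by rewrite e0 ltxx in v0.
  by apply: gf; exact: thF.
have cw1 w : ncube n.+1 w -> ncube n.+2 (upd w n.+1 1).
  by move=> cw; apply: ncube_snoc => //; exact: (itv01 true).
have th1 w : ncube n.+1 w -> th (upd w n.+1 1) = w.
  move=> cw; rewrite /th /q upd_last // updE subrr mul0r add0r mul1r.
  by rewrite updN ?ltn_eqF // upd_id.
exists (fun w => G (upd w n.+1 1)); split.
- apply: (contOn_comp (f := fun w => upd w n.+1 1) _ cG) => //.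
  by apply: contOnT; apply: continuous_upd => //; exact: continuous_cst.
- move=> w [cw fw]; rewrite Gg; last first.
    by split; [exact: cw1|right; apply/facet_upd].
  by rewrite /g' updE leNgt ltr01 /= th1.
- by move=> w cw; rewrite pG /= ?th1 //; exact: cw1.
Qed.

End TrivialFibration.

(** * Simplices *)

Section Simplices.
Variable R : realType.
Notation rseq := (rseq R).
Implicit Types w u t : rseq.

(* The simplex [0 <= t_1 <= ... <= t_n <= 1], extended by [t_0 = 0] and by
   [t_j = 1] for [j > n]. *)
Definition nsimplex (n : nat) : set rseq :=
  [set t | [/\ t 0%N = 0, forall i, t i <= t i.+1 & forall i, (n < i)%N -> t i = 1]].

Definition degenerate (n : nat) (t : rseq) : Prop :=
  exists2 i, (i <= n)%N & t i = t i.+1.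

Lemma nsimplex_mono n t i j : nsimplex n t -> (i <= j)%N -> t i <= t j.
Proof. move=> [_ h _]; exact: (homo_leq (@lexx _ R) le_trans h). Qed.

Lemma nsimplex_itv n t i : nsimplex n t -> 0 <= t i <= 1.
Proof.
move=> ht; have [t0 _ t1] := ht; rewrite -{1}t0 (nsimplex_mono ht) //=.
rewrite -(t1 (maxn i n.+1)) ?(nsimplex_mono ht) ?leq_maxl //.
by rewrite leq_max ltnSn orbT.
Qed.

(* [t_j = u_j * ... * u_n], where [u_j] is the coordinate [j - 1] of [u]. *)
Definition simplex_of_cube (n : nat) (u : rseq) : rseq :=
  fun j => if j is j'.+1 then \prod_(j' <= k < n) u k else 0.

Lemma simplex_of_cubeS n u j : (j < n)%N ->
  simplex_of_cube n u j.+1 = u j * simplex_of_cube n u j.+2.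
Proof. by move=> jn; rewrite /= big_ltn. Qed.

Lemma simplex_of_cubeP n u : (forall i, 0 <= u i <= 1) ->
  nsimplex n (simplex_of_cube n u).
Proof.
move=> u01.
have pos j : 0 <= simplex_of_cube n u j.
  by case: j => [|j] /=; rewrite ?lexx // prodr_ge0 // => i _; case/andP: (u01 i).
split=> // [[|j]|[|j] nj] //.
- have [jn|nj] := ltnP j n; last by rewrite /= !big_geq // leqW.
  rewrite simplex_of_cubeS //; case/andP: (u01 j) => u0 u1.
  by rewrite ler_piMl.
- by rewrite /= big_geq.
Qed.

Lemma continuous_simplex_of_cube n : continuous (simplex_of_cube n).
Proof.
apply: continuous_rseq => -[|j] /=; first exact: continuous_cst.
elim: n => [|n ih].
  rewrite (_ : (fun _ => _) = fun=> 1); first exact: continuous_cst.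
  by apply/funext => u; rewrite big_geq.
have [jn|nj] := leqP j n; last first.
  rewrite (_ : (fun _ => _) = fun=> 1); first exact: continuous_cst.
  by apply/funext => u; rewrite big_geq.
rewrite (_ : (fun _ => _) = fun u : rseq => (\prod_(j <= k < n) u k) * u n).
  by apply: continuous_mul => //; exact: continuous_coord.
by apply/funext => u; rewrite big_nat_recr.
Qed.

(** A section of [simplex_of_cube]. Division by 0 returns 0, which is harmless: if [t k.+2] vanishes
    then so does the smaller [t k.+1]. *)
Definition cube_of_simplex (n : nat) (t : rseq) : rseq :=
  fun k => if (k < n)%N then t k.+1 / t k.+2 else 0.

Lemma cube_of_simplexP n t : nsimplex n t -> ncube n (cube_of_simplex n t).
Proof.
move=> ht; split=> k; rewrite /cube_of_simplex; last by rewrite ltnNge => ->.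
case: ifP => _; last by rewrite lexx ler01.
have /andP[t0 _] := nsimplex_itv k.+1 ht; have [_ /(_ k.+1) tk _] := ht.
rewrite divr_ge0 // ?(le_trans t0) //=.
have [->|tN0] := eqVneq (t k.+2) 0; first by rewrite invr0 mulr0 ler01.
by rewrite ler_pdivrMr ?mul1r // lt_neqAle eq_sym tN0 (le_trans t0).
Qed.

Lemma cube_of_simplexK n t : nsimplex n t ->
  simplex_of_cube n (cube_of_simplex n t) = t.
Proof.
move=> ht; have [t0 _ t1] := ht; apply/funext => -[|j]; first by rewrite t0.
have [nj|jn] := leqP n j; first by rewrite /= big_geq // t1.
have [k] := ubnP (n - j); elim: k j jn => // k ih j jn; rewrite ltnS => nk.
rewrite simplex_of_cubeS //.
have -> : simplex_of_cube n (cube_of_simplex n t) j.+2 = t j.+2.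
  have [nj|jn'] := leqP n j.+1; first by rewrite /= big_geq // t1.
  by apply: ih => //; lia.
rewrite /cube_of_simplex jn; have [e|tN0] := eqVneq (t j.+2) 0.
  rewrite e mulr0; apply/esym/le_anti; rewrite -{1}e.
  by case/andP: (nsimplex_itv j.+1 ht) => -> _; rewrite andbT (nsimplex_mono ht).
by rewrite divfK.
Qed.

Lemma simplex_of_cube_eq0 n u j : simplex_of_cube n u j.+1 = 0 ->
  exists2 i, (i < n)%N & u i = 0.
Proof.
move=> /eqP; rewrite /= prodf_seq_eq0 => /hasP[k].
by rewrite mem_index_iota => /andP[_ kn] /eqP uk; exists k.
Qed.

(** A coordinate 1 makes two consecutive products equal, and a coordinate 0 makes the first product
    vanish, hence equal to [t_0]. So the boundary of the cube is the full preimage of the boundary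
    of the simplex, as descent requires. *)
Lemma facet_degenerate n u : (forall i, 0 <= u i <= 1) ->
  facet n u <-> degenerate n (simplex_of_cube n u).
Proof.
move=> u01; split=> [[i ni [ui|ui]]|[[|i] ni]].
- exists 0%N => //; apply/le_anti; have hs := simplex_of_cubeP n u01.
  rewrite (nsimplex_mono hs) //=.
  rewrite (le_trans (nsimplex_mono hs (_ : (1 <= i.+1)%N))) //.
  by rewrite simplex_of_cubeS // ui mul0r.
- by exists i.+1 => //; rewrite simplex_of_cubeS // ui mul1r.
- by move=> /esym /simplex_of_cube_eq0 [j jn uj]; exists j => //; left.
rewrite simplex_of_cubeS // => e.
have [/simplex_of_cube_eq0 [j jn uj]|/eqP sN0] :=
    eqVneq (simplex_of_cube n u i.+2) 0; first by exists j => //; left.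
exists i => //; right; apply: (mulIf (x := simplex_of_cube n u i.+2)).
  exact/eqP.
by rewrite mul1r.
Qed.

(** Off the facets no product vanishes, so the coordinates are recovered by cancellation. *)
Lemma simplex_of_cube_inj n u v : ncube n u -> ncube n v -> ~ facet n u ->
  simplex_of_cube n u = simplex_of_cube n v -> u = v.
Proof.
move=> cu cv fu e; apply/funext => i.
have [ni|ni] := leqP n i; first by rewrite cu.2 // cv.2.
have : simplex_of_cube n u i.+1 = simplex_of_cube n v i.+1 by rewrite e.
rewrite (simplex_of_cubeS u ni) (simplex_of_cubeS v ni) -e; apply: mulIf; apply/eqP => s0.
by have [j jn uj] := simplex_of_cube_eq0 s0; apply: fu; exists j => //; left.
Qed.

Lemma simplex_of_cube_image n : simplex_of_cube n @` ncube n = nsimplex n.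
Proof.
apply/seteqP; split=> [_ [u [u01 _] <-]|t ht]; first exact: simplex_of_cubeP.
exists (cube_of_simplex n t); [exact: cube_of_simplexP|exact: cube_of_simplexK].
Qed.

Lemma nsimplex_compact n : compact (nsimplex n).
Proof.
rewrite -simplex_of_cube_image; apply: contOn_compact (@ncube_compact R n).
by apply: contOnT; exact: continuous_simplex_of_cube.
Qed.

Lemma nsimplex_closed n : closed (nsimplex n).
Proof. by apply: compact_closed; [exact: rseq_hausdorff|exact: nsimplex_compact]. Qed.

Lemma nsimplex0 t : nsimplex 0 t -> t = fun j => (0 < j)%N%:R.
Proof. by move=> [t0 _ t1]; apply/funext => -[|j] //; rewrite t1. Qed.

Lemma vertex_nsimplex n : nsimplex n (fun j => (n < j)%N%:R : R).
Proof.
split=> // i; last by move=> ->.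
by case: (ltnP n i) => ni /=; [rewrite ltnW|exact: ler0n].
Qed.

(** One notion serves both colors: [U] is [[set 1]] at color [c] and the unit interval at color [o].
    In [prism_bd] the set [V] is where a lift is already known: nothing at color [c], the end 1 at
    color [o]. *)
Definition prism (U : set R) (n : nat) : set (rseq * R) :=
  [set q | nsimplex n q.1 /\ U q.2].

Definition prism_bd (U V : set R) (n : nat) : set (rseq * R) :=
  [set q | prism U n q /\ (degenerate n q.1 \/ V q.2)].

Lemma prism_hausdorff : hausdorff_space (rseq * R)%type.
Proof.
move=> p q cl; rewrite [p]surjective_pairing [q]surjective_pairing; congr pair.
  apply: rseq_hausdorff => A B Ap Bq.
  have [z [Az Bz]] := cl _ _ (continuous_fst Ap) (continuous_fst Bq).
  by exists z.1.
apply: (@Rhausdorff R) => A B Ap Bq.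
have [z [Az Bz]] := cl _ _ (continuous_snd Ap) (continuous_snd Bq).
by exists z.2.
Qed.

(** * Lifting on simplices and prisms *)

Section Lifting.
Variables (X Y : topologicalType) (p : X -> Y).
Hypothesis fp : serre_fibration R p.

(** The first [n] coordinates of the cube parametrize the simplex and coordinate [n] is the
    parameter of the prism; the box open at 0 is the preimage of the prescribed part. *)
Lemma prism_lifts n :
  lifts p (prism_bd [set s | 0 <= s <= 1] [set 1] n)
          (prism [set s | 0 <= s <= 1] n).
Proof.
pose r (w : rseq) := (simplex_of_cube n w, w n).
have proj_sc (w : rseq) : simplex_of_cube n (upd w n 0) = simplex_of_cube n w.
  apply/funext => -[|j] //=; apply: eq_big_nat => k /andP[_ kn].
  by rewrite updN // ltn_eqF.
apply: (lifts_descend (r := r) _ _ _ _ _ _ _ _ _ (@open_box_lifts1 _ _ _ _ fp n)).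
- exact: rseq_hausdorff.
- exact: prism_hausdorff.
- exact: ncube_compact.
- by move=> q [].
- by move=> w [].
- apply: contOnT; apply: continuous_pair; last exact: continuous_coord.
  exact: continuous_simplex_of_cube.
- apply/seteqP; split=> [_ [w cw <-]|[t s] [/= ht hs]].
    by split => /=; [exact: simplex_of_cubeP cw.1|exact: cw.1].
  exists (upd (cube_of_simplex n t) n s).
    by apply: ncube_snoc => //; exact: cube_of_simplexP.
  rewrite /r updE -proj_sc upd_last ?cube_of_simplexK //.
  exact: cube_of_simplexP.
- move=> w cw; have fd := facet_degenerate n cw.1.
  have pw : prism [set s | 0 <= s <= 1] n (r w).
    by split => /=; [exact: simplex_of_cubeP cw.1|exact: cw.1].
  by rewrite /open_box /prism_bd /=; tauto.
- move=> w w' cw cw' nb [e wn]; rewrite -(upd_id w n) -(upd_id w' n) wn.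
  rewrite -(upd_upd w n 0) -(upd_upd w' n 0); congr upd.
  apply: simplex_of_cube_inj; [exact: ncube_upd0..| |by rewrite !proj_sc].
  by move=> /facet_upd fw; apply: nb; split=> //; right.
Qed.

Hypothesis wp : weak_homotopy_equivalence R p.

(** Surjectivity on path components gives a path from the image of some point to [y]; the end of a
    lift of this path lies over [y]. *)
Lemma point_lift (y : Y) : exists x, p x = y.
Proof.
have [_ [_ /(_ y) [x0 [g [cg g0 g1]]]] _] := wp.
have [|||G [_ G0 pG]] := @serre_lifts _ _ _ _ fp 0 (fun=> x0)
  (fun w => g (itv_of (w 0%N))).
- by apply: contOnT; exact: continuous_cst.
- apply: contOnT; apply: continuous_compose cg.
  exact: continuous_compose (@continuous_coord R 0) (@continuous_itv_of R).
- by move=> w cw; rewrite cw.2 // itv_of0 g0.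
exists (G (upd (fun=> 0) 0%N 1)); rewrite pG ?updE ?itv_of1 //.
apply: ncube_snoc; last exact: (itv01 R true).
by split=> // i; exact: (itv01 R false).
Qed.

(** In dimension 0 the boundary is empty and [point_lift] applies. Otherwise the problem is pulled
    back to the cube, where it is based. *)
Lemma simplex_lifts n :
  lifts p [set t | nsimplex n t /\ degenerate n t] (@nsimplex n).
Proof.
case: n => [|n] g f cg cf gf.
  have [x px] := point_lift (f (fun j => (0 < j)%N%:R)).
  exists (fun=> x); split.
  - by apply: contOnT; exact: continuous_cst.
  - move=> t [/nsimplex0 -> [[|//] _ /= /esym/eqP]].
    by rewrite oner_eq0.
  - by move=> t /nsimplex0 ->.
pose r := simplex_of_cube n.+1.
have cr A : contOn A r by apply: contOnT; exact: continuous_simplex_of_cube.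
have rA w : ncube n.+1 w -> ncube_bd n.+1 w <->
    [set t | nsimplex n.+1 t /\ degenerate n.+1 t] (r w).
  move=> cw; have := facet_degenerate n.+1 cw.1.
  by have := simplex_of_cubeP n.+1 cw.1; rewrite /ncube_bd /r /=; tauto.
have bdC : @ncube_bd R n.+1 `<=` @ncube R n.+1 by move=> w [].
have rC w : ncube n.+1 w -> nsimplex n.+1 (r w).
  by move=> cw; exact: simplex_of_cubeP cw.1.
apply: (@liftable_descend _ _ _ _ _ (@ncube_bd R n.+1) (@ncube R n.+1)
  _ _ r) => //.
- exact: rseq_hausdorff.
- exact: rseq_hausdorff.
- exact: ncube_compact.
- by move=> t [].
- exact: simplex_of_cube_image.
- move=> w w' cw cw' nb; apply: simplex_of_cube_inj => // fw.
  by apply: nb.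
apply: (based_lifts fp wp (x := g (fun j => (n.+1 < j)%N%:R))).
- exact: contOn_descent_source bdC (cr _) rA _ _ cg.
- exact: contOn_comp (cr _) cf _.
- by move=> w bw; apply: gf; apply/rA => //; exact: bdC.
(* Every product contains the last coordinate as a factor, so its vanishing sends the whole face to
   the vertex [t_1 = ... = t_(n+1) = 0]. *)
- move=> w cw w0; congr g; apply/funext => -[|j] //; rewrite ltnS.
  have [nj|jn] := ltnP n j; first by rewrite /r /= big_geq.
  rewrite /r /=; apply/eqP; rewrite prodf_seq_eq0; apply/hasP.
  by exists n; rewrite ?mem_index_iota ?jn ?ltnSn //= w0.
Qed.

Lemma prism_cst_lifts n (c : R) :
  lifts p (prism_bd [set c] set0 n) (prism [set c] n).
Proof.
pose r (t : rseq) := (t, c).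
apply: (lifts_descend (r := r) _ _ _ _ _ _ _ _ _ (@simplex_lifts n)).
- exact: rseq_hausdorff.
- exact: prism_hausdorff.
- exact: nsimplex_compact.
- by move=> q [].
- by move=> w [].
- apply: contOnT; apply: continuous_pair; last exact: continuous_cst.
  by move=> t; exact: cvg_id.
- apply/seteqP; split=> [_ [t ht <-]//|[t s] [/= ht ->]]; by exists t.
- by move=> t ht; rewrite /prism_bd /prism /=; tauto.
- by move=> t t' _ _ _ [].
Qed.

End Lifting.
End Simplices.

(** * Lifting cosimplicial maps *)

(** Dependent choice along a family of types. The invariant [Q] carries from one step to the next
    what the extension has to know. *)
Lemma dependent_chain (A : nat -> Type) (Q : forall n, A n -> Prop)
    (E : forall n, A n -> A n.+1 -> Prop) :
  (exists a, Q 0%N a) ->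
  (forall n a, Q n a -> exists2 b, Q n.+1 b & E n a b) ->
  exists s : forall n, A n, forall n, Q n (s n) /\ E n (s n) (s n.+1).
Proof.
move=> /cid[a0 Qa0] step.
pose next n (a : {a | Q n a}) : {b | Q n.+1 b & E n (proj1_sig a) b} :=
  let c := cid2 (step n _ (proj2_sig a)) in exist2 _ _ (s2val c) (s2valP c) (s2valP' c).
pose s := fix s n : {a | Q n a} := if n is m.+1
  then exist _ (s2val (next m (s m))) (s2valP (next m (s m)))
  else exist _ a0 Qa0.
exists (fun n => proj1_sig (s n)) => n; split; first exact: proj2_sig (s n).
exact: s2valP' (next n (s n)).
Qed.

Section Cofaces.
Variable R : realType.
Notation rseq := (rseq R).
Implicit Types (t : rseq) (q : (rseq * R)%type).

(** Doubles [t_i], which parametrizes the face [t_i = t_(i+1)]. The index 0 inserts 0, and the index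
    [n.+1] inserts 1. *)
Definition coface (i : nat) (t : rseq) : rseq :=
  fun j => t (if (j <= i)%N then j else j.-1).

(** Drops [t_(i+1)]. It serves as the inverse of [coface i] on the face [t_i = t_(i+1)], where the
    dropped coordinate is a repetition. *)
Definition codegeneracy (i : nat) (t : rseq) : rseq :=
  fun j => t (if (j <= i)%N then j else j.+1).

Lemma coface_nsimplex n i t : nsimplex n t -> nsimplex n.+1 (coface i t).
Proof.
move=> ht; have [t0 _ t1] := ht; split=> // j; rewrite /coface.
  by apply: (nsimplex_mono ht); do 2 case: ifP; lia.
by move=> nj; apply: t1; case: ifP; lia.
Qed.

Lemma codegeneracy_nsimplex n i t : (i <= n.+1)%N -> t i = t i.+1 ->
  nsimplex n.+1 t -> nsimplex n (codegeneracy i t).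
Proof.
move=> ni ti ht; have [t0 _ t1] := ht; split=> // j; rewrite /codegeneracy.
  by apply: (nsimplex_mono ht); do 2 case: ifP; lia.
move=> nj; case: ifP => ji; last by apply: t1; lia.
have -> : j = i by lia.
by rewrite ti; apply: t1; lia.
Qed.

Lemma codegeneracyK i t : t i = t i.+1 -> coface i (codegeneracy i t) = t.
Proof.
move=> ti; apply/funext => j; rewrite /coface /codegeneracy.
have [ji|ij] := leqP j i; first by rewrite ji.
have [ji|ij'] := leqP j.-1 i; last by congr t; lia.
by have -> : j = i.+1 by lia.
Qed.

Lemma cofaceK i t : codegeneracy i (coface i t) = t.
Proof.
apply/funext => j; rewrite /coface /codegeneracy.
by case: (leqP j i) => ji; rewrite ?ji // leqNgt ltnS ltnW.
Qed.

Lemma coface_degenerate n i t : (i <= n)%N -> degenerate n (coface i t).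
Proof. by move=> ni; exists i => //; rewrite /coface leqnn ltnn. Qed.

Lemma codegeneracy_comm i j t : (i < j)%N ->
  codegeneracy i (codegeneracy j t) = codegeneracy j.-1 (codegeneracy i t).
Proof.
move=> ij; apply/funext => k; rewrite /codegeneracy; congr t.
by do ?case: ifP; lia.
Qed.

Lemma codegeneracy_degenerate_lt i j t : (i < j)%N -> t i = t i.+1 ->
  codegeneracy j t i = codegeneracy j t i.+1.
Proof. by move=> ij ti; rewrite /codegeneracy ij ltnW. Qed.

Lemma codegeneracy_degenerate_gt i j t : (i < j)%N -> t i = t i.+1 ->
  t j = t j.+1 -> codegeneracy i t j.-1 = codegeneracy i t j.
Proof.
move=> ij ti tj; rewrite /codegeneracy [in RHS]leqNgt ij -tj.
case: ifP => ji; last by congr t; lia.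
have ji1 : j = i.+1 by lia.
by rewrite ji1 /= ti.
Qed.

Lemma continuous_codegeneracy i : continuous (codegeneracy i).
Proof. by apply: continuous_rseq => j; exact: continuous_coord. Qed.

Definition coface1 i q : rseq * R := (coface i q.1, q.2).
Definition codegeneracy1 i q : rseq * R := (codegeneracy i q.1, q.2).

(** * Construction of a cosimplicial lift, dimension by dimension *)

Section Construction.
Variables (U V : set R).
Hypotheses (cU : closed U) (cV : closed V) (VU : V `<=` U).

Lemma prism_closed n : closed (prism U n).
Proof.
rewrite (_ : prism U n = (fst @^-1` @nsimplex R n) `&` (snd @^-1` U)) //.
apply: closedI.
  have /continuous_closedP h := @continuous_fst rseq R.
  by apply: h; exact: nsimplex_closed.
by have /continuous_closedP h := @continuous_snd rseq R; apply: h.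
Qed.

Variables (X_ Y_ : nat -> topologicalType) (p : forall n, X_ n -> Y_ n).
Variables (d : forall n, nat -> X_ n -> X_ n.+1).
Variables (dY : forall n, nat -> Y_ n -> Y_ n.+1).
Arguments d {n}. Arguments dY {n}. Arguments p {n}.
Hypothesis dc : forall n i, continuous (d (n := n) i).
Hypothesis dd : forall n i j (x : X_ n), (i < j)%N -> (j <= n.+2)%N ->
  d j (d i x) = d i (d j.-1 x).
Hypothesis pd : forall n i (x : X_ n), (i <= n.+1)%N -> p (d i x) = dY i (p x).
Variable g : forall n, rseq * R -> Y_ n.
Hypothesis gc : forall n, contOn (prism U n) (g n).
Hypothesis gd : forall n i q, prism U n q -> (i <= n.+1)%N ->
  g n.+1 (coface1 i q) = dY i (g n q).
Variable k : forall n, rseq * R -> X_ n.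
Hypothesis kc : forall n, contOn (prism V n) (k n).
Hypothesis kd : forall n i q, prism V n q -> (i <= n.+1)%N ->
  k n.+1 (coface1 i q) = d i (k n q).
Hypothesis pk : forall n q, prism V n q -> p (k n q) = g n q.
Hypothesis plifts : forall n,
  lifts (p (n := n)) (prism_bd U V n) (prism U n).

Definition lift_at n (f : rseq * R -> X_ n) : Prop :=
  [/\ contOn (prism U n) f, forall q, prism U n q -> p (f q) = g n q
    & forall q, prism V n q -> f q = k n q].

Definition cosimplicial_at n (f : rseq * R -> X_ n) (f' : rseq * R -> X_ n.+1) :=
  forall i q, prism U n q -> (i <= n.+1)%N -> f' (coface1 i q) = d i (f q).

(** Two faces meet in codimension two, so the values forced on them can be compared only if the
    current map is itself compatible with one in the dimension below. *)
Definition has_predecessor n : (rseq * R -> X_ n) -> Prop :=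
  if n is m.+1 then fun f => exists f', cosimplicial_at (n := m) f' f
  else fun=> True.

Lemma degenerate0 (t : rseq) : nsimplex 0 t -> ~ degenerate 0 t.
Proof.
by move=> /nsimplex0 -> [[|//] _ /= /esym/eqP]; rewrite oner_eq0.
Qed.

Lemma codegeneracy1_prism (U' : set R) n i q : (i <= n.+1)%N ->
  q.1 i = q.1 i.+1 -> prism U' n.+1 q -> prism U' n (codegeneracy1 i q).
Proof.
by move=> ni qi [hq Uq]; split=> //=; exact: codegeneracy_nsimplex.
Qed.

Lemma codegeneracy1K i q : q.1 i = q.1 i.+1 -> coface1 i (codegeneracy1 i q) = q.
Proof. by case: q => t s /= ti; rewrite /coface1 /= codegeneracyK. Qed.

Section Step.
Variables (n : nat) (f : rseq * R -> X_ n).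
Hypotheses (hf : lift_at f) (hp : has_predecessor f).

Let face i q := d i (f (codegeneracy1 i q)).

(** On the intersection, [f] at either codegeneracy is a coface of the predecessor [f'] at the point
    with both repetitions removed; the cosimplicial identity [dd] then equates the two values. *)
Lemma face_compat_lt i j q : prism U n.+1 q -> (i < j)%N -> (j <= n.+1)%N ->
  q.1 i = q.1 i.+1 -> q.1 j = q.1 j.+1 -> face i q = face j q.
Proof.
move=> hq ij jn qi qj; rewrite /face.
case: n f hf hp hq jn => [|m] f1 hf1 /= hp1 hq jn.
  (* In dimension 1 the faces are the two ends of an interval and do not meet. *)
  have [i0 j1] : i = 0%N /\ j = 1%N by lia.
  rewrite i0 in qi; rewrite j1 in qj.
  have [[q0 _ q1] _] := hq; exfalso.
  have : q.1 0%N = 1 by rewrite qi qj q1.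
  by rewrite q0 => /esym/eqP; rewrite oner_eq0.
case: hp1 => f' hf'.
have in1 : (i <= m.+2)%N by lia.
have hqj := codegeneracy1_prism jn qj hq.
have hqi := codegeneracy1_prism in1 qi hq.
have ei := codegeneracy_degenerate_lt ij qi.
have ej : (codegeneracy1 i q).1 j.-1 = (codegeneracy1 i q).1 j.-1.+1.
  by rewrite prednK ?(leq_ltn_trans _ ij) //; exact: codegeneracy_degenerate_gt.
have eqj := codegeneracy1K (q := codegeneracy1 j q) ei.
have eqi := codegeneracy1K ej.
have im : (i <= m.+1)%N by lia.
have jm : (j.-1 <= m.+1)%N by lia.
have ej' := codegeneracy1_prism jm ej hqi.
have ei' := codegeneracy1_prism (q := codegeneracy1 j q) im ei hqj.
rewrite -eqi -eqj (hf' _ _ ej' jm) (hf' _ _ ei' im).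
rewrite [RHS]dd //; congr (d _ (d _ (f' _))).
by rewrite /codegeneracy1 /= (codegeneracy_comm _ ij).
Qed.

Lemma face_compat i j q : prism U n.+1 q -> (i <= n.+1)%N -> (j <= n.+1)%N ->
  q.1 i = q.1 i.+1 -> q.1 j = q.1 j.+1 -> face i q = face j q.
Proof.
move=> hq ni nj qi qj; case: (ltngtP i j) => [ij|ji|->//].
  exact: face_compat_lt.
exact/esym/face_compat_lt.
Qed.

(** The values forced on the boundary. The choice of a face is immaterial by [face_compat]; off the
    faces only the part over [V] counts, and there [k] is prescribed. *)
Let bd q := if pselect (exists i, (i <= n.+1)%N /\ q.1 i = q.1 i.+1) is left e
  then face (projT1 (cid e)) q else k n.+1 q.

Lemma bd_face i q : prism U n.+1 q -> (i <= n.+1)%N -> q.1 i = q.1 i.+1 ->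
  bd q = face i q.
Proof.
move=> hq ni qi; rewrite /bd; case: pselect => [e|]; last by case; exists i.
by case: (cid e) => j /= [nj qj]; exact: face_compat.
Qed.

Lemma bd_k q : prism V n.+1 q -> bd q = k n.+1 q.
Proof.
move=> hq; rewrite /bd; case: pselect => // e.
case: (cid e) => j /= [nj qj]; rewrite /face.
have [_ _ fk] := hf; have hc := codegeneracy1_prism nj qj hq.
by rewrite fk // -kd // codegeneracy1K.
Qed.

Lemma step_lift : exists2 f' : rseq * R -> X_ n.+1,
  lift_at f' /\ has_predecessor (n := n.+1) f' & cosimplicial_at f f'.
Proof.
have [fc pf fk] := hf.
have VUp m q : prism V m q -> prism U m q by case=> ? /VU.
(* A finite union of closed pieces, on each of which [bd] has a single continuous formula. *)
have prism_bdE : prism_bd U V n.+1 =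
    (\bigcup_(i in [set i | (i < n.+2)%N])
      (prism U n.+1 `&` [set q | q.1 i = q.1 i.+1])) `|`
    (prism U n.+1 `&` [set q | V q.2]).
  apply/seteqP; split=> q.
    case=> hq [[i ni qi]|Vq]; [left|right] => //.
    by exists i.
  by case=> [[i ni [hq qi]]|[hq Vq]]; split=> //; [left; exists i|right].
have cF i : closed [set q : rseq * R | q.1 i = q.1 i.+1].
  have -> : [set q : rseq * R | q.1 i = q.1 i.+1] =
      [set q | q.1 i <= q.1 i.+1] `&` [set q | q.1 i.+1 <= q.1 i].
    apply/seteqP; split=> q /=; first by move=> ->.
    by move=> [h1 h2]; apply/le_anti; rewrite h1 h2.
  by apply: closedI; apply: closed_le;
    apply: continuous_coord_of; exact: continuous_fst.
have cb : contOn (prism_bd U V n.+1) bd.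
  rewrite prism_bdE; apply: contOnU.
  - apply: closed_bigcup; first exact: finite_II.
    by move=> i _; apply: closedI => //; exact: prism_closed.
  - apply: closedI; first exact: prism_closed.
    by have /continuous_closedP h := @continuous_snd rseq R; apply: h.
  - apply: contOn_glue_finite => i ni.
      by apply: closedI => //; exact: prism_closed.
    apply: (contOn_eq (f := face i)) => [q [hq qi]|]; first by rewrite (bd_face hq ni).
    have cfi : contOn (prism U n.+1 `&` [set q | q.1 i = q.1 i.+1])
        (f \o codegeneracy1 i).
      apply: contOn_comp _ fc _; last first.
        by move=> q [hq qi]; exact: codegeneracy1_prism.
      apply: contOnT; apply: continuous_pair; last exact: continuous_snd.
      exact: continuous_compose (@continuous_fst _ _) (@continuous_codegeneracy i).
    exact: (contOn_comp cfi (contOnT (A := setT) (@dc n i)) (fun _ _ => I)).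
  - apply: (contOn_eq (f := k n.+1)) => [q [hq Vq]|].
      by rewrite bd_k //; case: hq.
    by apply: (contOnS _ (@kc n.+1)) => q [[hq _] Vq].
have [|f' [f'c f'b f'g]] := @plifts n.+1 bd (g n.+1) cb (@gc n.+1).
  move=> q [hq [[i ni qi]|Vq]].
    rewrite (bd_face hq ni qi) /face pd // pf; last exact: codegeneracy1_prism.
    rewrite -gd //; last exact: codegeneracy1_prism.
    by rewrite codegeneracy1K.
  by rewrite bd_k ?pk //; split=> //; exact: hq.1.
have ff' : cosimplicial_at f f'.
  move=> i q hq ni.
  have hcq : prism U n.+1 (coface1 i q).
    by case: hq => hq Uq; split=> //=; exact: coface_nsimplex.
  have qi : (coface1 i q).1 i = (coface1 i q).1 i.+1 by rewrite /= /coface leqnn ltnn.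
  rewrite f'b; last by split=> //; left; exact: coface_degenerate.
  rewrite (bd_face hcq ni qi) /face; congr (d _ (f _)).
  by case: (q) => t s; rewrite /codegeneracy1 /= cofaceK.
exists f' => //; split; last by exists f.
split=> // q hq; rewrite f'b; last by split; [exact: VUp|right; exact: hq.2].
exact: bd_k.
Qed.

End Step.

Lemma cosimplicial_lift :
  exists h : forall n, rseq * R -> X_ n, forall n,
    lift_at (h n) /\ cosimplicial_at (h n) (h n.+1).
Proof.
have [||s hs] := @dependent_chain (fun n => rseq * R -> X_ n)
    (fun n f => lift_at f /\ has_predecessor f) cosimplicial_at.
(* A simplex of dimension 0 has no faces, so only the values over [V] are prescribed at the
   start. *)
- have bV q : prism_bd U V 0 q -> prism V 0 q.
    by case=> -[hq Uq] [/(degenerate0 hq)//|Vq]; split.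
  have [|||f [fc fb fg]] := @plifts 0%N (k 0) (g 0).
  + by apply: (contOnS _ (@kc 0%N)) => q /bV.
  + exact: gc.
  + by move=> q /bV; exact: pk.
  exists f; split=> //; split=> // q hq; apply: fb.
  by case: hq => hq Vq; split; [split=> //; exact: VU|right].
- by move=> n f [hf hp]; exact: step_lift.
by exists s => n; have [[]] := hs n.
Qed.

End Construction.
End Cofaces.

(** * The sequence D *)

(** A continuous injection of a compact space into a Hausdorff one is an embedding, so continuity
    may be tested after it. It is applied to [D_code]. *)
Lemma contOn_embedding (T X Z : topologicalType) (A : set T) (j : X -> Z)
    (f : T -> X) :
  compact [set: X] -> hausdorff_space Z -> continuous j -> injective j ->
  contOn A (j \o f) -> contOn A f.
Proof.
move=> cX hZ cj ij cjf x Ax N; rewrite nbhsE => -[Q [oQ Qfx] QN].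
have cQ : compact (~` Q).
  by apply: (subclosed_compact _ cX) => //; exact: open_closedC.
have clQ : closed (j @` (~` Q)).
  by apply: compact_closed => //; apply: contOn_compact cQ; exact: contOnT.
have nb : nbhs (j (f x)) (~` (j @` (~` Q))).
  apply: open_nbhs_nbhs; split; first exact: closed_openC.
  by case=> z nQz /ij zfx; apply: nQz; rewrite zfx.
have := cjf x Ax _ nb; rewrite /nbhs /= /within /=.
apply: filterS => y h Ay; apply: QN; apply: contrapT => nQ.
by apply: (h Ay); exists (f y).
Qed.

Lemma continuous_kify (X Y : topologicalType) (f : X -> Y) :
  continuous f -> continuous (f : kify X -> Y).
Proof.
move=> /continuousP cf; apply/continuousP => A oA.
by rewrite kify_openE => K _; exists (f @^-1` A) => //; exact: cf.
Qed.

(** The number of inputs [c], which is the dimension of the simplex factor of [D] in both colors. *)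
Definition arity (l : seq color) (t : color) : nat :=
  if t is col_o then (size l).-1 else size l.

Definition ast2 (s : color) : Act_pos [:: col_c; s] s :=
  if s is col_o then ast2o else ast2c.

Section DCoordinates.
Variable R : realType.
Notation rseq := (rseq R).
Implicit Types (s : seq R) (l : seq color) (t : color).

(** The default 1 of [nth] supplies the coordinates beyond the last one. *)
Definition ext (s : seq R) : rseq := nth 1 (0 :: s).

Lemma ext_inj s s' : size s = size s' -> ext s = ext s' -> s = s'.
Proof.
move=> ss e; apply: (@eq_from_nth _ 1) => // i _.
by have := congr1 (fun w : rseq => w i.+1) e.
Qed.

Lemma ext_mkseq n (w : rseq) : nsimplex n w ->
  ext (mkseq (fun i => w i.+1) n) = w.
Proof.
move=> [w0 _ w1]; apply/funext => -[|i]; rewrite /ext //=.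
by case: (ltnP i n) => ni; [rewrite nth_mkseq|rewrite nth_default ?size_mkseq // w1].
Qed.

Lemma coords_row n (w : rseq) :
  coords (\row_(i < n) w i.+1) = mkseq (fun i => w i.+1) n.
Proof.
apply: (@eq_from_nth _ 0) => [|i]; rewrite size_coords ?size_mkseq // => ni.
by rewrite nth_mkseq // (nth_coords _ (Ordinal ni)) mxE.
Qed.

Lemma simplexP n (x : 'rV[R]_n) : simplex x <-> nsimplex n (ext (coords x)).
Proof.
have extE i : (i <= n.+1)%N ->
    nth 0 (0 :: rcons (coords x) 1) i = ext (coords x) i.
  case: i => [|i] //=; rewrite ltnS => ni; rewrite nth_rcons size_coords.
  rewrite /ext /=; case: ltngtP ni => // [ni|->] _.
    by apply: set_nth_default; rewrite size_coords.
  by rewrite nth_default ?size_coords.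
have ext1 i : (n < i)%N -> ext (coords x) i = 1.
  by case: i => // i ni; rewrite /ext nth_default //= size_coords.
split=> [/(pathP 0) h|[_ h _]].
  split=> // i; have [ni|ni] := leqP i n; last by rewrite !ext1 // ltnW.
  have := h i; rewrite size_rcons size_coords ltnS => /(_ ni).
  by rewrite -[X in _ <= X]/(nth 0 (0 :: rcons (coords x) 1) i.+1) !extE // leqW.
apply/(pathP 0) => i; rewrite size_rcons size_coords ltnS => ni.
rewrite -[X in _ <= X]/(nth 0 (0 :: rcons (coords x) 1) i.+1) !extE //.
exact: leqW.
Qed.

Definition param_range (t : color) : set R :=
  if t is col_o then [set s | 0 <= s <= 1] else [set 1].

(** Points of color [c] carry the constant parameter 1, the value given by [ast2o \circ_1 -]; in
    these coordinates that operation is the identity. *)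
Definition D_code l t : D_seq R l t -> rseq * R :=
  match t return D_seq R l t -> rseq * R with
  | col_c => fun x => (ext (D_c_pts x), 1)
  | col_o => fun x => (ext (D_o_pts x).1, (D_o_pts x).2)
  end.

Lemma D_codeP l t (x : D_seq R l t) :
  has_inputs l t /\ prism (param_range t) (arity l t) (D_code x).
Proof.
case: t x => -[x hx]; have := set_mem hx.
  case=> hl [/= /simplexP hs]; rewrite in_itv /= => h01.
  by split=> //; split.
by case=> hl /simplexP hs; split=> //; split.
Qed.

Lemma D_code_inj l t : injective (@D_code l t).
Proof.
case: t => -[x hx] [y hy] [e].
  move=> e2; apply: val_inj => /=; case: x y hx hy e e2 => [x u] [y v] _ _ /=.
  move=> /ext_inj e ->; congr pair; apply/rowP => i.
  by rewrite -nth_coords e ?size_coords // nth_coords.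
apply: val_inj => /=; apply/rowP => i; have {}e := ext_inj _ e.
by rewrite -nth_coords [X in nth _ X](e _) ?size_coords // nth_coords.
Qed.

Lemma D_code_surj l t (q : rseq * R) : has_inputs l t ->
  prism (param_range t) (arity l t) q -> exists x : D_seq R l t, D_code x = q.
Proof.
case: q => w u hl [/= hw hu].
have := coords_row (arity l t) w => cw.
have sw : simplex (\row_(i < arity l t) w i.+1).
  by apply/simplexP; rewrite cw ext_mkseq.
case: t hl hw hu sw cw => /= hl hw hu sw cw.
  have h : @D_o_set R l (\row_(i < (size l).-1) w i.+1, u) by split.
  exists (exist (fun x => x \in @D_o_set R l) _ (mem_set h)).
  by rewrite /D_code /D_o_pts /= cw ext_mkseq.
have h : @D_c_set R l (\row_(i < size l) w i.+1) by split.
exists (exist (fun x => x \in @D_c_set R l) _ (mem_set h)).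
by rewrite /D_code /D_c_pts /= cw ext_mkseq // hu.
Qed.

Lemma continuous_ext_coords n : continuous (fun x : 'rV[R]_n => ext (coords x)).
Proof.
apply: continuous_rseq => -[|i]; first exact: continuous_cst.
have [ni|ni] := ltnP i n.
  rewrite (_ : (fun _ => _) = fun x : 'rV[R]_n => x ord0 (Ordinal ni)).
    exact: coord_continuous.
  apply/funext => x; rewrite /ext /= -(nth_coords x (Ordinal ni)).
  by apply: set_nth_default; rewrite size_coords.
rewrite (_ : (fun _ => _) = fun=> 1); first exact: continuous_cst.
by apply/funext => x; rewrite /ext /= nth_default // size_coords.
Qed.

Lemma continuous_D_code l t : continuous (@D_code l t).
Proof.
case: t => /=; apply: continuous_pair.
- apply: (continuous_compose _ (@continuous_ext_coords _)).
  exact: continuous_compose (@initial_continuous _ _ _) (@continuous_fst _ _).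
- exact: continuous_compose (@initial_continuous _ _ _) (@continuous_snd _ _).
- exact: continuous_compose (@initial_continuous _ _ _) (@continuous_ext_coords _).
- exact: continuous_cst.
Qed.

Lemma D_compact l t : compact [set: D_seq R l t].
Proof.
by case: t; apply: set_type_compact; [exact: D_o_compact|exact: D_c_compact].
Qed.

Lemma contOn_to_D (T : topologicalType) (A : set T) l t (f : T -> D_seq R l t) :
  contOn A (@D_code l t \o f) -> contOn A f.
Proof.
apply: contOn_embedding.
- exact: D_compact.
- exact: prism_hausdorff.
- exact: continuous_D_code.
- exact: D_code_inj.
Qed.

Lemma continuous_to_D (T : topologicalType) l t (f : T -> D_seq R l t) :
  continuous (@D_code l t \o f) -> continuous f.
Proof. by move=> h; apply: contOn_setT; apply: contOn_to_D; exact: contOnT. Qed.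

Lemma param_range1 t : param_range t 1.
Proof. by case: t; rewrite /= ?ler01 ?lexx. Qed.

Lemma D_inhabited l t : has_inputs l t -> exists x : D_seq R l t, True.
Proof.
move=> hl; have [x _] : exists x : D_seq R l t,
    D_code x = ((fun j => (arity l t < j)%N%:R) : rseq, 1).
  apply: D_code_surj => //; split; [exact: vertex_nsimplex|exact: param_range1].
by exists x.
Qed.

(* Meaningful on [prism (param_range t) (arity l t)] only. *)
Definition D_decode l t (hl : has_inputs l t) (q : rseq * R) : D_seq R l t :=
  xget (projT1 (cid (D_inhabited hl))) [set x | D_code x = q].

Lemma D_decodeK l t (hl : has_inputs l t) q :
  prism (param_range t) (arity l t) q -> D_code (D_decode hl q) = q.
Proof.
move=> /(D_code_surj hl)[x xq].
by apply: (@xgetPex _ _ [set x | D_code x = q]); exists x.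
Qed.

Lemma D_codeK l t (hl : has_inputs l t) (x : D_seq R l t) :
  D_decode hl (D_code x) = x.
Proof. by apply: D_code_inj; rewrite D_decodeK //; have [] := D_codeP x. Qed.

Lemma contOn_D_decode l t (hl : has_inputs l t) :
  contOn (prism (param_range t) (arity l t)) (D_decode hl).
Proof.
apply: contOn_to_D; apply: (contOn_eq (f := id)) => [q hq|].
  by rewrite /= D_decodeK.
by apply: contOnT => q; exact: cvg_id.
Qed.

Definition reindex (rho : nat -> nat) (q : rseq * R) : rseq * R :=
  (fun j => q.1 (rho j), q.2).

Lemma continuous_reindex rho : continuous (reindex rho).
Proof.
apply: continuous_pair; last exact: continuous_snd.
apply: continuous_rseq => j; apply: continuous_coord_of.
exact: continuous_fst.
Qed.

Lemma reindex_prism (U V : set R) n n' rho q : prism U n q -> rho 0%N = 0%N ->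
  (forall i, (rho i <= rho i.+1)%N) -> (forall j, (n' < j)%N -> (n < rho j)%N) ->
  V q.2 -> prism V n' (reindex rho q).
Proof.
move=> [hq _] r0 rS rn Vq; split=> //; have [q0 _ q1] := hq; split=> /=.
- by rewrite r0.
- by move=> i; apply: (nsimplex_mono hq).
- by move=> i /rn; exact: q1.
Qed.

End DCoordinates.

(* In the coordinates [0 = t_0 <= t_1 <= ... <= 1 = 1 = ...] all the operations
   are reindexings: composing an element of [D] on the right repeats one
   coordinate, and composing on the left inserts [0]s on the left and [1]s,
   already present, on the right. *)
Definition repeat_index (a m : nat) (j : nat) : nat :=
  (minn j a.+1 + (j - (a + m)))%N.

Definition shift_index (a : nat) (j : nat) : nat := (j - a)%N.

Definition is_o (t : color) : nat := if t is col_o then 1%N else 0%N.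

Lemma arity_size l t : has_inputs l t -> (arity l t + is_o t)%N = size l.
Proof.
case: t => [/has_inputs_oP[n ->]|_] /=; last by rewrite addn0.
by rewrite size_rcons addn1.
Qed.

(** An input [o] occurs only at output [o] and only in last position. Expressed through sizes, this
    lets [lia] settle the index computations. *)
Lemma slotP l t a b s : has_inputs l t -> l = a ++ s :: b ->
  [/\ (is_o t <= size b + is_o s)%N, (is_o s <= is_o t)%N
    & (is_o s = 0 \/ size b = 0)%N].
Proof.
move=> hl el; case: t hl.
  move=> /has_inputs_oP[n en]; move: (en); rewrite el => /esym/rcons_cat_inv[_].
  by case: s {el en} => [->|[k ->]]; rewrite /= ?size_rcons; split=> //; lia.
move=> /has_inputs_cP[n en]; move: (en); rewrite el => /esym/nseq_cat_inv[-> _ _].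
by split=> //=; left.
Qed.

Lemma slot_size (l a b m l' : seq color) (s : color) :
  l = a ++ s :: b -> l' = a ++ m ++ b ->
  size l = (size a + (size b).+1)%N /\ size l' = (size a + (size m + size b))%N.
Proof. by move=> -> ->; rewrite !size_cat. Qed.

(** * An infinitesimal bimodule structure on [D] *)

Section DStructure.
Variable R : realType.
Local Notation D := (@D_seq R).

Definition D_right : Defs.pcomp D Act_pos D :=
  fun l a b m l' s t e e' x y =>
    D_decode (has_inputs_comp e e' (proj1 (D_codeP x)) (proj2 (pt_prop y)))
      (reindex (repeat_index (size a) (size m)) (D_code x)).

Definition D_left : Defs.pcomp Act_pos D D :=
  fun l a b m l' s t e e' x y =>
    D_decode (has_inputs_comp e e' (proj2 (pt_prop x)) (proj1 (D_codeP y)))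
      (reindex (shift_index (size a)) (D_code y)).

Lemma Act_pos_size l t (x : Act_pos l t) : (0 < size l)%N.
Proof. by have [l0 _] := pt_prop x; case: l l0 {x}. Qed.

Section Prism.
Variables (l a b m l' : seq color) (s t : color).
Hypotheses (e : l = a ++ s :: b) (e' : l' = a ++ m ++ b).

Lemma D_right_prism (x : D l t) (y : Act_pos m s) :
  prism (@param_range R t) (arity l' t)
    (reindex (repeat_index (size a) (size m)) (D_code x)).
Proof.
have [hl hx] := D_codeP x; have ml := Act_pos_size y.
have [_ hm] := pt_prop y; have := arity_size hl.
have := arity_size (has_inputs_comp e e' hl hm).
have [-> ->] := slot_size e e' => h1 h2; have [s1 s2 s3] := slotP hl e.
by apply: (reindex_prism hx); rewrite /repeat_index; [lia|lia|lia|case: hx].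
Qed.

Lemma D_left_prism (x : Act_pos l t) (y : D m s) :
  prism (@param_range R t) (arity l' t) (reindex (shift_index (size a)) (D_code y)).
Proof.
have [hm hy] := D_codeP y; have [_ hl] := pt_prop x; have := arity_size hm.
have := arity_size (has_inputs_comp e e' hl hm).
have [_ ->] := slot_size e e' => h1 h2; have [s1 s2 s3] := slotP hl e.
apply: (reindex_prism hy); rewrite /shift_index; [lia|lia|lia|case: hy => _].
rewrite /=; move: (D_code y).2 s2 => u.
by case: (s) (t) => -[] //= _ ->; rewrite ler01 lexx.
Qed.

Lemma D_rightK (x : D l t) (y : Act_pos m s) :
  D_code (D_right e e' x y) = reindex (repeat_index (size a) (size m)) (D_code x).
Proof. by rewrite D_decodeK //; exact: D_right_prism. Qed.

Lemma D_leftK (x : Act_pos l t) (y : D m s) :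
  D_code (D_left e e' x y) = reindex (shift_index (size a)) (D_code y).
Proof. by rewrite D_decodeK //; exact: D_left_prism. Qed.

End Prism.

Lemma reindex_eq (rho rho' sigma sigma' : nat -> nat) (q : rseq R * R) :
  (forall j, sigma (rho j) = sigma' (rho' j)) ->
  reindex rho (reindex sigma q) = reindex rho' (reindex sigma' q).
Proof. by move=> h; congr pair; apply/funext => j /=; rewrite h. Qed.

Lemma reindex_eq1 (rho rho' sigma : nat -> nat) (q : rseq R * R) :
  (forall j, sigma (rho j) = rho' j) ->
  reindex rho (reindex sigma q) = reindex rho' q.
Proof. by move=> h; congr pair; apply/funext => j /=; rewrite h. Qed.

Lemma reindex_eq_beyond (U : set R) n (rho rho' : nat -> nat) (q : rseq R * R) :
  prism U n q ->
  (forall j, rho j = rho' j \/ ((n < rho j) && (n < rho' j))%N) ->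
  reindex rho q = reindex rho' q.
Proof.
move=> [[_ _ q1] _] h; congr pair; apply/funext => j /=.
by case: (h j) => [->//|/andP[h1 h2]]; rewrite !q1.
Qed.

Lemma reindex_comp (rho sigma : nat -> nat) (q : rseq R * R) :
  reindex rho (reindex sigma q) = reindex (sigma \o rho) q.
Proof. by []. Qed.

Lemma reindex_id rho (q : rseq R * R) : (forall j, rho j = j) -> reindex rho q = q.
Proof.
by case: q => w u h; congr pair; apply/funext => j /=; rewrite h.
Qed.

Definition D_structure : infbimod_structure Act_pos D.
Proof.
apply: (@InfBimodStructure _ Act_pos D D_left D_right).
- move=> l a b m l' s t e e'; apply: continuous_to_D.
  rewrite (_ : _ \o _ = fun p : kify (Act_pos l t * D m s)%type =>
    reindex (shift_index (size a)) (D_code p.2)).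
    apply: continuous_kify; apply: (continuous_compose _ (@continuous_reindex _ _)).
    exact: continuous_compose (@continuous_snd _ _) (@continuous_D_code _ _ _).
  by apply/funext => p; exact: D_leftK.
- move=> l a b m l' s t e e'; apply: continuous_to_D.
  rewrite (_ : _ \o _ = fun p : kify (D l t * Act_pos m s)%type =>
    reindex (repeat_index (size a) (size m)) (D_code p.1)).
    apply: continuous_kify; apply: (continuous_compose _ (@continuous_reindex _ _)).
    exact: continuous_compose (@continuous_fst _ _) (@continuous_D_code _ _ _).
  by apply/funext => p; exact: D_rightK.
- move=> l m n lm mn lmn a b c d s u t e1 e1' e2 e2' e3 e3' e4' x y z.
  apply: D_code_inj; rewrite !D_rightK; apply: reindex_eq1 => j.
  have hz := Act_pos_size z; rewrite e3' e3 /repeat_index !size_cat /=; lia.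
- move=> l m n lm mn lmn a b c d s u t e1 e1' e2 e2' e3 e3' e4' x y z.
  apply: D_code_inj; rewrite D_rightK !D_leftK D_rightK; apply: reindex_eq => j.
  have hz := Act_pos_size z; rewrite /repeat_index /shift_index !size_cat /=; lia.
- move=> l m n lm mn lmn a b c d s u t e1 e1' e2 e2' e3 e3' e4' x y z.
  apply: D_code_inj; rewrite !D_leftK; apply/esym; apply: reindex_eq1 => j.
  by rewrite /shift_index size_cat; lia.
- move=> l m n lm ln lmn a b c s u t e1 e1' e2 e2' e3 e3' e4 e4' x y z.
  apply: D_code_inj; rewrite !D_rightK; apply: reindex_eq => j.
  have hz := Act_pos_size z; have hy := Act_pos_size y.
  by rewrite /repeat_index !size_cat /=; lia.
- move=> l m n lm ln lmn a b c s u t e1 e1' e2 e2' e3 e3' e4 e4' x y z.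
  apply: D_code_inj; rewrite D_rightK !D_leftK reindex_comp.
  (* Here [z] acts to the right of the slot of [y], where all coordinates are already 1; the two
     index maps differ only beyond the arity of [y]. *)
  have [hm hy] := D_codeP y; have am := arity_size hm.
  apply: (reindex_eq_beyond hy) => j; have hz := Act_pos_size z.
  rewrite /repeat_index /shift_index /= !size_cat /=.
  by case: (leqP j (size a + (size m + size b)).+1) => hj; [left|right]; lia.
- move=> l m n lm ln lmn a b c s u t e1 e1' e2 e2' e3 e3' e4 e4' x y z.
  apply: D_code_inj; rewrite D_rightK !D_leftK; apply/esym; apply: reindex_eq1 => j.
  have hy := Act_pos_size y.
  by rewrite /repeat_index /shift_index !size_cat /=; lia.
- move=> l t e e' x; apply: D_code_inj; rewrite D_leftK; apply: reindex_id => j.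
  exact: subn0.
- move=> l a b s t e e' x; apply: D_code_inj; rewrite D_rightK.
  by apply: reindex_id => j; rewrite /repeat_index /=; lia.
Defined.

End DStructure.


(** * The prescribed operations in coordinates *)

Section DOperations.
Variable R : realType.
Local Notation D := (@D_seq R).
Implicit Types s : seq R.

Lemma ext_repeat_at i s : (i < size s)%N ->
  ext (repeat_at i.+1 s) = coface i.+1 (ext s).
Proof.
move=> is_; apply/funext => -[|j] //; rewrite /ext /coface /repeat_at /=.
rewrite nth_cat size_take_min (minn_idPl is_) ltnS.
case: leqP => ji; first by rewrite nth_take.
by rewrite nth_drop; case: j ji => // j ji; rewrite subSS subnKC.
Qed.

Lemma ext_cons0 s : ext (0 :: s) = coface 0 (ext s).
Proof. by apply/funext => -[|j]. Qed.

Lemma ext_rcons1 s : ext (rcons s 1) = ext s.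
Proof.
apply/funext => -[|j] //; rewrite /ext /= nth_rcons.
case: ltngtP => // [js|->]; first by rewrite nth_default // ltnW.
by rewrite nth_default.
Qed.

(** The inserted 1 is already present in the padding. *)
Lemma coface_last n (w : rseq R) : nsimplex n w -> coface n.+1 w = w.
Proof.
move=> [_ _ w1]; apply/funext => j; rewrite /coface; case: leqP => // nj.
by rewrite !w1 //; lia.
Qed.

Lemma size_D_c_pts l (x : D l col_c) : size (D_c_pts x) = size l.
Proof. exact: size_coords. Qed.

Lemma size_D_o_pts l (x : D l col_o) : size (D_o_pts x).1 = (size l).-1.
Proof. exact: size_coords. Qed.

Lemma reindex_repeat2 a (q : rseq R * R) :
  reindex (repeat_index a 2) q = coface1 a.+1 q.
Proof.
congr pair; apply/funext => j; rewrite /coface /=; congr (q.1 _).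
by rewrite /repeat_index; case: leqP; lia.
Qed.

Lemma reindex_shift1 (q : rseq R * R) : reindex (shift_index 1) q = coface1 0 q.
Proof.
congr pair; apply/funext => j; rewrite /coface /=; congr (q.1 _).
by rewrite /shift_index; case: leqP; lia.
Qed.

Lemma reindex_shift0 (q : rseq R * R) : reindex (shift_index 0) q = q.
Proof. by apply: reindex_id => j; exact: subn0. Qed.

Lemma D_c_ptsP l (x : D l col_c) s : size s = size l ->
  (D_code x).1 = ext s -> D_c_pts x = s.
Proof. by move=> ss; apply: ext_inj; rewrite size_D_c_pts. Qed.

Lemma D_o_ptsP l (x : D l col_o) s u : size s = (size l).-1 ->
  D_code x = (ext s, u) -> D_o_pts x = (s, u).
Proof.
move=> ss [e <-]; rewrite [LHS]surjective_pairing; congr pair.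
by apply: ext_inj e; rewrite size_D_o_pts.
Qed.

Lemma size_repeat_at i s : (i < size s)%N ->
  size (repeat_at i.+1 s) = (size s).+1.
Proof.
by move=> h; rewrite size_cat size_take_min size_drop (minn_idPl h) /=; lia.
Qed.

Lemma slot_c_lt l a b t : has_inputs l t -> l = a ++ col_c :: b ->
  (size a < arity l t)%N.
Proof.
move=> hl el; have [s1 _ _] := slotP hl el; have := arity_size hl.
by rewrite el size_cat /= in s1 *; lia.
Qed.

Lemma slot_o_last l a b t : has_inputs l t -> l = a ++ col_o :: b ->
  [/\ t = col_o, b = [::] & size a = arity l t].
Proof.
move=> hl el; have [_ s2 s3] := slotP hl el.
have b0 : b = [::] by apply/nilP; case: s3 => // /eqP.
split=> //; first by case: t s2 {hl}.
by have := arity_size hl; rewrite {2}el b0 size_cat /=; case: t s2 {hl} => //=; lia.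
Qed.

Lemma D_structure_right (l a b m l' : seq color) (s t : color) (e : l = a ++ s :: b)
    (e' : l' = a ++ m ++ b) (x : D l t) (y : Act_pos m s) :
  D_code (ib_right (D_structure R) e e' x y) =
    reindex (repeat_index (size a) (size m)) (D_code x).
Proof. exact: D_rightK. Qed.

Lemma D_structure_left (l a b m l' : seq color) (s t : color) (e : l = a ++ s :: b)
    (e' : l' = a ++ m ++ b) (x : Act_pos l t) (y : D m s) :
  D_code (ib_left (D_structure R) e e' x y) =
    reindex (shift_index (size a)) (D_code y).
Proof. exact: D_leftK. Qed.

Lemma D_structure_operations : D_operations (D_structure R).
Proof.
split.
- move=> l a b l' e e' x; have [hl _] := D_codeP x.
  have al := slot_c_lt hl e; have [sl sl'] := slot_size e e'.
  apply: D_c_ptsP; first by rewrite size_repeat_at size_D_c_pts // sl' sl /=; lia.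
  by rewrite D_structure_right reindex_repeat2 ext_repeat_at ?size_D_c_pts.
- move=> l a b l' e e' x; have [hl _] := D_codeP x.
  have al := slot_c_lt hl e; have [sl sl'] := slot_size e e'.
  apply: D_o_ptsP.
    by rewrite size_repeat_at size_D_o_pts // sl'; move: al; rewrite /= sl; lia.
  by rewrite D_structure_right reindex_repeat2 ext_repeat_at // size_D_o_pts.
- move=> l a l' e e' x; have [hl hx] := D_codeP x.
  have [_ _ al] := slot_o_last hl e; have [sl sl'] := slot_size e e'.
  apply: D_o_ptsP; first by rewrite size_rcons size_D_o_pts sl' sl /=; lia.
  rewrite D_structure_right reindex_repeat2 ext_rcons1 al; congr pair.
  by apply: coface_last; case: hx.
- move=> l l' e e' x; have [sl sl'] := slot_size e e'.
  apply: D_c_ptsP; first by rewrite /= size_D_c_pts sl' /=; lia.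
  by rewrite D_structure_left reindex_shift1 ext_cons0.
- move=> l l' e e' x; have [sl sl'] := slot_size e e'.
  apply: D_c_ptsP; first by rewrite size_rcons size_D_c_pts sl' /=; lia.
  by rewrite D_structure_left reindex_shift0 ext_rcons1.
- move=> l l' e e' x; have [sl sl'] := slot_size e e'.
  have [hl _] := D_codeP x; have := arity_size hl; rewrite /= => al.
  apply: D_o_ptsP; first by rewrite /= size_D_o_pts sl' /=; lia.
  by rewrite D_structure_left reindex_shift1 ext_cons0.
- move=> l l' e e' x; have [sl sl'] := slot_size e e'.
  apply: D_o_ptsP; first by rewrite size_D_c_pts sl' /=; lia.
  by rewrite D_structure_left reindex_shift0.
Qed.

Variable B : infbimod_structure Act_pos D.
Hypothesis hB : D_operations B.

(** The three prescribed right actions become one formula: at the input [o] the appended 1 is the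
    last coface, which does not change the coded sequence. *)
Lemma D_code_right (l a b l' : seq color) (s t : color) (e : l = a ++ s :: b)
    (e' : l' = a ++ [:: col_c; s] ++ b) (x : D l t) :
  D_code (ib_right B e e' x (ast2 s)) = coface1 (size a).+1 (D_code x).
Proof.
have [hl hx] := D_codeP x; case: s e e' => e e'; last first.
  have al := slot_c_lt hl e; case: t x hl hx al => x hl hx al.
    rewrite /ast2 /D_code (D_o_right_ast2c hB) /= ext_repeat_at //.
    by rewrite size_D_o_pts.
  rewrite /ast2 /D_code (D_c_right_ast2c hB) /= ext_repeat_at //.
  by rewrite size_D_c_pts.
have [et eb al] := slot_o_last hl e; move: x hl hx al; rewrite et => x hl hx al.
move: e e'; rewrite eb => e e'.
rewrite /ast2 /D_code (D_o_right_ast2o hB) /= ext_rcons1 al; congr pair.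
by rewrite coface_last //; case: hx.
Qed.

Lemma D_code_left2 l l' t (e : [:: col_c; t] = [:: col_c] ++ t :: [::])
    (e' : l' = [:: col_c] ++ l ++ [::]) (x : D l t) :
  D_code (ib_left B e e' (ast2 t) x) = coface1 0 (D_code x).
Proof.
case: t e x => e x.
  by rewrite /ast2 /D_code (D_ast2o_left2 hB) /= ext_cons0.
by rewrite /ast2 /D_code (D_ast2c_left2 hB) /= ext_cons0.
Qed.

Lemma D_code_left1 l l' t (e : [:: col_c; t] = [::] ++ col_c :: [:: t])
    (e' : l' = [::] ++ l ++ [:: t]) (x : D l col_c) :
  D_code (ib_left B e e' (ast2 t) x) = D_code x.
Proof.
case: t e e' => e e'.
  by rewrite /ast2 /D_code (D_ast2o_left1 hB).
by rewrite /ast2 /D_code (D_ast2c_left1 hB) /= ext_rcons1.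
Qed.

End DOperations.

(** * Infinitesimal bimodules over the positive action operad *)

Section Relations.
Variable M : infbimod Act_pos.
Implicit Types l a b m n : seq color.
Implicit Types s t u : color.

Lemma cat_cons_inj (T : Type) (a a1 b b1 : seq T) (s s1 : T) :
  a ++ s :: b = a1 ++ s1 :: b1 -> size a = size a1 ->
  [/\ a = a1, s = s1 & b = b1].
Proof.
move=> h sa; have h1 := congr1 (take (size a)) h.
have h2 := congr1 (drop (size a)) h.
rewrite take_size_cat // sa take_size_cat // in h1.
rewrite drop_size_cat // sa drop_size_cat // in h2.
by case: h2 => -> ->.
Qed.

(** Here and below, axioms of infinitesimal bimodules are restated with lists that are free
    variables tied by equations. Composites in [Act_pos] may be any element of the right type, since
    such elements are unique by [pt_eq]. *)
Lemma right_right_seq l m n lm mn lmn a b c d a2 b2 s u t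
    (e : l = a ++ s :: b) (e' : lm = a ++ m ++ b)
    (e2 : lm = a2 ++ u :: b2) (e2' : lmn = a2 ++ n ++ b2)
    (e4 : lmn = a ++ mn ++ b)
    (x : M l t) (y : Act_pos m s) (z : Act_pos n u) (yz : Act_pos mn s) :
  a2 = a ++ c -> b2 = d ++ b -> m = c ++ u :: d -> mn = c ++ n ++ d ->
  ib_right M e2 e2' (ib_right M e e' x y) z = ib_right M e e4 x yz.
Proof.
move=> ha hb e3 e3'; subst a2 b2.
rewrite (ib_seq_assoc1 M e e' e2 e2' e3 e3' e4); congr ib_right.
exact: pt_eq.
Qed.

Lemma left_right_seq l m n lm mn lmn a b c d a2 b2 s u t
    (e : l = a ++ s :: b) (e' : lm = a ++ m ++ b)
    (e2 : lm = a2 ++ u :: b2) (e2' : lmn = a2 ++ n ++ b2)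
    (e3 : m = c ++ u :: d) (e3' : mn = c ++ n ++ d) (e4 : lmn = a ++ mn ++ b)
    (x : Act_pos l t) (y : M m s) (z : Act_pos n u) :
  a2 = a ++ c -> b2 = d ++ b ->
  ib_right M e2 e2' (ib_left M e e' x y) z =
    ib_left M e e4 x (ib_right M e3 e3' y z).
Proof. by move=> ha hb; subst a2 b2; exact: ib_seq_assoc2. Qed.

Lemma left_left_seq l m n lm mn lmn a b c d a2 b2 s u t
    (e : l = a ++ s :: b) (e' : lm = a ++ m ++ b)
    (e2 : lm = a2 ++ u :: b2) (e2' : lmn = a2 ++ n ++ b2)
    (e3 : m = c ++ u :: d) (e3' : mn = c ++ n ++ d) (e4 : lmn = a ++ mn ++ b)
    (x : Act_pos l t) (y : Act_pos m s) (xy : Act_pos lm t) (z : M n u) :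
  a2 = a ++ c -> b2 = d ++ b ->
  ib_left M e2 e2' xy z = ib_left M e e4 x (ib_left M e3 e3' y z).
Proof.
move=> ha hb; subst a2 b2.
rewrite -(ib_seq_assoc3 M e e' e2 e2' e3 e3' e4); congr ib_left.
exact: pt_eq.
Qed.

Lemma right_right_par l m n lm ln lmn a b c a2 c2 s u t
    (e : l = a ++ s :: (b ++ u :: c)) (e' : lm = a ++ m ++ (b ++ u :: c))
    (e2 : lm = a2 ++ u :: c) (e2' : lmn = a2 ++ n ++ c)
    (e3 : l = (a ++ s :: b) ++ u :: c) (e3' : ln = (a ++ s :: b) ++ n ++ c)
    (e4 : ln = a ++ s :: c2) (e4' : lmn = a ++ m ++ c2)
    (x : M l t) (y : Act_pos m s) (z : Act_pos n u) :
  a2 = a ++ m ++ b -> c2 = b ++ n ++ c ->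
  ib_right M e2 e2' (ib_right M e e' x y) z =
    ib_right M e4 e4' (ib_right M e3 e3' x z) y.
Proof. by move=> ha hc; subst a2 c2; exact: ib_par_assoc1. Qed.

Lemma left_right_par l m n lm ln lmn a b c a2 c2 s u t
    (e : l = a ++ s :: (b ++ u :: c)) (e' : lm = a ++ m ++ (b ++ u :: c))
    (e2 : lm = a2 ++ u :: c) (e2' : lmn = a2 ++ n ++ c)
    (e4 : ln = a ++ s :: c2) (e4' : lmn = a ++ m ++ c2)
    (x : Act_pos l t) (y : M m s) (z : Act_pos n u) (xz : Act_pos ln t) :
  a2 = a ++ m ++ b -> c2 = b ++ n ++ c ->
  ib_right M e2 e2' (ib_left M e e' x y) z = ib_left M e4 e4' xz y.
Proof.
move=> ha hc; subst a2 c2.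
have e3 : l = (a ++ s :: b) ++ u :: c by rewrite e -catA.
have e3' : ln = (a ++ s :: b) ++ n ++ c by rewrite e4 -catA.
rewrite (ib_par_assoc2 M e e' e2 e2' e3 e3' e4 e4'); congr ib_left.
exact: pt_eq.
Qed.

Lemma left_right_par_rev l m n lm ln lmn a b c a2 c2 s u t
    (e : l = (a ++ s :: b) ++ u :: c) (e' : ln = (a ++ s :: b) ++ n ++ c)
    (e2 : lm = a2 ++ u :: c) (e2' : lmn = a2 ++ n ++ c)
    (e4 : ln = a ++ s :: c2) (e4' : lmn = a ++ m ++ c2)
    (x : Act_pos l t) (y : Act_pos m s) (xy : Act_pos lm t) (z : M n u) :
  a2 = a ++ m ++ b -> c2 = b ++ n ++ c ->
  ib_right M e4 e4' (ib_left M e e' x z) y = ib_left M e2 e2' xy z.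
Proof.
move=> ha hc; subst a2 c2.
have e3 : l = a ++ s :: (b ++ u :: c) by rewrite e -catA.
have e3' : lm = a ++ m ++ (b ++ u :: c) by rewrite e2 -!catA.
rewrite -(ib_par_assoc3 M e3 e3' e2 e2' e e' e4 e4'); congr ib_left.
exact: pt_eq.
Qed.

End Relations.

Lemma has_inputs1 z s : has_inputs [:: z] s -> z = s.
Proof. by case: s => -[]. Qed.

Lemma has_inputs_behead z m s : has_inputs (z :: m) s -> m <> [::] ->
  z = col_c /\ has_inputs m s.
Proof.
case: s => h m0.
  move: h => /has_inputs_oP[[|n]] /= [-> hm]; first by case: m0.
  by split=> //; apply/has_inputs_oP; exists n.
move: h => /has_inputs_cP[[|n]] //= [-> hm].
by split=> //; apply/has_inputs_cP; exists n.
Qed.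

Lemma has_inputs_belast z m t : has_inputs (rcons m z) t -> m <> [::] ->
  z = t /\ has_inputs m col_c.
Proof.
case: t => h m0.
  move: h => /has_inputs_oP[n] /rcons_inj[-> ->].
  by split=> //; apply/has_inputs_cP; exists n.
move: h => /has_inputs_cP[[|n]]; first by case: m m0.
rewrite -[n.+1]addn1 nseqD cats1 => /rcons_inj[-> ->].
by split=> //; apply/has_inputs_cP; exists n.
Qed.

(** * Compatibility with the generators suffices *)

Section Generators.
Variables (M N : infbimod Act_pos) (f : forall l t, M l t -> N l t).
Arguments f {l t}.
Implicit Types l a b m : seq color.
Implicit Types s t : color.
Hypothesis f_right : forall l a b l' s t (e : l = a ++ s :: b)
  (e' : l' = a ++ [:: col_c; s] ++ b) (x : M l t),
  f (ib_right M e e' x (ast2 s)) = ib_right N e e' (f x) (ast2 s).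
Hypothesis f_left2 : forall l l' t (e : [:: col_c; t] = [:: col_c] ++ t :: [::])
  (e' : l' = [:: col_c] ++ l ++ [::]) (x : M l t),
  f (ib_left M e e' (ast2 t) x) = ib_left N e e' (ast2 t) (f x).
Hypothesis f_left1 : forall l l' t (e : [:: col_c; t] = [::] ++ col_c :: [:: t])
  (e' : l' = [::] ++ l ++ [:: t]) (x : M l col_c),
  f (ib_left M e e' (ast2 t) x) = ib_left N e e' (ast2 t) (f x).

(* [y = ast2 s \circ_2 y'] with [y'] of smaller arity. *)
Lemma hom_right_of_generators l a b m l' s t (e : l = a ++ s :: b)
    (e' : l' = a ++ m ++ b) (x : M l t) (y : Act_pos m s) :
  f (ib_right M e e' x y) = ib_right N e e' (f x) y.
Proof.
have [k] := ubnP (size m); elim: k => // k ih in l a b m l' s t e e' x y *.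
have [m0 hm] := pt_prop y; case: m m0 hm e' y => // z m _ hm e' y.
rewrite /= ltnS => mk.
have [m0|m0] := pselect (m = [::]).
  move: hm e' y; rewrite m0 => /has_inputs1 -> e' y.
  have ll : l' = l by rewrite e e'.
  move: e'; rewrite ll => e'; have -> : y = op_id Act_pos s by exact: pt_eq.
  have E (P : infbimod Act_pos) (w : P l t) :
    ib_right P e e' w (op_id Act_pos s) = w by exact: ib_right_unit.
  by rewrite !E.
have [zc hm'] := has_inputs_behead hm m0; move: e' y {hm}; rewrite zc => e' y.
pose y' : Act_pos m s := pt (conj m0 hm').
have e1' : a ++ [:: col_c; s] ++ b = a ++ [:: col_c; s] ++ b by [].
have e2 : a ++ [:: col_c; s] ++ b = (a ++ [:: col_c]) ++ s :: b by rewrite -catA.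
have e2' : l' = (a ++ [:: col_c]) ++ m ++ b by rewrite e' -catA.
have hm2 : col_c :: m = [:: col_c] ++ m ++ [::] by rewrite cats0.
(* Quantifying over the bimodule lets the same factorization be rewritten in [M] and in [N]. *)
have E (P : infbimod Act_pos) (w : P l t) : ib_right P e e' w y =
    ib_right P e2 e2' (ib_right P e e1' w (ast2 s)) y'.
  by apply/esym/(@right_right_seq _ _ _ _ _ _ _ _ _ [:: col_c] [::]).
by rewrite !E ih // f_right.
Qed.

(** An input in front of the slot is split off as [x = ast2 t \circ_2 x']; if the slot comes first,
    a last input behind it is split off as [x = ast2 t \circ_1 x']; with no other input [x] is a
    unit. *)
Lemma hom_left_of_generators l a b m l' s t (e : l = a ++ s :: b)
    (e' : l' = a ++ m ++ b) (x : Act_pos l t) (y : M m s) :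
  f (ib_left M e e' x y) = ib_left N e e' x (f y).
Proof.
have [k] := ubnP (size l); elim: k => // k ih in l a b m l' s t e e' x y *.
have [_ hl] := pt_prop x; rewrite ltnS => lk.
case: a e e' => [|z a] e e'; last first.
  have a0 : a ++ s :: b <> [::] by case: (a).
  have [zc hl'] : z = col_c /\ has_inputs (a ++ s :: b) t.
    by apply: has_inputs_behead => //; move: hl; rewrite e.
  subst z.
  pose x' : Act_pos (a ++ s :: b) t := pt (conj a0 hl').
  have e1 : [:: col_c; t] = [:: col_c] ++ t :: [::] by [].
  have e1' : l = [:: col_c] ++ (a ++ s :: b) ++ [::] by rewrite cats0.
  have e4 : l' = [:: col_c] ++ (a ++ m ++ b) ++ [::] by rewrite cats0.
  have E (P : infbimod Act_pos) (w : P m s) : ib_left P e e' x w =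
      ib_left P e1 e4 (ast2 t) (ib_left P erefl erefl x' w).
    by apply: (@left_left_seq _ _ _ _ _ _ _ _ _ a b _ _ _ _ _ _ e1'); rewrite ?cats0.
  rewrite !E f_left2 ih //.
  by move: lk; rewrite e /=; exact: leq_trans.
case/lastP: b e e' => [|b z] e e'.
  have st : s = t by move: hl; rewrite e => /has_inputs1.
  subst t.
  have ll : l' = m by rewrite e' cats0.
  move: e'; rewrite ll => e'; case: _ / (esym e) (e) x {lk hl} => {}e x.
  have -> : x = op_id Act_pos s by exact: pt_eq.
  have E (P : infbimod Act_pos) (w : P m s) :
    ib_left P e e' (op_id Act_pos s) w = w by exact: ib_left_unit.
  by rewrite !E.
have s0 : s :: b <> [::] by [].
have [zt hl'] : z = t /\ has_inputs (s :: b) col_c.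
  by apply: has_inputs_belast => //; move: hl; rewrite e.
subst z.
pose x' : Act_pos (s :: b) col_c := pt (conj s0 hl').
have e1 : [:: col_c; t] = [::] ++ col_c :: [:: t] by [].
have e1' : l = [::] ++ (s :: b) ++ [:: t] by rewrite e /= cats1.
have e4 : l' = [::] ++ (m ++ b) ++ [:: t] by rewrite e' /= -catA cats1.
have e3' : m ++ b = [::] ++ m ++ b by [].
have E (P : infbimod Act_pos) (w : P m s) : ib_left P e e' x w =
    ib_left P e1 e4 (ast2 t) (ib_left P erefl e3' x' w).
  by apply: (@left_left_seq _ _ _ _ _ _ _ _ _ [::] b _ _ _ _ _ _ e1'); rewrite ?cats1.
rewrite !E f_left1 ih //.
by move: lk; rewrite e /= size_rcons.
Qed.

End Generators.

Lemma continuous_from_kify (X : Defs.space) (Z : topologicalType) (f : X -> Z) :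
  continuous (f : kify X -> Z) -> continuous f.
Proof.
by move=> /continuousP cf; apply/continuousP => A /cf; exact: space_cg.
Qed.

(** Joint continuity holds for the compactly generated product. Fixing the operad element gives
    continuity on [kify (M l t)], which has the topology of [M l t] because that space is compactly
    generated. *)
Lemma ib_right_continuousl (M : infbimod Act_pos) l a b m l' s t
    (e : l = a ++ s :: b) (e' : l' = a ++ m ++ b) (y : Act_pos m s) :
  continuous (fun x : M l t => ib_right M e e' x y).
Proof.
apply: continuous_from_kify.
have cg : continuous (fun x : M l t => (x, y)).
  by apply: continuous_pair; [move=> x; exact: cvg_id|exact: continuous_cst].
exact: continuous_compose (kify_continuous cg)
  (@ib_right_continuous _ _ _ M _ _ _ _ _ _ _ e e').
Qed.

Lemma ib_left_continuousr (M : infbimod Act_pos) l a b m l' s t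
    (e : l = a ++ s :: b) (e' : l' = a ++ m ++ b) (x : Act_pos l t) :
  continuous (fun y : M m s => ib_left M e e' x y).
Proof.
apply: continuous_from_kify.
have cg : continuous (fun y : M m s => (x, y)).
  by apply: continuous_pair; [exact: continuous_cst|move=> y; exact: cvg_id].
exact: continuous_compose (kify_continuous cg)
  (@ib_left_continuous _ _ _ M _ _ _ _ _ _ _ e e').
Qed.

(** Indexed by arity instead of length, so that both colors start in dimension 0 and [word n.+1 t]
    reduces to [col_c :: word n t]. *)
Definition word (n : nat) (t : color) : seq color :=
  nseq n col_c ++ (if t is col_o then [:: col_o] else [::]).

Lemma has_inputs_word l t : has_inputs l t -> l = word (arity l t) t.
Proof.
case: t.
  move=> /has_inputs_oP[n ->].
  by rewrite /word /arity size_rcons size_nseq cats1.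
by move=> /has_inputs_cP[n ->]; rewrite /word /arity size_nseq cats0.
Qed.

Lemma word_has_inputs n t : has_inputs (word n t) t.
Proof.
by case: t; rewrite /word ?cats1 ?cats0; [apply/has_inputs_oP|apply/has_inputs_cP];
  exists n.
Qed.

Lemma size_word n t : size (word n t) = (n + is_o t)%N.
Proof. by rewrite size_cat size_nseq; case: t. Qed.

Lemma arity_word n t : arity (word n t) t = n.
Proof. by have := arity_size (word_has_inputs n t); rewrite size_word; lia. Qed.

Lemma word_left2 n t : word n.+1 t = [:: col_c] ++ word n t ++ [::].
Proof. by rewrite cats0. Qed.

Lemma word_left1 n : word n.+1 col_c = [::] ++ word n col_c ++ [:: col_c].
Proof. by rewrite /word !cats0 -addn1 nseqD. Qed.

Lemma word_o n : word n col_o = [::] ++ word n col_c ++ [:: col_o].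
Proof. by rewrite /word cats0. Qed.

Lemma word_split n t k : (k < size (word n t))%N -> word n t =
  take k (word n t) ++ nth col_c (word n t) k :: drop k.+1 (word n t).
Proof. by move=> kn; rewrite -drop_nth // cat_take_drop. Qed.

Lemma word_insert n t a s b : word n t = a ++ s :: b ->
  word n.+1 t = a ++ [:: col_c; s] ++ b.
Proof.
move=> e; have -> : word n.+1 t = col_c :: word n t by [].
rewrite e; have h := word_has_inputs n t; rewrite e in h.
have {h} -> : a = nseq (size a) col_c.
  case: t h {e} => [/has_inputs_oP|/has_inputs_cP] [k] /esym.
    by case/rcons_cat_inv.
  by case/nseq_cat_inv.
by elim: (size a) => //= j ->.
Qed.

(** * The semi-cosimplicial spaces underlying an infinitesimal bimodule *)

Section Cofaces.
Variable X : infbimod Act_pos.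

Definition level (t : color) (n : nat) : Defs.space := X (word n t) t.

(** The last coface, of index [n.+1], is a left action at color [c] but a right action on the input
    [o] at color [o]. At color [o] the second branch of the inner match is reached only for indices
    above [n.+1], where the value is arbitrary. *)
Definition bcoface t n (i : nat) (x : level t n) : level t n.+1 :=
  if i is k.+1 then
    if pselect (k < size (word n t))%N is left h then
      ib_right X (word_split h) (word_insert (word_split h)) x (ast2 _)
    else match t return level t n -> level t n.+1 with
         | col_c => fun x => ib_left X (erefl : [:: col_c; col_c] =
                      [::] ++ col_c :: [:: col_c]) (word_left1 n) (ast2 col_c) x
         | col_o => fun x => ib_left X (erefl : [:: col_c; col_o] =
                      [:: col_c] ++ col_o :: [::]) (word_left2 n col_o) (ast2 col_o) x
         end x
  else ib_left X (erefl : [:: col_c; t] = [:: col_c] ++ t :: [::])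
         (word_left2 n t) (ast2 t) x.

Definition closing n (x : level col_c n) : level col_o n :=
  ib_left X (erefl : [:: col_c; col_o] = [::] ++ col_c :: [:: col_o])
    (word_o n) (ast2 col_o) x.

Lemma bcoface_right t n a s b (e : word n t = a ++ s :: b)
    (e' : word n.+1 t = a ++ [:: col_c; s] ++ b) k (ak : size a = k)
    (x : level t n) :
  bcoface k.+1 x = ib_right X e e' x (ast2 s).
Proof.
subst k.
have ka : (size a < size (word n t))%N by rewrite e size_cat /= -addSnnS leq_addr.
rewrite /bcoface; case: pselect => [h|//].
have [|h1 h2 h3] := @cat_cons_inj _ _ a _ b _ s (etrans (esym (word_split h)) e).
  by rewrite size_take ka.
move: (word_split h) (word_insert _); rewrite h1 h2 h3 => e1 e1'.
by congr ib_right; exact: Prop_irrelevance.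
Qed.

Lemma bcoface_left2 t n (e : [:: col_c; t] = [:: col_c] ++ t :: [::])
    (e' : word n.+1 t = [:: col_c] ++ word n t ++ [::]) (x : level t n) :
  bcoface 0 x = ib_left X e e' (ast2 t) x.
Proof. by congr ib_left; exact: Prop_irrelevance. Qed.

Lemma bcoface_left1 n (e : [:: col_c; col_c] = [::] ++ col_c :: [:: col_c])
    (e' : word n.+1 col_c = [::] ++ word n col_c ++ [:: col_c])
    (x : level col_c n) :
  bcoface n.+1 x = ib_left X e e' (ast2 col_c) x.
Proof.
rewrite /bcoface; case: pselect => [h|_].
  by exfalso; move: h; rewrite size_word /= addn0 ltnn.
by congr ib_left; exact: Prop_irrelevance.
Qed.

Lemma closingE n (e : [:: col_c; col_o] = [::] ++ col_c :: [:: col_o])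
    (e' : word n col_o = [::] ++ word n col_c ++ [:: col_o]) (x : level col_c n) :
  closing x = ib_left X e e' (ast2 col_o) x.
Proof. by congr ib_left; exact: Prop_irrelevance. Qed.

Lemma bcoface_continuous t n i : continuous (@bcoface t n i).
Proof.
rewrite /bcoface; case: i => [|k]; first exact: ib_left_continuousr.
case: pselect => [h|_]; first exact: ib_right_continuousl.
by case: t; exact: ib_left_continuousr.
Qed.

Lemma closing_continuous n : continuous (@closing n).
Proof. exact: ib_left_continuousr. Qed.

Lemma has_inputs_pos3 t : has_inputs_pos [:: col_c; col_c; t] t.
Proof. by case: t. Qed.

(** When two binary operations are grafted onto each other, both sides of a coface identity are the
    action of this ternary operation. *)
Let ast3 t : Act_pos [:: col_c; col_c; t] t := pt (has_inputs_pos3 t).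

Section Words.
Implicit Types m : seq color.

Lemma left1_left2 t m m1 m2 m3
    (e1 : m1 = [:: col_c] ++ m ++ [::]) (e2 : m2 = [::] ++ m1 ++ [:: t])
    (e3 : m3 = [::] ++ m ++ [:: t]) (e4 : m2 = [:: col_c] ++ m3 ++ [::])
    (f1 : [:: col_c; col_c] = [:: col_c] ++ col_c :: [::])
    (f2 : [:: col_c; t] = [::] ++ col_c :: [:: t])
    (f4 : [:: col_c; t] = [:: col_c] ++ t :: [::]) (x : X m col_c) :
  ib_left X f2 e2 (ast2 t) (ib_left X f1 e1 (ast2 col_c) x) =
  ib_left X f4 e4 (ast2 t) (ib_left X f2 e3 (ast2 t) x).
Proof.
have f : [:: col_c; col_c; t] = [:: col_c] ++ col_c :: [:: t] by [].
have h : m2 = [:: col_c] ++ m ++ [:: t] by rewrite e2 e1 /= -!catA.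
rewrite -(@left_left_seq X _ _ _ _ _ _ _ _ [:: col_c] [::] _ _ _ _ _ f2
  (erefl : [:: col_c; col_c; t] = [::] ++ [:: col_c; col_c] ++ [:: t]) f h f1 e1 e2
  _ _ (ast3 t)) //.
by rewrite -(@left_left_seq X _ _ _ _ _ _ _ _ [::] [:: t] _ _ _ _ _ f4
  (erefl : [:: col_c; col_c; t] = [:: col_c] ++ [:: col_c; t] ++ [::]) f h f2 e3 e4
  _ _ (ast3 t)).
Qed.

Lemma left1_left1 t m m1 m2 m3
    (e1 : m1 = [::] ++ m ++ [:: col_c]) (e2 : m2 = [::] ++ m1 ++ [:: t])
    (e3 : m3 = [::] ++ m ++ [:: t]) (e4 : m3 = m ++ t :: [::])
    (e5 : m2 = m ++ [:: col_c; t] ++ [::])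
    (f1 : [:: col_c; col_c] = [::] ++ col_c :: [:: col_c])
    (f2 : [:: col_c; t] = [::] ++ col_c :: [:: t]) (x : X m col_c) :
  ib_left X f2 e2 (ast2 t) (ib_left X f1 e1 (ast2 col_c) x) =
  ib_right X e4 e5 (ib_left X f2 e3 (ast2 t) x) (ast2 t).
Proof.
have f : [:: col_c; col_c; t] = [::] ++ col_c :: [:: col_c; t] by [].
have h : m2 = [::] ++ m ++ [:: col_c; t] by rewrite e2 e1 /= -!catA.
rewrite -(@left_left_seq X _ _ _ _ _ _ _ _ [::] [:: col_c] _ _ _ _ _ f2
  (erefl : [:: col_c; col_c; t] = [::] ++ [:: col_c; col_c] ++ [:: t]) f h f1 e1 e2
  _ _ (ast3 t)) //.
by rewrite (@left_right_par X _ _ _ _ _ _ [::] [::] [::] _ _ _ _ _ f2 e3 e4 e5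
  f h _ _ _ (ast3 t)) //= cats0.
Qed.

Lemma left1_right t s m a b m1 m2 m3 a' b'
    (e : m = a ++ s :: b) (e1 : m1 = a ++ [:: col_c; s] ++ b)
    (e2 : m2 = [::] ++ m1 ++ [:: t]) (e3 : m3 = [::] ++ m ++ [:: t])
    (e4 : m3 = a' ++ s :: b') (e5 : m2 = a' ++ [:: col_c; s] ++ b')
    (f2 : [:: col_c; t] = [::] ++ col_c :: [:: t]) (x : X m col_c) :
  a' = a -> b' = b ++ [:: t] ->
  ib_left X f2 e2 (ast2 t) (ib_right X e e1 x (ast2 s)) =
  ib_right X e4 e5 (ib_left X f2 e3 (ast2 t) x) (ast2 s).
Proof. by move=> ha hb; apply/esym; exact: left_right_seq. Qed.

Lemma right_left2 t s m a b m1 m2 m3 a' b'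
    (e : m = a ++ s :: b) (e1 : m1 = a ++ [:: col_c; s] ++ b)
    (e2 : m2 = [:: col_c] ++ m1 ++ [::]) (e3 : m3 = [:: col_c] ++ m ++ [::])
    (e4 : m3 = a' ++ s :: b') (e5 : m2 = a' ++ [:: col_c; s] ++ b')
    (f2 : [:: col_c; t] = [:: col_c] ++ t :: [::]) (x : X m t) :
  a' = col_c :: a -> b' = b ->
  ib_right X e4 e5 (ib_left X f2 e3 (ast2 t) x) (ast2 s) =
  ib_left X f2 e2 (ast2 t) (ib_right X e e1 x (ast2 s)).
Proof.
by move=> ha hb; apply: left_right_seq => //; rewrite hb cats0.
Qed.

Lemma right_left2_first t m m2 m3 (e3 : m3 = [:: col_c] ++ m ++ [::])
    (e4 : m3 = [::] ++ col_c :: m) (e5 : m2 = [::] ++ [:: col_c; col_c] ++ m)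
    (e2 : m2 = [:: col_c] ++ m3 ++ [::])
    (f2 : [:: col_c; t] = [:: col_c] ++ t :: [::]) (x : X m t) :
  ib_right X e4 e5 (ib_left X f2 e3 (ast2 t) x) (ast2 col_c) =
  ib_left X f2 e2 (ast2 t) (ib_left X f2 e3 (ast2 t) x).
Proof.
have f : [:: col_c; col_c; t] = [:: col_c; col_c] ++ t :: [::] by [].
have h : m2 = [:: col_c; col_c] ++ m ++ [::] by rewrite e5 cats0.
rewrite -(@left_left_seq X _ _ _ _ _ _ _ _ [:: col_c] [::] _ _ _ _ _ f2
  (erefl : [:: col_c; col_c; t] = [:: col_c] ++ [:: col_c; t] ++ [::]) f h f2 e3 e2
  _ _ (ast3 t)) //.
by rewrite (@left_right_par_rev X _ _ _ _ _ _ [::] [::] [::] _ _ _ _ _ f2 e3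
  f h e4 e5 _ _ (ast3 t)) //= cats0.
Qed.

Lemma right_right_adjacent t s m a b m1 m2 a1 a2
    (e : m = a ++ s :: b) (e1 : m1 = a ++ [:: col_c; s] ++ b)
    (e2 : m1 = a1 ++ s :: b) (e3 : m2 = a1 ++ [:: col_c; s] ++ b)
    (e4 : m1 = a ++ col_c :: a2) (e5 : m2 = a ++ [:: col_c; col_c] ++ a2)
    (x : X m t) : a1 = a ++ [:: col_c] -> a2 = s :: b ->
  ib_right X e2 e3 (ib_right X e e1 x (ast2 s)) (ast2 s) =
  ib_right X e4 e5 (ib_right X e e1 x (ast2 s)) (ast2 col_c).
Proof.
move=> h1 h2; have h : m2 = a ++ [:: col_c; col_c; s] ++ b.
  by rewrite e3 h1 -catA.
rewrite (@right_right_seq X _ _ _ _ _ _ _ _ [:: col_c] [::] _ _ _ _ _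
  e e1 e2 e3 h x _ _ (ast3 s)) //.
by rewrite (@right_right_seq X _ _ _ _ _ _ _ _ [::] [:: s] _ _ _ _ _
  e e1 e4 e5 h x _ _ (ast3 s)) ?cats0.
Qed.

End Words.

(** Each case is one associativity axiom, or two meeting in [ast3], according to whether the cofaces
    are left or right actions and whether two right actions concern the same input. *)
Lemma bcoface_comm t n i j (x : level t n) : (i < j)%N -> (j <= n.+2)%N ->
  bcoface j (bcoface i x) = bcoface i (bcoface j.-1 x).
Proof.
case: j => // j; rewrite !ltnS => ij jn; rewrite [j.+1.-1]/=.
have f1 : [:: col_c; col_c] = [::] ++ col_c :: [:: col_c] by [].
have f2 u : [:: col_c; u] = [:: col_c] ++ u :: [::] by [].
have split u k m : (k < size (word m u))%N ->
    exists a s b, word m u = a ++ s :: b /\ size a = k.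
  move=> h; do 3 eexists; split; first exact: word_split h.
  by rewrite size_take h.
have last_case : t = col_c /\ j = n.+1 \/ (j < size (word n t) + 1)%N.
  rewrite size_word; case: (t) => /=; first by right; lia.
  by case: (leqP j n) => ?; [right|left; split=> //]; lia.
case: i ij => [_|i ij].
  rewrite (bcoface_left2 (f2 t) (word_left2 n t)).
  case: j jn last_case => [_ _|j jn last_case].
    rewrite (bcoface_left2 (f2 t) (word_left2 n t)).
    rewrite (bcoface_left2 (f2 t) (word_left2 n.+1 t)).
    have e4 : word n.+1 t = [::] ++ col_c :: word n t by [].
    rewrite (bcoface_right e4 (word_insert e4) erefl).
    exact: right_left2_first.
  case: last_case => [[tc [jE]]|jt].
    subst t j; rewrite (bcoface_left1 f1 (word_left1 n.+1)).
    rewrite (bcoface_left1 f1 (word_left1 n)).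
    rewrite (bcoface_left2 (f2 col_c) (word_left2 n.+1 col_c)).
    exact: left1_left2.
  have [|a [s [b [e sa]]]] := split t j n; first by lia.
  subst j; have e4 : word n.+1 t = (col_c :: a) ++ s :: b.
    by rewrite /= -e.
  rewrite (bcoface_right e (word_insert e) erefl).
  rewrite (bcoface_left2 (f2 t) (word_left2 n.+1 t)).
  rewrite (bcoface_right e4 (word_insert e4) erefl).
  exact: right_left2.
have [iw|wi] := ltnP i (size (word n t)); last first.
  have [tc [iE jE]] : t = col_c /\ i = n /\ j = n.+1.
    by move: wi; rewrite size_word; case: (t) => /= h; [|split=> //]; lia.
  subst t i j; rewrite !(bcoface_left1 f1 (word_left1 n)).
  rewrite (bcoface_left1 f1 (word_left1 n.+1)).
  have e4 : word n.+1 col_c = word n col_c ++ col_c :: [::] by exact: word_left1.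
  have sn : size (word n col_c) = n by rewrite size_word addn0.
  rewrite (bcoface_right e4 (word_insert e4) sn).
  exact: left1_left1.
have [a [s [b [e sa]]]] := split t i n iw; subst i.
rewrite (bcoface_right e (word_insert e) erefl).
case: last_case => [[tc jE]|jt].
  subst t j; rewrite (bcoface_left1 f1 (word_left1 n.+1)).
  rewrite (bcoface_left1 f1 (word_left1 n)).
  have e4 : word n.+1 col_c = a ++ s :: (b ++ [:: col_c]).
    by rewrite word_left1 e /= -catA.
  rewrite (bcoface_right e4 (word_insert e4) erefl).
  exact: left1_right.
(* For consecutive indices both right actions subdivide the same input; otherwise they concern
   distinct inputs and commute. *)
have [jE|ja] : j = (size a).+1 \/ ((size a).+1 < j)%N by lia.
  rewrite jE (bcoface_right e (word_insert e) erefl).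
  have e2 : word n.+1 t = (a ++ [:: col_c]) ++ s :: b.
    by rewrite (word_insert e) -catA.
  have e4 : word n.+1 t = a ++ col_c :: (s :: b) by rewrite (word_insert e).
  have sa1 : size (a ++ [:: col_c]) = (size a).+1 by rewrite size_cat addn1.
  rewrite (bcoface_right e2 (word_insert e2) sa1).
  rewrite (bcoface_right e4 (word_insert e4) erefl).
  exact: right_right_adjacent.
have [|a2 [u [c [e2 sa2]]]] := split t j.-1 n; first by lia.
have [b1 ha2] : exists b1, a2 = a ++ s :: b1.
  exists (take (j.-1 - (size a).+1) b).
  have -> : a2 = take j.-1 (word n t) by rewrite e2 -sa2 take_size_cat.
  rewrite e take_cat ifN; last by lia.
  by have -> : (j.-1 - size a = (j.-1 - (size a).+1).+1)%N by lia.
have hb : b = b1 ++ u :: c.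
  have h : word n t = a ++ s :: (b1 ++ u :: c) by rewrite e2 ha2 -catA.
  by have [] := cat_cons_inj (etrans (esym e) h) erefl.
subst a2 b; have e3 := e2.
have e4 : word n.+1 t = a ++ s :: (b1 ++ [:: col_c; u] ++ c).
  by rewrite (word_insert e2) -catA.
have e5 : word n.+1 t = (a ++ [:: col_c; s] ++ b1) ++ u :: c.
  by rewrite (word_insert e) -!catA.
have [j' jE] : exists j', j = j'.+1 by exists j.-1; lia.
subst j; have {}sa2 : size (a ++ s :: b1) = j' by exact: sa2.
rewrite (bcoface_right e2 (word_insert e2) sa2).
rewrite (bcoface_right e4 (word_insert e4) erefl).
have sj : size (a ++ [:: col_c; s] ++ b1) = j'.+1.
  by move: sa2; rewrite !size_cat /=; lia.
rewrite (bcoface_right e5 (word_insert e5) sj).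
exact: right_right_par.
Qed.

(** The delicate index is [n.+1], where a left action at color [c] has to match a right action on
    the input [o]; the two composites agree through [ast3]. *)
Lemma closing_comm n i (x : level col_c n) : (i <= n.+1)%N ->
  closing (bcoface i x) = bcoface i (closing x).
Proof.
have f1 : [:: col_c; col_c] = [::] ++ col_c :: [:: col_c] by [].
have fo : [:: col_c; col_o] = [::] ++ col_c :: [:: col_o] by [].
have f2 u : [:: col_c; u] = [:: col_c] ++ u :: [::] by [].
rewrite (closingE fo (word_o n)) (closingE fo (word_o n.+1)).
case: i => [_|i].
  rewrite (bcoface_left2 (f2 _) (word_left2 _ _)).
  rewrite (bcoface_left2 (f2 _) (word_left2 _ _)).
  exact: left1_left2.
rewrite ltnS leq_eqVlt => /predU1P[->|ni].
  rewrite (bcoface_left1 f1 (word_left1 n)).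
  have e4 : word n col_o = word n col_c ++ col_o :: [::] by exact: word_o.
  have sn : size (word n col_c) = n by rewrite size_word addn0.
  rewrite (bcoface_right e4 (word_insert e4) sn).
  exact: left1_left1.
have iw : (i < size (word n col_c))%N by rewrite size_word addn0.
have e := word_split iw.
have sa : size (take i (word n col_c)) = i by rewrite size_take iw.
move: e sa; set a := take _ _; set s := nth _ _ _; set b := drop _ _ => e sa.
have e4 : word n col_o = a ++ s :: (b ++ [:: col_o]) by rewrite word_o e /= -catA.
rewrite (bcoface_right e (word_insert e) sa) (bcoface_right e4 (word_insert e4) sa).
exact: left1_right.
Qed.

End Cofaces.

(** * Cofibrancy *)

Section HomCofaces.
Variables (M N : infbimod Act_pos) (f : infbimod_hom M N).

Lemma hom_bcoface t n i (x : level M t n) :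
  f _ _ (bcoface i x) = bcoface i (f _ _ x).
Proof.
rewrite /bcoface; case: i => [|k]; first exact: ih_left.
case: pselect => [h|_]; first exact: ih_right.
by case: t x => x; exact: ih_left.
Qed.

Lemma hom_closing n (x : level M col_c n) :
  f _ _ (closing x) = closing (f _ _ x).
Proof. exact: ih_left. Qed.

End HomCofaces.

Definition cast_word (M : infbimod Act_pos) t l l' (e : l = l') (x : M l t) :
    M l' t :=
  eq_rect l (fun l => M l t) x l' e.

Section Cofibrant.
Variable R : realType.
Local Notation D := (@D_seq R).
Notation rseq := (rseq R).
Variable B : infbimod_structure Act_pos D.
Hypothesis hB : D_operations B.
Let DB : infbimod Act_pos := InfBimod B.

Lemma D_code_prism t n (x : level DB t n) :
  prism (@param_range R t) n (D_code x).
Proof. by have [_] := D_codeP x; rewrite arity_word. Qed.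

Lemma D_code_bcoface t n i (x : level DB t n) : (i <= n.+1)%N ->
  D_code (bcoface i x) = coface1 i (D_code x).
Proof.
have [hx _] := D_code_prism x; rewrite /bcoface; case: i => [_|k kn].
  exact: (D_code_left2 hB).
case: pselect => [h|wk].
  rewrite (D_code_right hB) size_take; move: h; rewrite /is_true => ->.
  by [].
have [tc kE] : t = col_c /\ k = n.
  by move: wk; rewrite size_word; case: (t) => /= h; [|split=> //]; lia.
subst t k; rewrite [LHS](D_code_left1 hB).
by rewrite /coface1 (coface_last hx) -surjective_pairing.
Qed.

Lemma D_code_closing n (x : level DB col_c n) : D_code (closing x) = D_code x.
Proof. exact: (D_code_left1 hB). Qed.

Definition D_level t n (q : rseq * R) : level DB t n :=
  D_decode (word_has_inputs n t) q.

Lemma D_levelK t n q : prism (@param_range R t) n q -> D_code (D_level t n q) = q.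
Proof. by move=> hq; apply: D_decodeK; rewrite arity_word. Qed.

Lemma D_level_code t n (x : level DB t n) : D_level t n (D_code x) = x.
Proof. exact: D_codeK. Qed.

Lemma contOn_D_level t n : contOn (prism (@param_range R t) n) (D_level t n).
Proof. by have := @contOn_D_decode R _ _ (word_has_inputs n t); rewrite arity_word. Qed.

Lemma coface1_prism (U : set R) n i q : prism U n q -> prism U n.+1 (coface1 i q).
Proof. by case=> hq Uq; split=> //; exact: coface_nsimplex. Qed.

Lemma D_level_coface t n i q : prism (@param_range R t) n q -> (i <= n.+1)%N ->
  D_level t n.+1 (coface1 i q) = bcoface i (D_level t n q).
Proof.
move=> hq ni; apply: D_code_inj; rewrite D_code_bcoface // !D_levelK //.
exact: coface1_prism.
Qed.

Lemma closed_param_range t : closed (@param_range R t).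
Proof.
case: t => /=; last exact: (accessible_closed_set1 (hausdorff_accessible (@Rhausdorff R))).
have -> : [set s : R | 0 <= s <= 1] = `[0, 1]%classic.
  by apply/seteqP; split=> s; rewrite /= in_itv.
exact: interval_closed.
Qed.

Lemma param_range_c t : [set (1 : R)] `<=` @param_range R t.
Proof. by move=> _ ->; exact: param_range1. Qed.

Lemma prism_c t n q : prism (@param_range R col_c) n q -> prism (@param_range R t) n q.
Proof. by case=> hq Uq; split=> //; exact: param_range_c. Qed.

Section FromLevels.
Variables (X : infbimod Act_pos) (h : forall t n, rseq * R -> level X t n).
Arguments h : clear implicits.
Hypothesis hc : forall t n, contOn (prism (@param_range R t) n) (h t n).
Hypothesis hd : forall t n i q, prism (@param_range R t) n q -> (i <= n.+1)%N ->
  h t n.+1 (coface1 i q) = bcoface i (h t n q).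
Hypothesis ho : forall n q, prism (@param_range R col_c) n q ->
  h col_o n q = closing (h col_c n q).

(** A point of [D l t] forces [l] to be the word of its arity. The transport along this equality
    disappears on words, by [from_levelsE]. *)
Definition from_levels l t (x : DB l t) : X l t :=
  cast_word (esym (has_inputs_word (proj1 (D_codeP x)))) (h t (arity l t) (D_code x)).

Lemma from_levelsE n t (x : DB (word n t) t) :
  from_levels x = h t n (D_code x).
Proof.
rewrite /from_levels; move: (esym _); rewrite arity_word => e.
by rewrite (Prop_irrelevance e erefl).
Qed.

Lemma D_word l t (x : DB l t) : exists n, word n t = l.
Proof. by exists (arity l t); rewrite -has_inputs_word //; have [] := D_codeP x. Qed.

Lemma from_levels_continuous l t : continuous (@from_levels l t).
Proof.
have [hl|nhl] := pselect (has_inputs l t); last first.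
  by move=> x; have [] := D_codeP x.
have e := esym (has_inputs_word hl); move: (arity l t) e => n e; subst l.
have -> : @from_levels (word n t) t = h t n \o @D_code R (word n t) t.
  by apply/funext => x; rewrite from_levelsE.
apply: contOn_comp_continuous (@hc t n) _; first exact: continuous_D_code.
exact: D_code_prism.
Qed.

Lemma from_levels_right l a b l' s t (e : l = a ++ s :: b)
    (e' : l' = a ++ [:: col_c; s] ++ b) (x : DB l t) :
  from_levels (ib_right B e e' x (ast2 s)) = ib_right X e e' (from_levels x) (ast2 s).
Proof.
have [n e0] := D_word x; case: _ / e0 e x => e x.
have e1 : word n.+1 t = l' by rewrite e' (word_insert e).
case: _ / e1 e' => e'; rewrite !from_levelsE.
rewrite (D_code_right hB) hd; last 2 first.
- exact: D_code_prism.
- by have := size_word n t; rewrite e size_cat /=; case: (t) => /=; lia.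
by rewrite (bcoface_right e e' erefl).
Qed.

Lemma from_levels_left2 l l' t (e : [:: col_c; t] = [:: col_c] ++ t :: [::])
    (e' : l' = [:: col_c] ++ l ++ [::]) (x : DB l t) :
  from_levels (ib_left B e e' (ast2 t) x) = ib_left X e e' (ast2 t) (from_levels x).
Proof.
have [n e0] := D_word x; case: _ / e0 e' x => e' x.
have e1 : word n.+1 t = l' by rewrite e' word_left2.
case: _ / e1 e' => e'; rewrite !from_levelsE.
rewrite (D_code_left2 hB) hd //; last exact: D_code_prism.
by rewrite (bcoface_left2 e e').
Qed.

Lemma from_levels_left1 l l' t (e : [:: col_c; t] = [::] ++ col_c :: [:: t])
    (e' : l' = [::] ++ l ++ [:: t]) (x : DB l col_c) :
  from_levels (ib_left B e e' (ast2 t) x) = ib_left X e e' (ast2 t) (from_levels x).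
Proof.
have [n e0] := D_word x; case: _ / e0 e' x => e' x; have hx := D_code_prism x.
case: t e e' => e e'.
  have e1 : word n col_o = l' by rewrite e' word_o.
  case: _ / e1 e' => e'; rewrite !from_levelsE.
  by rewrite (D_code_left1 hB) ho // (closingE e e').
have e1 : word n.+1 col_c = l' by rewrite e' word_left1.
case: _ / e1 e' => e'; rewrite !from_levelsE.
rewrite (D_code_left1 hB) -(bcoface_left1 e e') -hd //; congr (h _ _ _).
by rewrite /coface1 (coface_last hx.1) -surjective_pairing.
Qed.

Definition hom_from_levels : infbimod_hom DB X.
Proof.
apply: (@InfBimodHom _ _ DB X from_levels).
- exact: from_levels_continuous.
- move=> *; apply: hom_left_of_generators.
  + exact: from_levels_left2.
  + exact: from_levels_left1.
- move=> *; apply: hom_right_of_generators; exact: from_levels_right.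
Defined.

End FromLevels.

Lemma D_cofibrant : cofibrant R DB.
Proof.
move=> X Y p fp wp f g _.
pose gn t n q := g _ _ (D_level t n q).
have gnc t n : contOn (prism (@param_range R t) n) (gn t n).
  apply: (contOn_comp (B := setT) (@contOn_D_level t n)) => //.
  by apply: contOnT; exact: ih_continuous.
have gnd t n i q : prism (@param_range R t) n q -> (i <= n.+1)%N ->
    gn t n.+1 (coface1 i q) = bcoface i (gn t n q).
  by move=> hq ni; rewrite /gn D_level_coface // hom_bcoface.
(* Over the empty set [V] nothing is prescribed, but a total map [k0] is still required, hence a
   point in every level; the argument of [gn] is arbitrary. *)
have inh n : exists x : level X col_c n, True.
  have [x _] := point_lift (fp _ _) (wp (word n col_c) col_c)
    (gn col_c n (fun=> 0, 0)).
  by exists x.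
pose k0 n (_ : rseq * R) := projT1 (cid (inh n)).
have [hc hcP] : exists h : forall n, rseq * R -> level X col_c n, forall n,
    lift_at (@param_range R col_c) set0 (fun n => p (word n col_c) col_c)
      (gn col_c) k0 (h n) /\
    cosimplicial_at (@param_range R col_c) (@bcoface X col_c) (h n) (h n.+1).
  apply: (@cosimplicial_lift R _ _ _ _ _ _ _ _ _ (@bcoface Y col_c)).
  - exact: closed_param_range.
  - exact: closed0.
  - by move=> ?.
  - exact: bcoface_continuous.
  - exact: bcoface_comm.
  - by move=> n i x _; exact: hom_bcoface.
  - exact: gnc.
  - exact: gnd.
  - by move=> n q [].
  - by move=> n i q [].
  - by move=> n q [].
  - by move=> n; apply: prism_cst_lifts; [exact: fp|exact: wp].
have hcc n : contOn (prism (@param_range R col_c) n) (hc n).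
  by have [[]] := hcP n.
have phc n q : prism (@param_range R col_c) n q -> p _ _ (hc n q) = gn col_c n q.
  by have [[_ + _] _] := hcP n; exact.
(* At parameter 1 the value at color [o] is forced by [ast2o \circ_1 -] from the lift already built
   at color [c]. *)
pose k1 n q := closing (hc n q).
have [h_o hoP] : exists h : forall n, rseq * R -> level X col_o n, forall n,
    lift_at (@param_range R col_o) [set 1] (fun n => p (word n col_o) col_o)
      (gn col_o) k1 (h n) /\
    cosimplicial_at (@param_range R col_o) (@bcoface X col_o) (h n) (h n.+1).
  apply: (@cosimplicial_lift R _ _ _ _ _ _ _ _ _ (@bcoface Y col_o)).
  - exact: closed_param_range.
  - exact: (@closed_param_range col_c).
  - exact: param_range_c.
  - exact: bcoface_continuous.
  - exact: bcoface_comm.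
  - by move=> n i x _; exact: hom_bcoface.
  - exact: gnc.
  - exact: gnd.
  - move=> n; apply: (contOn_comp (B := setT) (hcc n)) => //.
    by apply: contOnT; exact: closing_continuous.
  - by move=> n i q hq ni; rewrite /k1 (hcP n).2 // closing_comm.
  - move=> n q hq; rewrite /k1 hom_closing phc // /gn -hom_closing; congr (g _ _ _).
    apply: D_code_inj; rewrite D_code_closing !D_levelK //.
    exact: prism_c.
  - by move=> n; apply: prism_lifts; exact: fp.
have hoc n : contOn (prism (@param_range R col_o) n) (h_o n).
  by have [[]] := hoP n.
have pho n q : prism (@param_range R col_o) n q -> p _ _ (h_o n q) = gn col_o n q.
  by have [[_ + _] _] := hoP n; exact.
pose h t : forall n, rseq * R -> level X t n :=
  if t is col_o return forall n, rseq * R -> level X t n then h_o else hc.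
have h_cont t n : contOn (prism (@param_range R t) n) (h t n) by case: t.
have h_coface t n i q : prism (@param_range R t) n q -> (i <= n.+1)%N ->
    h t n.+1 (coface1 i q) = bcoface i (h t n q).
  by case: t => hq ni; [exact: (hoP n).2|exact: (hcP n).2].
have h_closing n q : prism (@param_range R col_c) n q ->
    h col_o n q = closing (h col_c n q) by have [[_ _ +] _] := hoP n; exact.
exists (hom_from_levels h_cont h_coface h_closing); split.
  by move=> l t a; case: (pt_prop a).
move=> l t x; have [n e0] := D_word x; case: _ / e0 x => x.
rewrite /= from_levelsE -[in RHS](D_level_code x).
have hx := D_code_prism x; rewrite -/(gn t n (D_code x)).
by case: t x hx => x hx; [exact: pho|exact: phc].
Qed.

End Cofibrant.

(** * The weak equivalence *)

Section ToAct.
Variable R : realType.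
Local Notation D := (@D_seq R).
Notation rseq := (rseq R).
Variable B : infbimod_structure Act_pos D.

Definition D_to_Act : infbimod_hom (InfBimod B) Act_bimod.
Proof.
apply: (@InfBimodHom _ _ (InfBimod B) Act_bimod
  (fun l t (x : D l t) => pt (proj1 (D_codeP x)))).
- by move=> *; exact: pt_continuous.
- by move=> *; exact: pt_eq.
- by move=> *; exact: pt_eq.
Defined.

Definition interpolate (s : R) (q q' : rseq * R) : rseq * R :=
  (fun j => (1 - s) * q.1 j + s * q'.1 j, (1 - s) * q.2 + s * q'.2).

Lemma interpolate0 q q' : interpolate 0 q q' = q.
Proof.
rewrite [RHS]surjective_pairing /interpolate subr0 !mul1r mul0r addr0; congr pair.
by apply/funext => j; rewrite mul1r mul0r addr0.
Qed.

Lemma interpolate1 q q' : interpolate 1 q q' = q'.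
Proof.
rewrite [RHS]surjective_pairing /interpolate subrr !mul1r mul0r add0r; congr pair.
by apply/funext => j; rewrite mul1r mul0r add0r.
Qed.

Lemma interpolate_id s q : interpolate s q q = q.
Proof.
rewrite [RHS]surjective_pairing /interpolate; congr pair; last by ring.
by apply/funext => j; ring.
Qed.

Lemma interpolate_prism t n s q q' : 0 <= s <= 1 ->
  prism (@param_range R t) n q -> prism (@param_range R t) n q' ->
  prism (@param_range R t) n (interpolate s q q').
Proof.
move=> /andP[s0 s1] [[a0 aS a1] au] [[b0 bS b1] bu]; split; first split => /=.
- by rewrite a0 b0; ring.
- by move=> i; apply: lerD; apply: ler_wpM2l => //; rewrite subr_ge0.
- by move=> i ni; rewrite a1 // b1 //; ring.
case: t au bu => /=; last by move=> -> ->; ring.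
by move=> /andP[? ?] /andP[? ?]; apply/andP; split; nra.
Qed.

Lemma continuous_interpolate (T : topologicalType) (s : T -> R)
    (f f' : T -> (rseq * R)%type) :
  continuous s -> continuous f -> continuous f' ->
  continuous (fun x => interpolate (s x) (f x) (f' x)).
Proof.
move=> cs cf cf'.
have c1 : continuous (fun x => 1 - s x).
  by apply: continuous_add; [exact: continuous_cst|exact: continuous_opp].
have cfst (k : T -> (rseq * R)%type) : continuous k -> continuous (fun x => (k x).1).
  by move=> ck; exact: continuous_compose ck (@continuous_fst _ _).
have csnd (k : T -> (rseq * R)%type) : continuous k -> continuous (fun x => (k x).2).
  by move=> ck; exact: continuous_compose ck (@continuous_snd _ _).
apply: continuous_pair.
  apply: continuous_rseq => j; apply: continuous_add; apply: continuous_mul => //.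
    exact: (continuous_coord_of (i := j) (cfst _ cf)).
  exact: (continuous_coord_of (i := j) (cfst _ cf')).
by apply: continuous_add; apply: continuous_mul => //; exact: csnd.
Qed.

Section StraightLine.
Variables (l : seq color) (t : color) (T : topologicalType) (f f' : T -> D l t).
Hypotheses (cf : continuous f) (cf' : continuous f').

(** The coded points form a convex set, and interpolation does not move a point at which the two
    maps agree; this makes the homotopies relative to the boundary. *)
Lemma straight_line : exists H : (T * itv R)%type -> D l t,
  [/\ continuous H, forall u, H (u, itv0 R) = f u, forall u, H (u, itv1 R) = f' u
    & forall u s, f u = f' u -> H (u, s) = f u].
Proof.
have [hl|nhl] := pselect (has_inputs l t); last first.
  have nT u : False := nhl (proj1 (D_codeP (f u))).
  by exists (fun p => f p.1); split=> u; [case: (nT u.1)|case: (nT u)..].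
pose q (p : T * itv R) := interpolate (itv_val p.2) (D_code (f p.1)) (D_code (f' p.1)).
have pq p : prism (@param_range R t) (arity l t) (q p).
  by apply: interpolate_prism; [exact: itv_val_itv|exact: (proj2 (D_codeP _))..].
have cq : continuous q.
  have cfst (k : T -> D l t) : continuous k ->
      continuous (fun p : T * itv R => D_code (k p.1)).
    move=> ck; apply: (continuous_compose _ (@continuous_D_code _ _ _)).
    exact: continuous_compose (@continuous_fst _ _) ck.
  apply: continuous_interpolate; [|exact: cfst..].
  exact: continuous_compose (@continuous_snd _ _) (@continuous_itv_val R).
exists (fun p => D_decode hl (q p)); split.
- exact: contOn_comp_continuous cq (@contOn_D_decode R _ _ hl) pq.
- move=> u; rewrite /q /= -itv_of0 itv_ofK ?lexx ?ler01 // interpolate0.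
  exact: D_codeK.
- move=> u; rewrite /q /= -itv_of1 itv_ofK ?lexx ?ler01 // interpolate1.
  exact: D_codeK.
- by move=> u s e; rewrite /q /= -e interpolate_id D_codeK.
Qed.

End StraightLine.

Lemma D_to_Act_weak_equivalence : weak_equivalence R D_to_Act.
Proof.
move=> l t; split; first exact: pt_continuous.
- split=> [x x' _|y].
    have [H [cH H0 H1 _]] := straight_line (@continuous_cst _ _ x)
      (@continuous_cst (itv R) _ x').
    exists (fun s => H (itv0 R, s)); split; [|exact: H0|exact: H1].
    apply: continuous_compose cH; apply: continuous_pair.
      exact: continuous_cst.
    by move=> s; exact: cvg_id.
  have [x _] := D_inhabited R (pt_prop y); exists x.
  by exists (fun=> y); split; [exact: continuous_cst|exact: pt_eq|].
- move=> n x _; split=> [al al' [cal alx] [cal' alx'] _|be [cbe bex]].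
    have [H [cH H0 H1 He]] := straight_line cal cal'.
    by exists H; split=> // u s hu; apply: He; rewrite alx ?alx'.
  exists (fun=> x); first by split=> //; exact: continuous_cst.
  exists (fun p => be p.1); split.
  + exact: continuous_compose (@continuous_fst _ _) cbe.
  + by move=> u; exact: pt_eq.
  + by [].
  + by move=> u s _; exact: pt_eq.
Qed.

End ToAct.

(** The structure is described by its values on generators, so the claim has two halves: these
    values extend to a structure, and every structure with these values gives a cofibrant
    replacement. *)
Theorem proposition3p10 (R : realType) :
  (exists B : infbimod_structure Act_pos (@D_seq R), @D_operations R B) /\
  (forall B : infbimod_structure Act_pos (@D_seq R), @D_operations R B ->
     cofibrant_replacement R (InfBimod B) Act_bimod).
Proof.
split; first by exists (D_structure R); exact: D_structure_operations.
move=> B hB; split; first exact: D_cofibrant.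
by exists (D_to_Act B); exact: D_to_Act_weak_equivalence.
Qed.
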